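(* Let $(X,d,G)$ be a $G$-system and $\{F_n\}$ a tempered Følner sequence of $G$. Then for every $f\in C(X,\mathbb R)$, $$\overline{\mathrm{mdim}}_M(G,X,f,d)=\max_{\mu\in M(X,G)}\Big\{\overline{\mathrm{mdim}}_M(\mu,\{F_n\},d)+\int f\,d\mu\Big\}.$$
   Context: $G$ is a countably infinite discrete amenable group; $(X,d,G)$ a compact metric space with continuous $G$-action by homeomorphisms. Følner: nonempty finite $F_n$ with $|gF_n\triangle F_n|/|F_n|\to0$; tempered: $|\bigcup_{j<n}F_j^{-1}F_n|\le C|F_n|$. $d_F(x,y)=\max_{g\in F}d(gx,gy)$. For $f\in C(X,\mathbb R)$ and finite $F$, $S_Ff(x)=\sum_{g\in F}f(gx)$ and $P_F(X,f,d,\epsilon)=\sup\{\sum_{x\in E}e^{S_Ff(x)}:E\subset X,\ d_F(x,y)>\epsilon\ \forall x\ne y\in E\}$; $P(X,f,d,\{F_n\},\epsilon)=\limsup_n\frac1{|F_n|}\log P_{F_n}(X,f,d,\epsilon)$. Upper metric mean dimension with potential: $\overline{\mathrm{mdim}}_M(G,X,f,d)=\limsup_{\epsilon\to0}\frac{1}{\log(1/\epsilon)}P(X,f\log\frac1\epsilon,d,\{F_n\},\epsilon)$. $M(X,G)$: invariant Borel probability measures (weak* ); $E(X,G)$: ergodic; $\mathrm{co}(E(X,G))$: finite convex combinations $\mu=\sum_j\lambda_j\mu_j$ (unique, distinct ergodic $\mu_j$, $\lambda_j>0$). $h_\nu(G,\alpha)=\lim_n\frac1{|F_n|}H_\nu(\bigvee_{g\in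 F_n}g^{-1}\alpha)$; for ergodic $\nu$, $h_\nu(\epsilon)=\inf\{h_\nu(G,\alpha):\alpha$ finite Borel partition, $\mathrm{diam}(\alpha)\le\epsilon\}$; $F(\mu,\epsilon)=\sum_j\lambda_jh_{\mu_j}(\epsilon)$ for $\mu\in\mathrm{co}(E(X,G))$. $M_G(\mu)$: families $(\mu_\epsilon)_{\epsilon>0}\subset\mathrm{co}(E(X,G))$ converging weak* to $\mu$ as $\epsilon\to0$. $\overline{\mathrm{mdim}}_M(\mu,\{F_n\},d)=\sup_{(\mu_\epsilon)\in M_G(\mu)}\limsup_{\epsilon\to0}F(\mu_\epsilon,\epsilon)/\log\frac1\epsilon$. *)

(* Defs.v *)
From HB Require Import structures.
From mathcomp Require Import all_boot all_order all_algebra.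
From mathcomp Require Import finmap.
From Stdlib Require List.
From mathcomp Require Import all_classical all_reals all_analysis.

Set Implicit Arguments.
Unset Strict Implicit.
Unset Printing Implicit Defensive.

Import Order.TTheory GRing.Theory Num.Theory.
Import numFieldNormedType.Exports.
Local Open Scope classical_set_scope.
Local Open Scope ring_scope.

Section GSystems.
Variable R : realType.
Variable G : groupType.
Variables (disp : measure_display) (X : measurableType disp).
Variable d : X -> X -> R.
Variable act : G -> X -> X.

Definition countably_infinite_group : Prop :=
  (exists e : G -> nat, injective e) /\ (exists e : nat -> G, injective e).

Definition lmul_fset (g : G) (A : {fset G}) : {fset G} := [fset (g * a)%g | a in A]%fset.

Definition Folner (F : nat -> {fset G}) : Prop :=
  (forall n, F n != fset0) /\
  forall g : G,
    (fun n => ((#|` (lmul_fset g (F n) `\` F n)%fset| + #|` (F n `\` lmul_fset g (F n))%fset|)%:R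
               / (#|` F n|%:R) : R)) @ \oo --> (0 : R).

Definition tempered (F : nat -> {fset G}) : Prop :=
  exists C : R, forall n : nat,
    (#|` (\bigcup_(j <- iota 0 n) [fset ((a^-1) * b)%g | a in F j, b in F n])%fset|%:R : R)
      <= C * (#|` F n|%:R).

Definition is_metric : Prop :=
  (forall x y, d x y = 0 <-> x = y) /\ (forall x y, d x y = d y x) /\
  (forall x y z, d x z <= d x y + d y z).

Definition dopen (U : set X) : Prop :=
  forall x, U x -> exists2 r : R, 0 < r & [set y | d x y < r] `<=` U.

Definition dcompact : Prop :=
  forall (I : Type) (U : I -> set X), (forall i, dopen (U i)) ->
    [set: X] `<=` \bigcup_i U i ->
    exists s : seq I, forall x : X, exists2 i, List.In i s & U i x.

Definition borel_for_d : Prop :=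
  forall A : set X, measurable A <-> <<s dopen >> A.

Definition dcontinuous (h : X -> X) : Prop :=
  forall x (e : R), 0 < e -> exists2 r : R, 0 < r & forall y, d x y < r -> d (h x) (h y) < e.

Definition dcontinuous_real (h : X -> R) : Prop :=
  forall x (e : R), 0 < e -> exists2 r : R, 0 < r & forall y, d x y < r -> `|h x - h y| < e.

(* continuous G-action by homeomorphisms (homeomorphism follows from the action laws) *)
Definition G_action : Prop :=
  (forall x, act 1%g x = x) /\ (forall g h x, act (g * h)%g x = act g (act h x)) /\
  (forall g, dcontinuous (act g)).

Definition dF (F : {fset G}) (x y : X) : R :=
  \big[Num.max/0]_(g <- F) d (act g x) (act g y).

Definition SF (F : {fset G}) (phi : X -> R) (x : X) : R := \sum_(g <- F) phi (act g x).

Definition separated (F : {fset G}) (eps : R) (E : seq X) : Prop :=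
  uniq E /\ forall x y, x \in E -> y \in E -> x != y -> eps < dF F x y.

Definition PF (F : {fset G}) (phi : X -> R) (eps : R) : R :=
  sup [set (\sum_(x <- E) expR (SF F phi x)) | E in separated F eps].

Definition pressure (phi : X -> R) (F : nat -> {fset G}) (eps : R) : \bar R :=
  limn_esup (fun n => (ln (PF (F n) phi eps) / (#|` F n|%:R))%:E).

Definition umdim_pot (f : X -> R) (F : nat -> {fset G}) : \bar R :=
  limf_esup (fun eps : R =>
     (pressure (fun x => (f x * ln eps^-1)%R) F eps * ((ln eps^-1)^-1)%:E)%E) (0%R^'+).

Definition G_invariant (mu : probability X R) : Prop :=
  forall g A, measurable A -> mu (act g @^-1` A) = mu A.

Definition G_ergodic (mu : probability X R) : Prop :=
  G_invariant mu /\
  forall A, measurable A -> (forall g, act g @^-1` A = A) -> mu A = 0%E \/ mu A = 1%E.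

Definition finite_partition (k : nat) (alpha : 'I_k -> set X) : Prop :=
  (forall i, measurable (alpha i)) /\
  (forall i j, i != j -> alpha i `&` alpha j = set0) /\
  \bigcup_i alpha i = [set: X].

Definition diam (A : set X) : \bar R :=
  ereal_sup [set (d p.1 p.2)%:E | p in A `*` A].

Definition diam_part (k : nat) (alpha : 'I_k -> set X) : \bar R :=
  \big[maxe/-oo%E]_(i < k) diam (alpha i).

Definition entr_fun (t : R) : R := - (t * ln t).

(* H_mu of the join \/_{g in F} g^{-1} alpha, indexing cells by c : F -> 'I_k *)
Definition H_join (mu : probability X R) (F : {fset G}) (k : nat) (alpha : 'I_k -> set X) : R :=
  let s := (F : seq G) in
  \sum_(c : {ffun 'I_(size s) -> 'I_k})
     entr_fun (fine (mu [set x | forall j : 'I_(size s), alpha (c j) (act (nth 1%g s j) x)])).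

Definition h_part (mu : probability X R) (F : nat -> {fset G}) (k : nat) (alpha : 'I_k -> set X) : R :=
  limn (fun n => H_join mu (F n) alpha / (#|` F n|%:R)).

Definition h_eps (mu : probability X R) (F : nat -> {fset G}) (eps : R) : \bar R :=
  ereal_inf [set v | exists (k : nat) (alpha : 'I_k -> set X),
      [/\ finite_partition alpha, (diam_part alpha <= eps%:E)%E & v = (h_part mu F alpha)%:E]].

Record co_decomp := CoDecomp {
  cd_k : nat;
  cd_lam : 'I_cd_k -> R;
  cd_nu : 'I_cd_k -> probability X R }.

Definition is_co_decomp (mu : probability X R) (D : co_decomp) : Prop :=
  [/\ forall i : 'I_(cd_k D), 0 < @cd_lam D i,
      \sum_(i < cd_k D) @cd_lam D i = 1,
      forall i : 'I_(cd_k D), G_ergodic (@cd_nu D i),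
      forall i j : 'I_(cd_k D), (@cd_nu D i : set X -> \bar R) = @cd_nu D j -> i = j &
      forall A, measurable A -> mu A = (\sum_(i < cd_k D) (@cd_lam D i)%:E * @cd_nu D i A)%E].

Definition F_co (F : nat -> {fset G}) (D : co_decomp) (eps : R) : \bar R :=
  (\sum_(i < cd_k D) (@cd_lam D i)%:E * h_eps (@cd_nu D i) F eps)%E.

Definition weak_star_to (mus : R -> probability X R) (mu : probability X R) : Prop :=
  forall phi : X -> R, dcontinuous_real phi ->
    (fun eps => (\int[mus eps]_x (phi x)%:E)%E) @ (0%R^'+) --> (\int[mu]_x (phi x)%:E)%E.

Definition umdim_mu (mu : probability X R) (F : nat -> {fset G}) : \bar R :=
  ereal_sup [set v | exists (mus : R -> probability X R) (D : R -> co_decomp),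
     [/\ forall eps, 0 < eps -> is_co_decomp (mus eps) (D eps),
         weak_star_to mus mu &
         v = limf_esup (fun eps : R => (F_co F (D eps) eps * ((ln eps^-1)^-1)%:E)%E) (0%R^'+)]].

End GSystems.

(* Main.v *)
(* Upper bound. Let [nu] be ergodic and let [phi] oscillate by at most [w] on
   balls of radius [r]; then [h_nu(2r) <= P(phi, r) + w - \int phi dnu]. If
   stabilizers are infinite, [nu] has zero entropy. Otherwise almost all of them
   have the same number [m] of elements, and Folner shapes [T_i] can be placed
   greedily on base sets [B_i] so that nearly every point is covered [m] times
   and [\sum |T_i| nu(B_i)] is close to [m]. Recording at each base point the
   nearest element of an [r]-spanning set of [T_i] gives a labelling [gamma]
   whose entropy is at most [m (P + w - \int phi dnu)] by the Gibbs inequality.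
   The window names of [gamma] locate points up to [2r], and since each letter
   is read [m] times along the stabilizers, the entropy of the process generated
   by [gamma] is at most [1/m] times the entropy of [gamma]. The potential
   [phi = f log(1/r)] and summation over ergodic components give one inequality.

   Lower bound. Averaging weighted separated sets along [F_n] (Misiurewicz) and
   using Shearer's inequality instead of tilings yields, for every [c < P(phi, eps)],
   an invariant measure with [c <= H(names on K) / |K| + \int phi] for all
   partitions finer than [eps] and all finite windows [K]. For the largest
   possible [c] these measures form a closed face, in which successive
   maximisation of a countable determining family of integrals selects an ergodic
   measure. A weak limit of such measures along scales tending to [0] attains the
   maximum. *)

Require Import Defs.
From HB Require Import structures.
From mathcomp Require Import all_boot all_order all_algebra.
From mathcomp Require Import finmap.
From mathcomp Require Import all_classical all_reals all_analysis.
From mathcomp Require Import measurable_realfun ring lra.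
Import Order.TTheory GRing.Theory Num.Theory.
Import numFieldNormedType.Exports.
Local Open Scope classical_set_scope.
Local Open Scope ring_scope.
Set Implicit Arguments.
Unset Strict Implicit.
Unset Printing Implicit Defensive.

(** * The entropy function *)

(** Maximality of [c] is what makes the good measures a face: if one of two invariant parts fell
    short for some partition, the other part, which cannot exceed the maximum, would have a
    partition keeping it near the maximum, and the two partitions glued along the invariant set
    would violate the bound for the whole. Factors of 2 in the scales are harmless because
    [ln (1 / eps)] then changes by [ln 2] only. Likewise the oscillation of [f ln (1 / r)] on balls
    of radius [r], divided by [ln (1 / r)], is that of [f], which tends to 0. In the upper bound the
    number of tile shapes is fixed before their sizes: each base set adds the entropy of its
    indicator, and these terms become small only when the shapes are large. *)

Section FiniteEntropy.
Variable R : realType.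
Implicit Types (p q t : R).
Local Notation entr := (@entr_fun R).

Lemma entr0 : entr 0 = 0. Proof. by rewrite /entr_fun mul0r oppr0. Qed.

Lemma entr1 : entr 1 = 0. Proof. by rewrite /entr_fun ln1 mulr0 oppr0. Qed.

(** Tangent line of the concave function [entr], in the form [ln (q / p) <= q / p - 1]. Since
    [ln 0 = 0] here, the case [q = 0 < p] has to be excluded; this is absolute continuity. [gibbs],
    [ssa] and [entr_concave] sum instances of it. *)
Lemma entr_le p q : 0 <= p -> 0 <= q -> (q = 0 -> p = 0) ->
  entr p <= - (p * ln q) + (q - p).
Proof.
move=> p0 q0 qp; case: (eqVneq p 0) => [->|pn0].
  by rewrite entr0 mul0r oppr0 add0r addr0.
have pp : 0 < p by rewrite lt_neqAle eq_sym pn0.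
have qn0 : q != 0 by apply: contra_neq pn0 => /qp.
have qq : 0 < q by rewrite lt_neqAle eq_sym qn0.
have : ln (q / p) <= q / p - 1.
  have := @le_ln1Dx R (q / p - 1); rewrite addrCA subrr addr0; apply.
  by rewrite ltrBDl subrr divr_gt0.
rewrite ln_div// -(ler_pM2l pp) => h.
have -> : q - p = p * (q / p - 1) by rewrite mulrBr mulr1 mulrCA divff ?mulr1.
rewrite /entr_fun -subr_ge0; apply: le_trans (_ : 0 <= p * (q / p - 1) - p * (ln q - ln p)) _.
  by rewrite subr_ge0.
by rewrite le_eqVlt; apply/orP; left; apply/eqP; ring.
Qed.

Lemma entr_ge0 p : p <= 1 -> 0 <= entr p.
Proof.
move=> p1; have [p0|p0] := leP p 0; first by rewrite /entr_fun ln0// mulr0 oppr0.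
by rewrite /entr_fun oppr_ge0 mulr_ge0_le0 ?ln_le0// ltW.
Qed.

Lemma entrM p q : 0 <= p -> 0 <= q -> entr (p * q) = p * entr q + q * entr p.
Proof.
rewrite le_eqVlt => /predU1P[<-|p0]; first by rewrite !mul0r entr0 mulr0 addr0.
rewrite le_eqVlt => /predU1P[<-|q0]; first by rewrite mulr0 entr0 mulr0 mul0r addr0.
by rewrite /entr_fun lnM//; ring.
Qed.

(** Sum of the tangent bounds of [entr_le] at the Gibbs weights [q i = P e^{a i} / Z], whose total
    mass is again [P]. The masses are not normalised because the inequality is used on pieces of the
    space. *)
Lemma gibbs (I : finType) (p a : I -> R) : (forall i, 0 <= p i) ->
  \sum_i entr (p i) + \sum_i p i * a i <=
  entr (\sum_i p i) + (\sum_i p i) * ln (\sum_i expR (a i)).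
Proof.
move=> p0; set P := \sum_i p i; set Z := \sum_i expR (a i).
have P0 : 0 <= P by apply: sumr_ge0.
case: (eqVneq P 0) => [P00|Pn0].
  have pz i : p i = 0.
    by apply/eqP; rewrite eq_le p0 andbT -P00 /P (bigD1 i)//= lerDl sumr_ge0.
  rewrite P00 entr0 mul0r addr0 !big1 ?addr0// => i _; by rewrite pz ?entr0 ?mul0r.
have PP : 0 < P by rewrite lt_neqAle eq_sym Pn0.
have [i0 _|I0] := pickP (@predT I); last first.
  by move: Pn0; rewrite /P big1 ?eqxx// => i; have := I0 i.
have Z0 : 0 < Z.
  by rewrite /Z (bigD1 i0)//= ltr_wpDr ?expR_gt0// sumr_ge0// => i _; exact: expR_ge0.
pose q i := P * expR (a i) / Z.
have q0 i : 0 < q i by rewrite divr_gt0// mulr_gt0// expR_gt0.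
have sq : \sum_i q i = P by rewrite /q -mulr_suml -mulr_sumr mulfK// gt_eqF.
have lnq i : ln (q i) = ln P + a i - ln Z.
  by rewrite /q ln_div ?lnM ?expRK// posrE ?mulr_gt0 ?expR_gt0.
have : \sum_i entr (p i) <= \sum_i (- (p i * ln (q i)) + (q i - p i)).
  by apply: ler_sum => i _; apply: entr_le => //; [exact: ltW | move/eqP; rewrite gt_eqF].
have -> : \sum_i (- (p i * ln (q i)) + (q i - p i)) =
    - (P * ln P) - \sum_i p i * a i + P * ln Z.
  rewrite big_split/= sumrB sq subrr addr0.
  under eq_bigr do rewrite lnq mulrBr mulrDr.
  by rewrite sumrN sumrB big_split/= -!mulr_suml -/P; ring.
by rewrite /entr_fun => h; lra.
Qed.

Lemma entr_sum_le (I : finType) (P : pred I) (p : I -> R) : (forall i, 0 <= p i) ->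
  entr (\sum_(i | P i) p i) <= \sum_(i | P i) entr (p i).
Proof.
move=> p0; set S := \sum_(i | P i) p i.
rewrite {1}/entr_fun {1}/S mulr_suml -sumrN; apply: ler_sum => i Pi.
rewrite /entr_fun lerN2; have := p0 i.
rewrite le_eqVlt => /predU1P[<-|pi0]; first by rewrite !mul0r.
have piS : p i <= S by rewrite /S (bigD1 i)//= lerDl sumr_ge0.
by rewrite ler_pM2l// ler_ln ?posrE// (lt_le_trans pi0).
Qed.

(** Compares [p] with [q a b c = u a c * v b c / w c], which makes the first two coordinates
    independent given the third. Both have the same total mass, so the corrections [q - p] of the
    tangent bound cancel. *)
Lemma ssa (A B C : finType) (p : A -> B -> C -> R) : (forall a b c, 0 <= p a b c) ->
  \sum_a \sum_b \sum_c entr (p a b c) + \sum_c entr (\sum_a \sum_b p a b c) <=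
  \sum_a \sum_c entr (\sum_b p a b c) + \sum_b \sum_c entr (\sum_a p a b c).
Proof.
move=> p0; pose u a c := \sum_b p a b c; pose v b c := \sum_a p a b c.
pose w c := \sum_a \sum_b p a b c.
have u0 a c : 0 <= u a c by apply: sumr_ge0.
have v0 b c : 0 <= v b c by apply: sumr_ge0.
have w0 c : 0 <= w c by apply: sumr_ge0 => a _; apply: sumr_ge0.
have wu c : w c = \sum_a u a c by [].
have wv c : w c = \sum_b v b c by rewrite /w exchange_big.
have pu a b c : p a b c <= u a c by rewrite /u (bigD1 b)//= lerDl sumr_ge0.
have pv a b c : p a b c <= v b c by rewrite /v (bigD1 a)//= lerDl sumr_ge0.
have uw a c : u a c <= w c by rewrite wu (bigD1 a)//= lerDl sumr_ge0.
pose q a b c := u a c * v b c / w c.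
have key a b c : entr (p a b c) <=
    - (p a b c * ln (u a c)) - p a b c * ln (v b c) + p a b c * ln (w c) + (q a b c - p a b c).
  case: (eqVneq (p a b c) 0) => [->|pn0].
    by rewrite entr0 !mul0r !oppr0 !add0r !addr0 divr_ge0// mulr_ge0.
  have pp : 0 < p a b c by rewrite lt_neqAle eq_sym pn0 p0.
  have up : 0 < u a c by exact: lt_le_trans (pu a b c).
  have vp : 0 < v b c by exact: lt_le_trans (pv a b c).
  have wp : 0 < w c by exact: lt_le_trans (uw a c).
  have qp : 0 < q a b c by rewrite divr_gt0// mulr_gt0.
  apply: le_trans (entr_le (p0 a b c) (ltW qp) _) _.
    by move/eqP; rewrite gt_eqF.
  rewrite le_eqVlt; apply/orP; left; apply/eqP.
  rewrite /q ln_div ?posrE ?mulr_gt0// lnM ?posrE//; ring.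
have qs : \sum_a \sum_b \sum_c q a b c = \sum_c w c.
  rewrite exchange_big/=; under eq_bigr do rewrite exchange_big/=.
  rewrite exchange_big/=; apply: eq_bigr => c _.
  rewrite exchange_big/=; under eq_bigr => a _.
    under eq_bigr => b _ do rewrite /q mulrAC.
    rewrite -mulr_sumr -wv; over.
  case: (eqVneq (w c) 0) => [->|wn0].
    by rewrite big1// => a _; rewrite mulr0.
  by under eq_bigr => a _ do rewrite divfK//.
have ps : \sum_a \sum_b \sum_c p a b c = \sum_c w c.
  rewrite exchange_big/=; under eq_bigr do rewrite exchange_big/=.
  rewrite exchange_big/=; apply: eq_bigr => c _.
  by rewrite exchange_big.
have : \sum_a \sum_b \sum_c entr (p a b c) <=
  \sum_a \sum_b \sum_c (- (p a b c * ln (u a c)) - p a b c * ln (v b c) + p a b c * ln (w c) + (q a b c - p a b c)).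
  by do 3! (apply: ler_sum => ? _); exact: key.
have split4 (f1 f2 f3 f4 f5 : A -> B -> C -> R) :
  \sum_a \sum_b \sum_c (- f1 a b c - f2 a b c + f3 a b c + (f4 a b c - f5 a b c)) =
  - (\sum_a \sum_b \sum_c f1 a b c) - \sum_a \sum_b \sum_c f2 a b c
  + \sum_a \sum_b \sum_c f3 a b c + (\sum_a \sum_b \sum_c f4 a b c - \sum_a \sum_b \sum_c f5 a b c).
  have s1 (f g : A -> B -> C -> R) : \sum_a \sum_b \sum_c (f a b c + g a b c) =
     \sum_a \sum_b \sum_c f a b c + \sum_a \sum_b \sum_c g a b c.
    rewrite -big_split; apply: eq_bigr => a _; rewrite -big_split; apply: eq_bigr => b _.
    by rewrite -big_split.
  have s2 (f : A -> B -> C -> R) : \sum_a \sum_b \sum_c - f a b c = - \sum_a \sum_b \sum_c f a b c.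
    rewrite -sumrN; apply: eq_bigr => a _; rewrite -sumrN; apply: eq_bigr => b _.
    by rewrite -sumrN.
  by rewrite !s1 !s2.
rewrite (split4 _ _ _ _ p) qs ps subrr addr0.
have -> : \sum_a \sum_b \sum_c p a b c * ln (u a c) = - \sum_a \sum_c entr (u a c).
  rewrite -sumrN; apply: eq_bigr => a _; rewrite exchange_big/= -sumrN; apply: eq_bigr => c _.
  by rewrite -mulr_suml /entr_fun opprK.
have -> : \sum_a \sum_b \sum_c p a b c * ln (v b c) = - \sum_b \sum_c entr (v b c).
  rewrite exchange_big/= -sumrN; apply: eq_bigr => b _; rewrite exchange_big/= -sumrN; apply: eq_bigr => c _.
  by rewrite -mulr_suml /entr_fun opprK.
have -> : \sum_a \sum_b \sum_c p a b c * ln (w c) = - \sum_c entr (w c).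
  under eq_bigr do rewrite exchange_big/=.
  rewrite exchange_big/= -sumrN; apply: eq_bigr => c _.
  under eq_bigr do rewrite -mulr_suml.
  by rewrite -mulr_suml /entr_fun opprK.
by rewrite /u /v /w => h; lra.
Qed.

(** Jensen's inequality, from the tangent line at the mean [q]: the linear corrections [q - p i] sum
    to zero. *)
Lemma entr_concave (I : Type) (s : seq I) (p : I -> R) : (forall i, 0 <= p i) ->
  (0 < size s)%N ->
  \sum_(i <- s) entr (p i) <= (size s)%:R * entr ((\sum_(i <- s) p i) / (size s)%:R).
Proof.
move=> p0 s0; set N : R := (size s)%:R; set q := _ / N.
have N0 : 0 < N by rewrite ltr0n.
have q0 : 0 <= q by rewrite divr_ge0 ?sumr_ge0// ltW.
have sN : \sum_(i <- s) p i = N * q by rewrite /q mulrC divfK// gt_eqF.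
have [qz|qn0] := eqVneq q 0.
  have S0 : \sum_(i <- s) p i = 0 by rewrite sN qz mulr0.
  have : \sum_(i <- s) entr (p i) = 0.
    move: S0; clear -p0; elim: s => [|i s IH]; rewrite ?big_nil// !big_cons => h.
    have h1 : p i = 0.
      apply/eqP; rewrite eq_le p0 andbT; rewrite -h lerDl; exact: sumr_ge0.
    by rewrite IH ?h1 ?entr0 ?add0r//; rewrite h1 add0r in h.
  by move=> ->; rewrite qz entr0 mulr0.
apply: (@le_trans _ _ (\sum_(i <- s) (- (p i * ln q) + (q - p i)))).
  by apply: ler_sum => i _; apply: entr_le => // /eqP; rewrite (negbTE qn0).
rewrite big_split/= sumrB sumrN -mulr_suml sN big_const_seq count_predT iter_addr_0.
by rewrite -(mulr_natl q) -/N subrr addr0 /entr_fun mulrN -mulrA.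
Qed.

(** Serves the continuity of [entr] at 0. With [s = sqrt t] the left side is [2 s (s ln s^-1)], and
    [ln s^-1 < s^-1]. *)
Lemma entr_le_sqrt t : 0 <= t -> entr t <= 2 * Num.sqrt t.
Proof.
rewrite le_eqVlt => /predU1P[<-|t0]; first by rewrite entr0 sqrtr0 mulr0.
have s0 : 0 < Num.sqrt t by rewrite sqrtr_gt0.
have -> : entr t = 2 * (Num.sqrt t * (Num.sqrt t * ln (Num.sqrt t)^-1)).
  rewrite lnV ?posrE// -[in LHS](sqr_sqrtr (ltW t0)) /entr_fun lnXn//.
  by rewrite mulr2n expr2; ring.
rewrite ler_pM2l// -[leRHS]mulr1 ler_pM2l//.
have : ln (Num.sqrt t)^-1 < (Num.sqrt t)^-1 by apply: ln_sublinear; rewrite invr_gt0.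
move/ltW; rewrite -(ler_pM2l s0) divff ?gt_eqF//.
Qed.

Lemma entr_continuous : continuous entr.
Proof.
move=> t; have [t0|t0|->] := ltgtP t 0.
- rewrite /continuous_at; have -> : entr t = 0 by rewrite /entr_fun ln0 ?(ltW t0)// mulr0 oppr0.
  apply: cvg_near_cst; near=> x; rewrite /entr_fun ln0 ?mulr0 ?oppr0//.
  by near: x; exact: (lt_le_nbhsl t0).
- apply: cvgN; apply: cvgM; last exact: (continuous_ln t0).
  exact: cvg_id.
- rewrite /continuous_at entr0; apply: (@squeeze_cvgr _ _ _ R (fun=> 0) (fun x => 2 * Num.sqrt x)).
  + near=> x; apply/andP; split.
      by apply: entr_ge0; near: x; exact: (lt_le_nbhsl (@ltr01 R)).
    have [x0|x0] := leP 0 x; first exact: entr_le_sqrt.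
    by rewrite /entr_fun ln0 ?(ltW x0)// mulr0 oppr0 mulr_ge0// sqrtr_ge0.
  + exact: cvg_cst.
  + rewrite -[X in _ --> X](mulr0 2); apply: cvgM; first exact: cvg_cst.
    by rewrite -[X in _ --> X](@sqrtr0 R); apply: sqrt_continuous.
Unshelve. all: by end_near. Qed.

End FiniteEntropy.

(** * Shearer's inequality and Folner sequences *)

Section GroupFsets.
Variables (R : realType) (G : groupType).
Implicit Types (A B D K F S : {fset G}) (g a : G).
Local Open Scope fset_scope.
Local Open Scope ring_scope.

Definition fmul A B : {fset G} := [fset (a * b)%g | a in A, b in B].
Definition fsinv A : {fset G} := [fset (a^-1)%g | a in A].
Definition rtrans A g : {fset G} := [fset (a * g)%g | a in A].

Lemma fmulP A B g : reflect (exists a b, [/\ a \in A, b \in B & g = (a * b)%g]) (g \in fmul A B).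
Proof.
apply: (iffP (imfset2P _ _ _ _ _)) => [[a aA [b bB ->]]|[a [b [aA bB ->]]]].
  by exists a, b.
by exists a => //; exists b.
Qed.

Lemma mem_fmul A B a b : a \in A -> b \in B -> (a * b)%g \in fmul A B.
Proof. by move=> aA bB; apply/fmulP; exists a, b. Qed.

Lemma mem_fsinv A g : (g \in fsinv A) = (g^-1%g \in A).
Proof.
apply/imfsetP/idP => [[a aA ->]|gA]; first by rewrite invgK.
by exists g^-1%g => //; rewrite invgK.
Qed.

Lemma mem_rtrans A g a : (a \in rtrans A g) = ((a * g^-1)%g \in A).
Proof.
apply/imfsetP/idP => [[b bA ->]|gA]; first by rewrite mulgK.
by exists (a * g^-1)%g => //; rewrite mulgVK.
Qed.

Lemma mem_lmul A g a : (a \in lmul_fset g A) = ((g^-1 * a)%g \in A).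
Proof.
apply/imfsetP/idP => [[b bA ->]|gA]; first by rewrite mulKg.
by exists (g^-1 * a)%g => //; rewrite mulVKg.
Qed.

Lemma card_fsinv A : #|` fsinv A| = #|` A|.
Proof. by rewrite card_imfset//; exact: invg_inj. Qed.

Lemma card_rtrans A g : #|` rtrans A g| = #|` A|.
Proof. by rewrite card_imfset//; exact: mulIg. Qed.

Lemma card_lmul A g : #|` lmul_fset g A| = #|` A|.
Proof. by rewrite card_imfset//; exact: mulgI. Qed.

Section SetFunction.
Variable h : {fset G} -> R.
Hypothesis h0 : h fset0 = 0.
Hypothesis hmono : forall A B, A `<=` B -> h A <= h B.
Hypothesis hsub : forall A B, h (A `|` B) + h (A `&` B) <= h A + h B.

(* Adding one point [g] to a set [P] increases every [h (S j :&: P)] with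
   [g \in S j] at least as much as it increases [h P]. *)
Lemma shearer (J : Type) (js : seq J) (S : J -> {fset G}) (F : {fset G}) (k : nat) :
  (forall g, g \in F -> (k <= count (fun j => g \in S j) js)%N) ->
  k%:R * h F <= \sum_(j <- js) h (S j).
Proof.
move=> cov; apply: (@le_trans _ _ (\sum_(j <- js) h (S j `&` F))); last first.
  by apply: ler_sum => j _; apply: hmono; exact: fsubsetIl.
suff claim (s : seq G) : {subset s <= F} ->
    k%:R * h (seq_fset tt s) <= \sum_(j <- js) h (S j `&` seq_fset tt s).
  have := claim (enum_fset F) (fun=> id).
  by rewrite (_ : seq_fset tt (enum_fset F) = F)//; apply/fsetP => x; rewrite seq_fsetE.
elim: s => [|g s IH] sub.
  rewrite (_ : seq_fset tt [::] = fset0); last by apply/fsetP => x; rewrite seq_fsetE !inE.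
  by rewrite h0 mulr0 big1// => j _; rewrite fsetI0 h0.
have {}IH := IH (fun x xs => sub x (mem_behead (s := g :: s) xs)).
set P := seq_fset tt s in IH *.
have -> : seq_fset tt (g :: s) = g |` P by apply/fsetP => x; rewrite !(inE, seq_fsetE).
set dl := h (g |` P) - h P.
have dl0 : 0 <= dl by rewrite subr_ge0; apply: hmono; exact: fsubsetUr.
have step j : h (S j `&` P) + (g \in S j)%:R * dl <= h (S j `&` (g |` P)).
  case: (boolP (g \in S j)) => gS; last first.
    by rewrite mul0r addr0; apply: hmono; apply: fsetIS; exact: fsubsetUr.
  rewrite mul1r /dl addrA lerBlDr addrC.
  have := hsub (S j `&` (g |` P)) P.
  rewrite -fsetIA (_ : (g |` P) `&` P = P); last first.
    by apply/fsetIidPr; exact: fsubsetUr.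
  rewrite (_ : S j `&` (g |` P) `|` P = g |` P)//.
  apply/fsetP => x; rewrite !inE; case: eqP => [->|_] /=; first by rewrite gS.
  by case: (x \in S j); case: (x \in P).
apply: (@le_trans _ _ (\sum_(j <- js) (h (S j `&` P) + (g \in S j)%:R * dl))); last first.
  exact: ler_sum.
rewrite big_split/= -mulr_suml -natr_sum.
have -> : h (g |` P) = h P + dl by rewrite /dl addrC subrK.
rewrite mulrDr lerD// ler_wpM2r// ler_nat.
apply: leq_trans (cov g (sub g (mem_head g s))) _.
by rewrite -sum1_count big_mkcond/=; apply: leq_sum => i _; case: (g \in S i).
Qed.

Hypothesis hinv : forall A g, h (rtrans A g) = h A.

(** Shearer's inequality for the translates [K g] with [g] in [K^-1 F]: an element [f] of [F] lies
    in the [#|K|] distinct translates with [g = k^-1 f]. When [F] is almost invariant this makes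
    [h F / #|F|] at most about [h K / #|K|]. *)
Lemma inf_rule K F : #|` K|%:R * h F <= #|` fmul (fsinv K) F|%:R * h K.
Proof.
have := @shearer G (fmul (fsinv K) F) (rtrans K) F #|` K| _.
under eq_bigr do rewrite hinv.
rewrite big_const_seq count_predT iter_addr_0 -(mulr_natl (h K)); apply => g gF.
rewrite -size_filter.
apply: (@leq_trans (size (enum_fset [fset (k^-1 * g)%g | k in K]))).
  by rewrite card_imfset//= => x y /mulIg/invg_inj.
apply: uniq_leq_size; first exact: fset_uniq.
move=> x /imfsetP[k /= kK ->]; rewrite mem_filter mem_rtrans invgM invgK mulVKg kK/=.
by apply: mem_fmul => //; rewrite mem_fsinv invgK.
Qed.
End SetFunction.

(** * Folner sequences and translates in an infinite group *)

Section FolnerSeq.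
Variable F : nat -> {fset G}.
Hypothesis FF : Folner R F.

Lemma Folner_card_gt0 n : 0 < (#|` F n|%:R : R).
Proof. by rewrite ltr0n cardfs_gt0; case: FF. Qed.

Lemma Folner_lmul g (e : R) : 0 < e -> exists N, forall n, (N <= n)%N ->
  #|` lmul_fset g (F n) `\` F n|%:R <= e * #|` F n|%:R.
Proof.
move=> e0; case: FF => _ /(_ g) /cvgrPdist_lt/(_ _ e0)[N _ NP].
exists N => n /NP; rewrite sub0r normrN ger0_norm ?divr_ge0// => /ltW.
rewrite ler_pdivrMr ?Folner_card_gt0//; apply: le_trans.
by rewrite ler_nat leq_addr.
Qed.

Lemma Folner_lmul_all D (e : R) : 0 < e -> exists N, forall n, (N <= n)%N ->
  forall g, g \in D -> #|` lmul_fset g (F n) `\` F n|%:R <= e * #|` F n|%:R.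
Proof.
move=> e0; suff H (s : seq G) : exists N, forall n, (N <= n)%N ->
  forall g, g \in s -> #|` lmul_fset g (F n) `\` F n|%:R <= e * #|` F n|%:R by exact: (H D).
elim: s => [|g s [N IH]]; first by exists 0%N => n _ g; rewrite in_nil.
have [M MP] := Folner_lmul g e0.
exists (maxn N M) => n; rewrite geq_max => /andP[Nn Mn] x; rewrite inE => /orP[/eqP ->|xs].
  exact: MP.
exact: IH.
Qed.

Lemma card_bigfcup_le (I : Type) (s : seq I) (B : I -> {fset G}) :
  (#|` \bigcup_(i <- s) B i| <= \sum_(i <- s) #|` B i|)%N.
Proof.
elim/big_ind2: _ => [|n A m B' le1 le2|//]; first by rewrite cardfs0.
apply: leq_trans (leq_add le1 le2); rewrite -(leq_add2r #|` A `&` B'|).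
by rewrite cardfsUI leq_addr.
Qed.

Lemma Folner_fmul D (e : R) : 0 < e -> exists N, forall n, (N <= n)%N ->
  #|` fmul D (F n) `\` F n|%:R <= e * #|` F n|%:R.
Proof.
move=> e0; pose e' := e / #|` D|.+1%:R.
have e'0 : 0 < e' by rewrite divr_gt0.
have [N NP] := Folner_lmul_all D e'0; exists N => n /NP {}NP.
have sub : fmul D (F n) `\` F n `<=` \bigcup_(g <- D) (lmul_fset g (F n) `\` F n).
  apply/fsubsetP => x; rewrite !inE => /andP[xF /fmulP[a [b [aD bF xab]]]].
  apply/bigfcupP; exists a; rewrite ?aD// !inE xF mem_lmul xab mulKg//.
apply: le_trans (_ : (\sum_(g <- D) #|` lmul_fset g (F n) `\` F n|)%:R <= _).
  by rewrite ler_nat (leq_trans (fsubset_leq_card sub))// card_bigfcup_le.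
rewrite natr_sum; apply: (@le_trans _ _ (\sum_(g <- D) e' * #|` F n|%:R)).
  by rewrite big_seq [leRHS]big_seq; apply: ler_sum => g gD; exact: NP.
rewrite big_const_seq count_predT iter_addr_0 -[_ *+ size _]mulr_natl mulrA ler_wpM2r//.
rewrite /e' mulrA ler_pdivrMr// mulrC ler_wpM2l ?(ltW e0)// ler_nat//.
Qed.

Lemma Folner_fmul_card D (e : R) : 0 < e -> exists N, forall n, (N <= n)%N ->
  #|` fmul D (F n)|%:R <= (1 + e) * #|` F n|%:R.
Proof.
move=> e0; have [N NP] := Folner_fmul D e0; exists N => n /NP {}NP.
rewrite mulrDl mul1r; apply: (@le_trans _ _ (#|` F n|%:R + #|` fmul D (F n) `\` F n|%:R)).
  2: by rewrite lerD2l.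
rewrite -natrD ler_nat -(cardfsID (F n) (fmul D (F n))) leq_add//.
exact: fsubset_leq_card (fsubsetIr _ _).
Qed.

Lemma Folner_invariant_elts D (e : R) : 0 < e -> exists N, forall n, (N <= n)%N ->
  #|` [fset f in F n | ~~ all (fun g => (g * f)%g \in F n) D]|%:R <= e * #|` F n|%:R.
Proof.
move=> e0; pose e' := e / #|` D|.+1%:R.
have e'0 : 0 < e' by rewrite divr_gt0.
have [N NP] := Folner_lmul_all D e'0; exists N => n /NP {}NP.
have sub : [fset f in F n | ~~ all (fun g => (g * f)%g \in F n) D] `<=`
   \bigcup_(g <- D) (lmul_fset g^-1 (lmul_fset g (F n) `\` F n)).
  apply/fsubsetP => x; rewrite !inE => /andP[xF /allPn[g gD gx]].
  by apply/bigfcupP; exists g; rewrite ?gD// mem_lmul invgK !inE gx mem_lmul mulKg.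
apply: le_trans (_ : (\sum_(g <- D) #|` lmul_fset g (F n) `\` F n|)%:R <= _).
  rewrite ler_nat (leq_trans (fsubset_leq_card sub))// (leq_trans (card_bigfcup_le _ _))//.
  by apply: leq_sum => g _; rewrite card_lmul.
rewrite natr_sum; apply: (@le_trans _ _ (\sum_(g <- D) e' * #|` F n|%:R)).
  by rewrite big_seq [leRHS]big_seq; apply: ler_sum => g gD; exact: NP.
rewrite big_const_seq count_predT iter_addr_0 -[_ *+ size _]mulr_natl mulrA ler_wpM2r//.
rewrite /e' mulrA ler_pdivrMr// mulrC ler_wpM2l ?(ltW e0)// ler_nat//.
Qed.

Hypothesis Ginf : exists e : nat -> G, injective e.

Lemma fset_avoid A : exists g, g \notin A.
Proof.
apply: contrapT => h; case: Ginf => e einj.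
have sub i : e i \in A by apply: contrapT => /negP n; apply: h; exists (e i).
have : (size (map e (iota 0 #|` A|.+1)) <= size (enum_fset A))%N.
  apply: uniq_leq_size; first by rewrite map_inj_uniq ?iota_uniq.
  by move=> x /mapP[i _ ->]; exact: sub.
by rewrite size_map size_iota ltnn.
Qed.

Lemma fset_large L : exists A, #|` A| = L.
Proof.
elim: L => [|L [A AL]]; first by exists fset0; rewrite cardfs0.
by have [g gA] := fset_avoid A; exists (g |` A); rewrite cardfsU1 gA AL.
Qed.

(** A new [g] outside [A K K^-1] makes [g K] disjoint from [A K]; avoiding [A] as well keeps the
    count of [A] right. *)
Lemma disjoint_translates K L : exists A, [/\ #|` A| = L &
  #|` fmul A K| = (L * #|` K|)%N].
Proof.
elim: L => [|L [A [AL AK]]].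
  exists fset0; split; first by rewrite cardfs0.
  rewrite mul0n; apply/eqP; rewrite cardfs_eq0; apply/eqP/fsetP => x; rewrite !inE.
  by apply/negbTE/negP => /fmulP[a [b []]]; rewrite inE.
have [g gA] := fset_avoid (A `|` fmul (fmul A K) (fsinv K)).
exists (g |` A); move: gA; rewrite inE negb_or => /andP[gA gAK]; split.
  by rewrite cardfsU1 gA AL.
have -> : fmul (g |` A) K = lmul_fset g K `|` fmul A K.
  apply/fsetP => x; apply/fmulP/fsetUP => [[a [b [+ bK ->]]]|[|]].
  - rewrite !inE => /orP[/eqP ->|aA]; [left|right]; last exact: mem_fmul.
    by rewrite mem_lmul mulKg.
  - by rewrite mem_lmul => h; exists g, (g^-1 * x)%g; rewrite !inE eqxx mulVKg.
  - by move=> /fmulP[a [b [aA bK ->]]]; exists a, b; rewrite !inE aA orbT.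
rewrite -[LHS]addn0 -[X in (_ + X)%N](@cardfs0 G) -(_ : lmul_fset g K `&` fmul A K = fset0).
  by rewrite cardfsUI card_lmul AK mulSn.
apply/fsetP => x; rewrite !inE; apply/negbTE/negP => /andP[+ xAK].
rewrite mem_lmul => gx; move/negP: gAK; apply.
have -> : g = (x * (g^-1 * x)^-1)%g by rewrite invgM invgK mulVKg.
by apply: mem_fmul => //; rewrite mem_fsinv invgK.
Qed.

(** If [F n] is almost invariant under a set [A] of [L] elements, some [f] in [F n] has all of [A f]
    inside [F n]. *)
Lemma Folner_card_infty L : exists N, forall n, (N <= n)%N -> (L <= #|` F n|)%N.
Proof.
have [A AL] := fset_large L.
have h2 : 0 < (2^-1 : R) by rewrite invr_gt0.
have [N NP] := Folner_invariant_elts A h2; exists N => n /NP {}NP.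
have [f fF fA] : exists2 f, f \in F n & all (fun g => (g * f)%g \in F n) A.
  apply: contrapT => h; move: NP.
  rewrite (_ : [fset f in F n | _] = F n).
    have := Folner_card_gt0 n; set c := #|` _|%:R => c0; lra.
  apply/fsetP => f; rewrite !inE; case: (boolP (f \in F n)) => //= fF.
  by apply/negP => fA; apply: h; exists f.
rewrite -AL -(card_rtrans A f); apply: fsubset_leq_card; apply/fsubsetP => x.
by move=> /imfsetP[a /= aA ->]; move/allP: fA; apply.
Qed.

End FolnerSeq.
End GroupFsets.

(** * Probability measures on a compact metric space *)

Section ProbabilityReals.
Context {R : realType} {dd : measure_display} {T : measurableType dd}.
Implicit Types (mu : probability T R) (phi psi : T -> R) (A B : set T).

(** On bounded measurable functions the real-valued integral [Ex] is linear and monotone with no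
    further integrability conditions, so that later estimates are inequalities between reals. *)
Definition bmeas phi := measurable_fun setT phi /\ exists M : R, forall x, `|phi x| <= M.
Definition Ex mu phi : R := (\int[mu]_x phi x)%R.
Definition fm mu A : R := fine (mu A).

Lemma bmeas_cst (c : R) : bmeas (fun=> c).
Proof. by split; [exact: measurable_cst|exists `|c|]. Qed.

Lemma bmeasD phi psi : bmeas phi -> bmeas psi -> bmeas (fun x => phi x + psi x).
Proof.
move=> [m1 [M1 b1]] [m2 [M2 b2]]; split; first exact: measurable_funD.
by exists (M1 + M2) => x; rewrite (le_trans (ler_normD _ _))// lerD.
Qed.

Lemma bmeasM phi psi : bmeas phi -> bmeas psi -> bmeas (fun x => phi x * psi x).
Proof.
move=> [m1 [M1 b1]] [m2 [M2 b2]]; split; first exact: measurable_funM.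
by exists (M1 * M2) => x; rewrite normrM ler_pM.
Qed.

Lemma bmeasZ (c : R) phi : bmeas phi -> bmeas (fun x => c * phi x).
Proof. by apply: bmeasM; exact: bmeas_cst. Qed.

Lemma bmeasN phi : bmeas phi -> bmeas (fun x => - phi x).
Proof.
move=> /(bmeasZ (-1)) h; rewrite (_ : (fun x => - phi x) = fun x => -1 * phi x)//.
by apply/funext => x; rewrite mulN1r.
Qed.

Lemma bmeasB phi psi : bmeas phi -> bmeas psi -> bmeas (fun x => phi x - psi x).
Proof. by move=> h1 /bmeasN; exact: bmeasD. Qed.

Lemma bmeas_indic A : measurable A -> bmeas (\1_A : T -> R).
Proof.
move=> mA; split; first exact: measurable_indic.
by exists 1 => x; rewrite indicE normr_nat lern1 leq_b1.
Qed.

Lemma bmeas_sum (I : Type) (s : seq I) (f : I -> T -> R) :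
  (forall i, bmeas (f i)) -> bmeas (fun x => \sum_(i <- s) f i x).
Proof.
move=> h; elim: s => [|i s IH].
  rewrite (_ : (fun x => _) = fun=> 0); first exact: bmeas_cst.
  by apply/funext => x; rewrite big_nil.
rewrite (_ : (fun x => _) = fun x => f i x + \sum_(i <- s) f i x); first exact: bmeasD.
by apply/funext => x; rewrite big_cons.
Qed.

Lemma bmeas_integrable mu phi : bmeas phi -> mu.-integrable setT (EFin \o phi).
Proof.
move=> [m [M b]]; apply: measurable_bounded_integrable => //.
  exact: (le_lt_trans (probability_le1 mu measurableT) (ltry _)).
exists M; split; first exact: num_real.
by move=> x Mx y _; exact: (le_trans (b y) (ltW Mx)).
Qed.

Lemma ExE mu phi : bmeas phi -> (\int[mu]_x (phi x)%:E)%E = (Ex mu phi)%:E.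
Proof.
move=> /(bmeas_integrable mu) h; rewrite /Ex /Rintegral fineK//.
exact: integrable_fin_num.
Qed.

Lemma Ex_cst mu c : Ex mu (fun=> c) = c.
Proof.
rewrite /Ex Rintegral_cst//; have -> : fine (mu setT) = 1 by rewrite probability_setT.
by rewrite mulr1.
Qed.

Lemma ExD mu phi psi : bmeas phi -> bmeas psi ->
  Ex mu (fun x => phi x + psi x) = Ex mu phi + Ex mu psi.
Proof. by move=> h1 h2; rewrite /Ex RintegralD//; exact: bmeas_integrable. Qed.

Lemma ExZ mu c phi : bmeas phi -> Ex mu (fun x => c * phi x) = c * Ex mu phi.
Proof. by move=> h1; rewrite /Ex RintegralZl//; exact: bmeas_integrable. Qed.

Lemma ExB mu phi psi : bmeas phi -> bmeas psi ->
  Ex mu (fun x => phi x - psi x) = Ex mu phi - Ex mu psi.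
Proof. by move=> h1 h2; rewrite /Ex RintegralB//; exact: bmeas_integrable. Qed.

Lemma Ex_le mu phi psi : bmeas phi -> bmeas psi ->
  (forall x, phi x <= psi x) -> Ex mu phi <= Ex mu psi.
Proof.
by move=> h1 h2 h; apply: le_Rintegral => //; exact: bmeas_integrable.
Qed.

Lemma Ex_abs_le mu phi (M : R) : bmeas phi -> (forall x, `|phi x| <= M) -> `|Ex mu phi| <= M.
Proof.
move=> h b; rewrite ler_norml -{1}(Ex_cst mu (- M)) -{2}(Ex_cst mu M).
apply/andP; split; apply: Ex_le => //; try exact: bmeas_cst.
  by move=> x; have := b x; rewrite ler_norml => /andP[].
by move=> x; have := b x; rewrite ler_norml => /andP[].
Qed.

Lemma Ex_indic mu A : measurable A -> Ex mu (\1_A : T -> R) = fm mu A.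
Proof. by move=> mA; rewrite /Ex /Rintegral integral_indic// setIT. Qed.

Lemma Ex_sum mu (I : Type) (s : seq I) (f : I -> T -> R) :
  (forall i, bmeas (f i)) -> Ex mu (fun x => \sum_(i <- s) f i x) = \sum_(i <- s) Ex mu (f i).
Proof.
move=> h; elim: s => [|i s IH].
  rewrite big_nil (_ : (fun x => _) = fun=> 0) ?Ex_cst//.
  by apply/funext => x; rewrite big_nil.
rewrite big_cons -IH -ExD//; last exact: bmeas_sum.
by congr Ex; apply/funext => x; rewrite big_cons.
Qed.

Lemma Ex_dominated mu (f : nat -> T -> R) phi (M : R) :
  (forall n, bmeas (f n)) -> bmeas phi -> (forall n x, `|f n x| <= M) ->
  (forall x, f n x @[n --> \oo] --> phi x) ->
  Ex mu (f n) @[n --> \oo] --> Ex mu phi.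
Proof.
move=> mf mphi b cv.
have mfe n : measurable_fun setT (EFin \o f n) by apply/measurable_EFinP; case: (mf n).
have cve x : (fun n => (f n x)%:E) @ \oo --> (phi x)%:E.
  by apply: cvg_EFin; [exact: nearW|exact: cv].
have [_ _ h] := @dominated_convergence _ _ _ mu setT measurableT
  (fun n => EFin \o f n) (EFin \o phi) (fun=> M%:E) mfe
  (proj2 (measurable_EFinP _ _) (proj1 mphi))
  (aeW _ (fun x _ => cve x))
  (bmeas_integrable mu (bmeas_cst M)) (aeW _ (fun x n _ => b n x)).
have {}h : (fun n => (Ex mu (f n))%:E) @ \oo --> (Ex mu phi)%:E.
  rewrite -ExE//; under eq_fun do rewrite -ExE//; exact: h.
exact: (fine_cvg h).
Qed.

Lemma fm_ge0 mu A : 0 <= fm mu A.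
Proof. by rewrite fine_ge0. Qed.

Lemma fmE mu A : measurable A -> mu A = (fm mu A)%:E.
Proof. by move=> mA; rewrite /fm fineK// fin_num_measure. Qed.

Lemma fm_le mu A B : measurable A -> measurable B -> A `<=` B -> fm mu A <= fm mu B.
Proof. by move=> mA mB AB; rewrite -lee_fin -!fmE// le_measure// inE. Qed.

Lemma fm0 mu : fm mu set0 = 0. Proof. by rewrite /fm measure0. Qed.
Lemma fmT mu : fm mu setT = 1. Proof. by rewrite /fm probability_setT. Qed.

Lemma fm_le1 mu A : measurable A -> fm mu A <= 1.
Proof. by move=> mA; rewrite -(fmT mu) fm_le. Qed.

Lemma fmU mu A B : measurable A -> measurable B -> A `&` B = set0 ->
  fm mu (A `|` B) = fm mu A + fm mu B.
Proof.
move=> mA mB AB; apply: EFin_inj; rewrite EFinD -!fmE//; last exact: measurableU.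
by rewrite measureU.
Qed.

Lemma fmID mu A B : measurable A -> measurable B ->
  fm mu A = fm mu (A `&` B) + fm mu (A `\` B).
Proof.
move=> mA mB; rewrite -fmU; last 3 first.
- exact: measurableI.
- exact: measurableD.
- by rewrite setIDA setIC setIA -setDE -setIDA setDv setI0 || (apply/seteqP; split => x //= [[? ?] [? ?]]).
by rewrite setUIDK.
Qed.

Lemma fmC mu A : measurable A -> fm mu (~` A) = 1 - fm mu A.
Proof.
by move=> mA; rewrite -(fmT mu) (@fmID mu setT A)// setTI setTD addrC addKr.
Qed.

Lemma fmU_le mu A B : measurable A -> measurable B ->
  fm mu (A `|` B) <= fm mu A + fm mu B.
Proof.
move=> mA mB; rewrite -lee_fin EFinD -!fmE//; last exact: measurableU.
exact: measureU2.
Qed.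

Lemma fm_bigU_le mu (I : Type) (s : seq I) (A : I -> set T) :
  (forall i, measurable (A i)) ->
  fm mu (\big[setU/set0]_(i <- s) A i) <= \sum_(i <- s) fm mu (A i).
Proof.
move=> mA; elim: s => [|i s IH]; first by rewrite !big_nil fm0.
rewrite !big_cons; apply: le_trans (fmU_le _ _ _) _ => //.
  exact: bigsetU_measurable.
by rewrite lerD2l.
Qed.

Lemma fm_cvg_up mu (A : nat -> set T) : (forall n, measurable (A n)) ->
  nondecreasing_seq A -> fm mu (A n) @[n --> \oo] --> fm mu (\bigcup_n A n).
Proof.
move=> mA ndA; have mU : measurable (\bigcup_n A n) by exact: bigcup_measurable.
have h := @nondecreasing_cvg_mu _ _ _ mu A mA mU ndA.
have {}h : (fun n => (fm mu (A n))%:E) @ \oo --> (fm mu (\bigcup_n A n))%:E.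
  by rewrite -fmE//; under eq_fun do rewrite -fmE//; exact: h.
exact: (fine_cvg h).
Qed.

Lemma fm_partition mu (I : finType) (Y : T -> I) (A : set T) : measurable A ->
  (forall i, measurable (Y @^-1` [set i])) ->
  \sum_i fm mu (A `&` Y @^-1` [set i]) = fm mu A.
Proof.
move=> mA mY; rewrite -(Ex_indic mu mA).
under eq_bigr => i _ do rewrite -(Ex_indic mu (measurableI _ _ mA (mY i))).
rewrite -Ex_sum; last by move=> i; apply: bmeas_indic; exact: measurableI.
congr Ex; apply/funext => x; rewrite (bigD1 (Y x))//= !indicE big1 ?addr0.
  by congr (_%:R); congr nat_of_bool; apply/idP/idP; rewrite !inE/= => // -[].
move=> i ix; rewrite indicE memNset//= => -[_ xi]; by rewrite xi eqxx in ix.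
Qed.

(** Double counting: both sides integrate over [A] the number of sets [U i] through a point. The
    tilings rest on the consequences [count_fm_ge] and [count_fm_le]. *)
Lemma sum_fm_Ex mu (I : Type) (s : seq I) (U : I -> set T) A :
  (forall i, measurable (U i)) -> measurable A ->
  \sum_(i <- s) fm mu (U i `&` A) = Ex mu (fun x => \1_A x * (count (fun i => x \in U i) s)%:R).
Proof.
move=> mU mA; under eq_bigr => i _ do rewrite -(Ex_indic mu (measurableI _ _ (mU i) mA)).
rewrite -Ex_sum; last by move=> i; apply: bmeas_indic; exact: measurableI.
congr Ex; apply/funext => x; rewrite -sum1_count [X in X%:R]big_mkcond natr_sum mulr_sumr.
apply: eq_bigr => i _; rewrite !indicE in_setI.
by case: (x \in U i); case: (x \in A); rewrite /= ?mulr1 ?mulr0.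
Qed.

Lemma bmeas_count (I : Type) (s : seq I) (U : I -> set T) A :
  (forall i, measurable (U i)) -> measurable A ->
  bmeas (fun x => \1_A x * (count (fun i => x \in U i) s)%:R : R).
Proof.
move=> mU mA; apply: bmeasM; first exact: bmeas_indic.
rewrite (_ : (fun x => _) = fun x => \sum_(i <- s) \1_(U i) x : R).
  by apply: bmeas_sum => i; exact: bmeas_indic.
apply/funext => x; rewrite -sum1_count [X in X%:R]big_mkcond natr_sum.
by apply: eq_bigr => i _; rewrite indicE; case: (x \in U i).
Qed.

Lemma count_fm_ge mu (I : Type) (s : seq I) (U : I -> set T) A (c : R) :
  (forall i, measurable (U i)) -> measurable A ->
  (forall x, A x -> c <= (count (fun i => x \in U i) s)%:R) ->
  c * fm mu A <= \sum_(i <- s) fm mu (U i `&` A).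
Proof.
move=> mU mA h; rewrite sum_fm_Ex// -(Ex_indic mu mA) -ExZ; last exact: bmeas_indic.
apply: Ex_le; [by apply: bmeasZ; exact: bmeas_indic|exact: bmeas_count|move=> x].
rewrite !indicE; case: (boolP (x \in A)) => [|_]; last by rewrite mulr0 mul0r.
by rewrite inE mulr1 mul1r => /h.
Qed.

Lemma count_fm_le mu (I : Type) (s : seq I) (U : I -> set T) A (c : R) :
  (forall i, measurable (U i)) -> measurable A ->
  (forall x, A x -> (count (fun i => x \in U i) s)%:R <= c) ->
  \sum_(i <- s) fm mu (U i `&` A) <= c * fm mu A.
Proof.
move=> mU mA h; rewrite sum_fm_Ex// -(Ex_indic mu mA) -ExZ; last exact: bmeas_indic.
apply: Ex_le; [exact: bmeas_count|by apply: bmeasZ; exact: bmeas_indic|move=> x].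
rewrite !indicE; case: (boolP (x \in A)) => [|_]; last by rewrite mulr0 mul0r.
by rewrite inE mulr1 mul1r => /h.
Qed.

End ProbabilityReals.

(** * Continuous functions and Borel sets of a compact metric space *)

Section CompactMetric.
Variables (R : realType) (disp : measure_display) (X : measurableType disp).
Variable d : X -> X -> R.
Hypothesis dm : is_metric d.
Local Notation dcont := (dcontinuous_real d).
Implicit Types (phi psi : X -> R) (x y z : X) (A B U : set X) (mu : probability X R).

Lemma dxx x : d x x = 0. Proof. by case: dm => h _; apply/h. Qed.
Lemma dsym x y : d x y = d y x. Proof. by case: dm => _ []. Qed.
Lemma dtri x y z : d x z <= d x y + d y z. Proof. by case: dm => _ []. Qed.
Lemma d_eq0 x y : d x y = 0 -> x = y. Proof. by case: dm => h _ /h. Qed.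
Lemma d_ge0 x y : 0 <= d x y.
Proof. by have := dtri x y x; rewrite dxx (dsym y x) -mulr2n pmulrn_lge0. Qed.

Lemma dcont_cst (c : R) : dcont (fun=> c).
Proof. by move=> x e e0; exists 1 => // y _; rewrite subrr normr0. Qed.

Lemma dcont_comp (h : R -> R) phi : continuous h -> dcont phi -> dcont (h \o phi).
Proof.
move=> hc cphi x e e0; have /cvgrPdist_lt/(_ _ e0) := hc (phi x).
rewrite -nbhs_ballE => -[r /= r0 hr]; have [s s0 hs] := cphi x r r0.
by exists s => // y /hs h1; apply: hr; rewrite /ball/= .
Qed.

Lemma dcontD phi psi : dcont phi -> dcont psi -> dcont (fun x => phi x + psi x).
Proof.
move=> h1 h2 x e e0; have e2 : 0 < e / 2 by rewrite divr_gt0.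
have [r r0 hr] := h1 x _ e2; have [s s0 hs] := h2 x _ e2.
exists (Num.min r s); first by rewrite lt_min r0.
move=> y; rewrite lt_min => /andP[/hr a1 /hs a2].
rewrite opprD addrACA (le_lt_trans (ler_normD _ _))//.
by rewrite (splitr e) ltrD.
Qed.

Lemma dcontZ (c : R) phi : dcont phi -> dcont (fun x => c * phi x).
Proof. by apply: (@dcont_comp (fun t => c * t)); exact: mulrl_continuous. Qed.

Lemma dcontN phi : dcont phi -> dcont (fun x => - phi x).
Proof. by apply: (@dcont_comp (fun t => - t)); exact: opp_continuous. Qed.

Lemma dcontB phi psi : dcont phi -> dcont psi -> dcont (fun x => phi x - psi x).
Proof. by move=> h1 /dcontN; exact: dcontD. Qed.

Lemma dcont_sqr phi : dcont phi -> dcont (fun x => phi x * phi x).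
Proof.
by apply: (@dcont_comp (fun t => t * t)) => t; apply: cvgM; exact: cvg_id.
Qed.

Lemma dcontM phi psi : dcont phi -> dcont psi -> dcont (fun x => phi x * psi x).
Proof.
move=> h1 h2.
have h := dcontZ (4^-1) (dcontB (dcont_sqr (dcontD h1 h2)) (dcont_sqr (dcontB h1 h2))).
rewrite (_ : (fun x => _) = fun x => 4^-1 * ((phi x + psi x) * (phi x + psi x) -
   (phi x - psi x) * (phi x - psi x)))//.
by apply/funext => x; field.
Qed.

Lemma dcont_min (c : R) phi : dcont phi -> dcont (fun x => Num.min c (phi x)).
Proof.
apply: (@dcont_comp (fun t => Num.min c t)) => t.
by apply: continuous_min; [exact: cst_continuous|exact: cvg_id].
Qed.

Lemma dcont_max (c : R) phi : dcont phi -> dcont (fun x => Num.max c (phi x)).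
Proof.
apply: (@dcont_comp (fun t => Num.max c t)) => t.
by apply: continuous_max; [exact: cst_continuous|exact: cvg_id].
Qed.

Lemma dcont_lip phi : (forall x y, phi x <= phi y + d x y) -> dcont phi.
Proof.
move=> h x e e0; exists e => // y xy; have := h x y; have := h y x.
by rewrite (dsym y x) ltr_norml => h1 h2; apply/andP; split; lra.
Qed.

Lemma dcont_d x : dcont (d x).
Proof. by apply: dcont_lip => y z; rewrite (dsym y z) dtri. Qed.

(** Adjoining the value 1 keeps the set nonempty when [A] is empty; the capped distance is still
    1-Lipschitz. *)
Definition dist1 A x : R := inf ([set 1] `|` d x @` A).

Let dist1_lb A x : lbound ([set 1] `|` d x @` A) 0.
Proof. by move=> _ [->|[y _ <-]]; rewrite ?ler01 ?d_ge0. Qed.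

Lemma dist1_ge0 A x : 0 <= dist1 A x.
Proof. by apply: lb_le_inf; [exists 1; left|exact: dist1_lb]. Qed.

Lemma dist1_le A x y : A y -> dist1 A x <= d x y.
Proof.
by move=> Ay; apply: ge_inf; [exists 0; exact: dist1_lb|right; exists y].
Qed.

Lemma dist1_le1 A x : dist1 A x <= 1.
Proof. by apply: ge_inf; [exists 0; exact: dist1_lb|left]. Qed.

Lemma dist1_in A x : A x -> dist1 A x = 0.
Proof. by move=> Ax; apply/eqP; rewrite eq_le dist1_ge0 -(dxx x) dist1_le. Qed.

Lemma dist1_lt A x (r : R) : r <= 1 -> dist1 A x < r -> exists2 y, A y & d x y < r.
Proof.
move=> r1 h; apply: contrapT => n; move: h; rewrite ltNge => /negP; apply.
apply: lb_le_inf; first by exists 1; left.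
move=> _ [->//|[y Ay <-]]; rewrite leNgt; apply/negP => xy; apply: n; by exists y.
Qed.

Lemma dcont_dist1 A : dcont (dist1 A).
Proof.
apply: dcont_lip => x y; rewrite -lerBlDr; apply: lb_le_inf; first by exists 1; left.
move=> _ [->|[z Az <-]].
  by rewrite lerBlDr (le_trans (dist1_le1 A x))// lerDl d_ge0.
by rewrite lerBlDr (le_trans (dist1_le x Az))// addrC dtri.
Qed.

Lemma dist1_gt0 U x : dopen d U -> U x -> 0 < dist1 (~` U) x.
Proof.
move=> oU Ux; have [r r0 hr] := oU x Ux.
apply: (@lt_le_trans _ _ (Num.min 1 r)); first by rewrite lt_min ltr01.
apply: lb_le_inf; first by exists 1; left.
move=> _ [->|[y nUy <-]]; first by rewrite ge_min lexx.
by rewrite ge_min; apply/orP; right; rewrite leNgt; apply/negP => /hr.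
Qed.

(** Continuous functions increasing to the indicator of an open [U]; they carry information from
    integrals of continuous functions to measures of sets. *)
Definition open_bump U (n : nat) x : R := Num.min 1 (n%:R * dist1 (~` U) x).

Lemma dcont_open_bump U n : dcont (open_bump U n).
Proof. by apply: dcont_min; apply: dcontZ; exact: dcont_dist1. Qed.

Lemma open_bump_ge0 U n x : 0 <= open_bump U n x.
Proof. by rewrite le_min ler01 mulr_ge0// dist1_ge0. Qed.

Lemma open_bump_le1 U n x : open_bump U n x <= 1.
Proof. by rewrite ge_min lexx. Qed.

Lemma open_bump_cvg U x : dopen d U -> open_bump U n x @[n --> \oo] --> (\1_U x : R).
Proof.
move=> oU; apply: cvg_near_cst; rewrite indicE.
case: (boolP (x \in U)) => [/set_mem Ux|nUx]; last first.
  apply: nearW => n; rewrite /open_bump dist1_in ?mulr0; last first.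
    by move=> /= Ux; move/negP: nUx; apply; apply/mem_set.
  by rewrite (min_r ler01).
have h := dist1_gt0 oU Ux; set r := dist1 _ _ in h.
exists (Num.bound r^-1) => // n /= hn; rewrite /open_bump -/r min_l//.
rewrite -(ler_pdivrMr _ _ h) mul1r; apply: ltW; apply: lt_le_trans (_ : (Num.bound r^-1)%:R <= _).
  by rewrite archi_boundP// invr_ge0 ltW.
by rewrite ler_nat.
Qed.

Hypothesis db : borel_for_d d.

Lemma dopen_measurable U : dopen d U -> measurable U.
Proof. by move=> oU; apply/db; exact: sub_gen_smallest. Qed.

Lemma dopenT : dopen d setT. Proof. by move=> x _; exists 1. Qed.
Lemma dopen0 : dopen d set0. Proof. by move=> x []. Qed.

Lemma dopenI U V : dopen d U -> dopen d V -> dopen d (U `&` V).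
Proof.
move=> oU oV x [Ux Vx]; have [r r0 hr] := oU x Ux; have [s s0 hs] := oV x Vx.
exists (Num.min r s); first by rewrite lt_min r0.
by move=> y /=; rewrite lt_min => /andP[/hr ? /hs ?].
Qed.

Lemma dcont_open_lt phi (c : R) : dcont phi -> dopen d [set x | phi x < c].
Proof.
move=> cphi x /= h; have := cphi x (c - phi x); rewrite subr_gt0 => /(_ h)[r r0 hr].
exists r => // y /= /hr; rewrite ltr_norml => /andP[+ _].
by rewrite opprB ltrD2l ltrNr opprK.
Qed.

Lemma dcont_open_gt phi (c : R) : dcont phi -> dopen d [set x | c < phi x].
Proof.
move=> /dcontN /(@dcont_open_lt _ (- c)).
rewrite (_ : [set x | - phi x < - c] = [set x | c < phi x])//.
by apply/seteqP; split => x /=; rewrite ltrN2.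
Qed.

Lemma dcont_measurable phi : dcont phi -> measurable_fun setT phi.
Proof.
move=> cphi; apply: (measurability _ (RGenOInfty.measurableE R)) => //.
move=> _ [_ [c ->] <-]; rewrite setTI; apply: dopen_measurable.
rewrite (_ : _ @^-1` _ = [set x | c < phi x]); first exact: dcont_open_gt.
by apply/seteqP; split => x /=; rewrite in_itv/= andbT.
Qed.

Lemma dball_open x (r : R) : dopen d [set y | d x y < r].
Proof. exact: dcont_open_lt (dcont_d x). Qed.

(** By dominated convergence the integrals of the bumps determine the measure of each [U] in [UU],
    and a generating family closed under intersection determines the measure. A countable [UU]
    yields a countable determining family later. *)
Lemma measure_eq_open mu mu' (UU : set (set X)) :
  setI_closed UU -> UU setT -> (forall U, UU U -> dopen d U) ->
  (forall V, dopen d V -> <<s UU >> V) ->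
  (forall U n, UU U -> Ex mu (open_bump U n) = Ex mu' (open_bump U n)) ->
  forall A, measurable A -> mu A = mu' A.
Proof.
move=> UUI UUT UUo gen eqE A mA.
have bm U n : bmeas (open_bump U n).
  split; first exact: dcont_measurable (dcont_open_bump U n).
  by exists 1 => x; rewrite ger0_norm ?open_bump_ge0 ?open_bump_le1.
have key U : UU U -> mu U = mu' U.
  move=> uU; have mU := dopen_measurable (UUo _ uU).
  rewrite !fmE//; congr EFin; rewrite -!Ex_indic//.
  have h nu : Ex nu (open_bump U n) @[n --> \oo] --> Ex nu (\1_U : X -> R).
    apply: (@Ex_dominated _ _ _ _ _ _ 1) => //; first exact: bmeas_indic.
      by move=> n x; rewrite ger0_norm ?open_bump_ge0 ?open_bump_le1.
    by move=> x; apply: open_bump_cvg; exact: UUo.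
  have E : (fun n => Ex mu (open_bump U n)) = (fun n => Ex mu' (open_bump U n)).
    by apply/funext => n; exact: eqE.
  by have h1 := h mu; rewrite -(cvg_lim _ h1)// E; apply: (cvg_lim _ (h mu')).
apply: (@g_sigma_algebra_measure_unique _ _ _ UU _ (fun=> setT)) => //.
- by move=> U /UUo; exact: dopen_measurable.
- by apply/seteqP; split => // x _; exists 0%N.
- by move=> k; rewrite (le_lt_trans (probability_le1 mu measurableT)) ?ltry.
have := mA; rewrite db => h.
apply: h; split; first by apply: smallest_sigma_algebra.
by move=> V; exact: gen.
Qed.

Hypothesis dc : dcompact d.

Lemma dcompact_ball (rad : X -> R) : (forall x, 0 < rad x) ->
  exists s : seq X, forall x, exists2 c, c \in s & d c x < rad c.
Proof.
move=> rad0; have [s sP] := dc (fun c => @dball_open c (rad c))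
  (fun x _ => ex_intro2 _ _ x I (eq_ind_r (fun t => t < rad x) (rad0 x) (dxx x))).
exists s => x; have [c cs xc] := sP x; exists c => //.
elim: s cs {sP} => //= a s IH [->|/IH h]; first by rewrite inE eqxx.
by rewrite inE h orbT.
Qed.

Lemma seq_pos_min (I : eqType) (s : seq I) (rad : I -> R) : (forall i, 0 < rad i) ->
  exists2 r, 0 < r & forall i, i \in s -> r <= rad i.
Proof.
move=> rad0; elim: s => [|a s [r r0 hr]]; first by exists 1.
exists (Num.min (rad a) r); first by rewrite lt_min rad0.
move=> x; rewrite inE => /predU1P[->|/hr]; first by rewrite ge_min lexx.
by move=> h; rewrite ge_min h orbT.
Qed.

Lemma dcont_unif phi (e : R) : dcont phi -> 0 < e ->
  exists2 r, 0 < r & forall x y, d x y < r -> `|phi x - phi y| < e.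
Proof.
move=> cphi e0; have e2 : 0 < e / 2 by rewrite divr_gt0.
pose h x := cid2 (cphi x _ e2); pose rad x := sval (h x) / 2.
have rad0 x : 0 < rad x by rewrite /rad; case: (h x) => r /= r0 _; rewrite divr_gt0.
have [s sP] := dcompact_ball rad0; have [r r0 hr] := seq_pos_min s rad0.
exists r => // x y xy; have [c cs cx] := sP x.
have cy : d c y < sval (h c).
  rewrite (le_lt_trans (dtri c x y))// (splitr (sval _)) ltrD//.
  by rewrite (lt_le_trans xy) ?hr.
have cx' : d c x < sval (h c).
  by rewrite (lt_trans cx)// /rad ltr_pdivrMr// ltr_pMr ?ltr1n//; have := rad0 c; rewrite /rad pmulr_lgt0.
move: cy cx'; case: (h c) => t /= t0 ht /ht cy /ht cx'.
rewrite -(subrK (phi c) (phi x)) -addrA (le_lt_trans (ler_normD _ _))//.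
by rewrite (splitr e) ltrD// distrC.
Qed.

Lemma dcont_bounded phi : dcont phi -> exists2 M, 0 <= M & forall x, `|phi x| <= M.
Proof.
move=> cphi; have [r r0 hr] := dcont_unif cphi ltr01.
have [s sP] := @dcompact_ball (fun=> r) (fun=> r0).
exists (\sum_(c <- s) `|phi c| + 1); first by rewrite addr_ge0// sumr_ge0.
move=> x; have [c cs /hr h] := sP x.
rewrite -(subrK (phi c) (phi x)) addrC (le_trans (ler_normD _ _))// lerD//.
  by rewrite (big_rem _ cs)/= lerDl sumr_ge0.
by rewrite distrC ltW.
Qed.

Lemma dcont_bmeas phi : dcont phi -> bmeas phi.
Proof.
move=> cphi; split; first exact: dcont_measurable.
by have [M _ h] := dcont_bounded cphi; exists M.
Qed.

(** If no point were a limit, the Cauchy sequence would eventually stay out of a ball around every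
    point; finitely many of these balls cover the space, and the tail has no place left. *)
Lemma dcomplete (u : nat -> X) :
  (forall e : R, 0 < e -> exists N, forall m n, (N <= m)%N -> (N <= n)%N -> d (u m) (u n) < e) ->
  exists x, forall e : R, 0 < e -> exists N, forall n, (N <= n)%N -> d (u n) x < e.
Proof.
move=> cau; apply: contrapT => H.
have far x : exists r : R, 0 < r /\ exists N, forall n, (N <= n)%N -> r <= d x (u n).
  apply: contrapT => h; apply: H; exists x => e e0.
  have e2 : 0 < e / 2 by rewrite divr_gt0.
  have [N NP] := cau _ e2; exists N => n Nn.
  have [m Nm xm] : exists2 m, (N <= m)%N & d x (u m) < e / 2.
    apply: contrapT => k; apply: h; exists (e / 2); split => //; exists N => m Nm.
    by rewrite leNgt; apply/negP => xm; apply: k; exists m.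
  rewrite dsym (le_lt_trans (dtri _ (u m) _))// (splitr e) ltrD//; exact: NP.
pose rad x := sval (cid (far x)).
have radP x : 0 < rad x /\ exists N, forall n, (N <= n)%N -> rad x <= d x (u n).
  by rewrite /rad; case: (cid _).
have [s sP] := dcompact_ball (fun x => (radP x).1).
have [N NP] : exists N, forall c, c \in s -> forall n, (N <= n)%N -> rad c <= d c (u n).
  elim: s {sP} => [|a s [N NP]]; first by exists 0%N.
  have [M MP] := (radP a).2; exists (maxn N M) => c; rewrite inE.
  by move=> /predU1P[->|cs] n; rewrite geq_max => /andP[Nn Mn]; [exact: MP|exact: NP].
have [c cs] := sP (u N); rewrite ltNge => /negP; apply; exact: NP.
Qed.

Definition same_bits (D : nat -> set X) n x y := forall i, (i < n)%N -> (D i x <-> D i y).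

(** The sets are balls of radius [1 / (k + 1)] around finite nets, enumerated by pairs of level and
    index. Some ball of level [k] contains [x], hence also every point with the same bits, which is
    then within [2 / (k + 1)]. These bits code points by binary words in the construction of weak
    limits. *)
Lemma separating_sets : exists D : nat -> set X, (forall i, measurable (D i)) /\
  forall e : R, 0 < e -> exists n, forall x y, same_bits D n x y -> d x y < e.
Proof.
have net k : exists s : seq X, forall x, exists2 c, c \in s & d c x < (k.+1%:R)^-1.
  by apply: dcompact_ball => x.
pose s k := sval (cid (net k)).
have sP k x : exists2 c, c \in s k & d c x < (k.+1%:R)^-1.
  by rewrite /s; case: (cid (net k)).
pose D i : set X := if (choice.unpickle i : option (nat * nat)) is Some kj then
   [set y | d (nth point (s kj.1) kj.2) y < (kj.1.+1%:R)^-1] else set0.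
exists D; split.
  by move=> i; rewrite /D; case: choice.unpickle => // kj; apply: dopen_measurable; exact: dball_open.
move=> e e0; pose k := Num.bound (2 / e).
have ke : 2 * (k.+1%:R)^-1 < e.
  rewrite ltr_pdivrMr// mulrC -ltr_pdivrMr//.
  apply: (@lt_trans _ _ k%:R); last by rewrite ltr_nat.
  by rewrite archi_boundP// divr_ge0// ltW.
exists (\max_(j < size (s k)) (choice.pickle (k, j : nat)).+1)%N => x y xy.
have [c cs cx] := sP k x.
have jl : (index c (s k) < size (s k))%N by rewrite index_mem.
have /xy := @leq_bigmax_cond _ xpredT (fun j : 'I_(size (s k)) => (choice.pickle (k, j : nat)).+1) (Ordinal jl) isT.
rewrite /D choice.pickleK /= nth_index// => -[/(_ cx) cy _].
rewrite (le_lt_trans (dtri x c y))// (lt_trans _ ke)// mulr2n mulrDl mul1r ltrD//.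
by rewrite dsym.
Qed.

End CompactMetric.

(** * Entropy of finite labellings along a group action *)

Section Labels.
Context {R : realType} {dd : measure_display} {X : measurableType dd}.
Implicit Types (mu : probability X R) (A E : set X) (T U V : finType).
Local Notation entr := (@entr_fun R).

(** Finite partitions are handled as labellings by a finite type; a value that is not attained
    corresponds to an empty cell. *)
Definition mlab T (Y : X -> T) := forall t, measurable (Y @^-1` [set t]).

Lemma mlab_pred T (Y : X -> T) (P : T -> Prop) : mlab Y -> measurable [set x | P (Y x)].
Proof.
move=> mY; rewrite (_ : [set x | P (Y x)] = \bigcup_(t in [set t | P t]) (Y @^-1` [set t])).
  by apply: fin_bigcup_measurable; [exact: finite_finset|move=> t _; exact: mY].
apply/seteqP; split => [x Px|x [t Pt /= xt]]; first by exists (Y x).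
by move: Pt; rewrite -xt.
Qed.

Lemma mlab_comp T U (h : T -> U) (Y : X -> T) : mlab Y -> mlab (fun x => h (Y x)).
Proof. by move=> mY u; exact: (@mlab_pred T Y (fun t => h t = u)). Qed.

Lemma mlab_pair T U (Y : X -> T) (Z : X -> U) : mlab Y -> mlab Z -> mlab (fun x => (Y x, Z x)).
Proof.
move=> mY mZ [t u]; rewrite (_ : _ @^-1` _ = Y @^-1` [set t] `&` Z @^-1` [set u]).
  exact: measurableI.
by apply/seteqP; split => x /= [-> ->].
Qed.

Lemma mlab_ffun (I : finType) T (Y : I -> X -> T) : (forall i, mlab (Y i)) ->
  mlab (fun x => [ffun i => Y i x]).
Proof.
move=> mY c; rewrite (_ : _ @^-1` _ = \bigcap_(i in [set: I]) (Y i @^-1` [set c i])).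
  by apply: fin_bigcap_measurable; [exact: finite_finset|move=> i _; exact: mY].
apply/seteqP; split => [x /= <- i _ /=|x h]; first by rewrite ffunE.
by apply/ffunP => i; rewrite ffunE; exact: h.
Qed.

Lemma mlab_asbool A : measurable A -> mlab (fun x => `[< A x >]).
Proof.
move=> mA [].
  by rewrite (_ : _ @^-1` _ = A)//; apply/seteqP; split => x /= /asboolP.
rewrite (_ : _ @^-1` _ = ~` A); first exact: measurableC.
by apply/seteqP; split => x /=; [move/asboolPn|move=> ?; apply/asboolPn].
Qed.

(* The entropy of [Y] on [E] for the unnormalised restriction of [mu] to [E], that
   is, [mu E] times its entropy for the conditional measure. *)
Definition HE mu E T (Y : X -> T) : R :=
  \sum_t entr (fm mu (E `&` Y @^-1` [set t])) - entr (fm mu E).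

Lemma HE_ge0 mu E T (Y : X -> T) : measurable E -> mlab Y -> 0 <= HE mu E Y.
Proof.
move=> mE mY; rewrite subr_ge0 -(fm_partition mu mE mY).
by apply: entr_sum_le => t; exact: fm_ge0.
Qed.

Lemma HE_gibbs mu E T (Y : X -> T) (a : T -> R) : measurable E -> mlab Y ->
  HE mu E Y + \sum_t fm mu (E `&` Y @^-1` [set t]) * a t <= fm mu E * ln (\sum_t expR (a t)).
Proof.
move=> mE mY; have := @gibbs R T (fun t => fm mu (E `&` Y @^-1` [set t])) a (fun t => fm_ge0 _ _).
by rewrite fm_partition// /HE => h; lra.
Qed.

Lemma HE_le_ln mu E T (Y : X -> T) : measurable E -> mlab Y ->
  HE mu E Y <= fm mu E * ln (#|T|%:R).
Proof.
move=> mE mY; have := @HE_gibbs mu E T Y (fun=> 0) mE mY.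
rewrite [X in _ + X]big1 ?addr0; last by move=> t _; rewrite mulr0.
by under eq_bigr do rewrite expR0; rewrite sumr_const.
Qed.

Lemma HE_det mu E T U (Y : X -> T) (Z : X -> U) : measurable E -> mlab Y -> mlab Z ->
  (forall x y, E x -> E y -> Z x = Z y -> Y x = Y y) -> HE mu E Y <= HE mu E Z.
Proof.
move=> mE mY mZ det; rewrite /HE lerD2r.
pose f u : T := if pselect (exists x, E x /\ Z x = u) is left h then Y (sval (cid h)) else Y point.
have fE x : E x -> f (Z x) = Y x.
  move=> Ex; rewrite /f; case: pselect => [h|[]]; last by exists x.
  by case: (cid h) => y [Ey yx] /=; exact: det.
rewrite (partition_big f predT)//=; apply: ler_sum => t _.
have -> : fm mu (E `&` Y @^-1` [set t]) = \sum_(u | f u == t) fm mu (E `&` Z @^-1` [set u]).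
  rewrite -(@fm_partition _ _ _ mu U Z)//; last exact: measurableI.
  rewrite [RHS]big_mkcond/=; apply: eq_bigr => u _; case: eqP => fu.
    congr fm; apply/seteqP; split => x /=; first by move=> [[Ex _] zx].
    by move=> [Ex zx]; split => //; split => //; rewrite -(fE x Ex) zx.
  rewrite -[RHS](fm0 mu); congr fm; apply/seteqP; split => x //= [[Ex yx] zx].
  by apply: fu; rewrite -zx (fE x Ex).
by apply: entr_sum_le => u; exact: fm_ge0.
Qed.

Lemma HE_deteq mu E T U (Y : X -> T) (Z : X -> U) : measurable E -> mlab Y -> mlab Z ->
  (forall x y, E x -> E y -> Z x = Z y <-> Y x = Y y) -> HE mu E Y = HE mu E Z.
Proof.
by move=> mE mY mZ h; apply/eqP; rewrite eq_le !HE_det// => x y Ex Ey /(h x y Ex Ey).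
Qed.

Lemma HE_ssa mu E T U V (Y : X -> T) (Z : X -> U) (W : X -> V) : measurable E ->
  mlab Y -> mlab Z -> mlab W ->
  HE mu E (fun x => (Y x, Z x, W x)) + HE mu E W <=
  HE mu E (fun x => (Y x, W x)) + HE mu E (fun x => (Z x, W x)).
Proof.
move=> mE mY mZ mW.
pose p t u v := fm mu (E `&` (Y @^-1` [set t] `&` Z @^-1` [set u] `&` W @^-1` [set v])).
have := @ssa R T U V p (fun _ _ _ => fm_ge0 _ _).
have pY t v : \sum_u p t u v = fm mu (E `&` (fun x => (Y x, W x)) @^-1` [set (t, v)]).
  rewrite -(@fm_partition _ _ _ mu U Z)//; last by apply: measurableI => //; exact: mlab_pair.
  apply: eq_bigr => u _; congr fm; apply/seteqP; split => x /=.
    by move=> [Ex [[-> ->] ->]].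
  by move=> [[Ex [-> ->]] ->].
have pZ u v : \sum_t p t u v = fm mu (E `&` (fun x => (Z x, W x)) @^-1` [set (u, v)]).
  rewrite -(@fm_partition _ _ _ mu T Y)//; last by apply: measurableI => //; exact: mlab_pair.
  apply: eq_bigr => t _; congr fm; apply/seteqP; split => x /=.
    by move=> [Ex [[-> ->] ->]].
  by move=> [[Ex [-> ->]] ->].
have pW v : \sum_t \sum_u p t u v = fm mu (E `&` W @^-1` [set v]).
  rewrite -(@fm_partition _ _ _ mu T Y)//; last by apply: measurableI.
  apply: eq_bigr => t _; rewrite pY; congr fm; apply/seteqP; split => x /=.
    by move=> [Ex [-> ->]].
  by move=> [[Ex ->] ->].
have pp t u v : p t u v = fm mu (E `&` (fun x => (Y x, Z x, W x)) @^-1` [set (t, u, v)]).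
  congr fm; apply/seteqP; split => x /=.
    by move=> [Ex [[-> ->] ->]].
  by move=> [Ex [-> -> ->]].
under [X in X + _ <= _ -> _]eq_bigr do under eq_bigr do under eq_bigr do rewrite pp.
under [X in _ + X <= _ -> _]eq_bigr do rewrite pW.
under [X in _ <= X + _ -> _]eq_bigr do under eq_bigr do rewrite pY.
under [X in _ <= _ + X -> _]eq_bigr do under eq_bigr do rewrite pZ.
rewrite !pair_bigA/= => h.
have e2 (S S' : finType) (f : S * S' -> R) : \sum_i f i = \sum_i f (i.1, i.2).
  by apply: eq_bigr => -[].
have e3 (f : T * U * V -> R) : \sum_i f i = \sum_i f (i.1.1, i.1.2, i.2).
  by apply: eq_bigr => -[[]].
rewrite /HE [X in X - _ + _]e3 [X in _ <= X - _ + _]e2 [X in _ <= _ + (X - _)]e2; lra.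
Qed.

Lemma HE_unit mu E : HE mu E (fun=> tt) = 0.
Proof.
rewrite /HE (bigD1 tt)//= big1 => [|[]//]; rewrite addr0.
by rewrite (_ : _ @^-1` _ = setT) ?setIT ?subrr//; apply/seteqP; split.
Qed.

Lemma mlab_cst T (t : T) : mlab (fun=> t : T).
Proof.
move=> u; rewrite (_ : _ @^-1` _ = [set x : X | t = u])//.
by case: (pselect (t = u)) => h; [rewrite (_ : mkset _ = setT)|rewrite (_ : mkset _ = set0)];
  try (apply/seteqP; split).
Qed.

Lemma HE_pair_le mu E T U (Y : X -> T) (Z : X -> U) : measurable E -> mlab Y -> mlab Z ->
  HE mu E (fun x => (Y x, Z x)) <= HE mu E Y + HE mu E Z.
Proof.
move=> mE mY mZ; have mt := mlab_cst tt.
have := @HE_ssa mu E _ _ _ Y Z (fun=> tt) mE mY mZ mt; rewrite HE_unit addr0.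
rewrite (@HE_deteq mu E _ _ (fun x => (Y x, tt)) Y) //; last 2 first.
- exact: mlab_pair.
- by move=> x y _ _; split => [->|[->]].
rewrite (@HE_deteq mu E _ _ (fun x => (Z x, tt)) Z) //; last 2 first.
- exact: mlab_pair.
- by move=> x y _ _; split => [->|[->]].
apply: le_trans; apply: HE_det => //; try by do ?apply: mlab_pair.
by move=> x y _ _ [-> ->].
Qed.

(** Chain rule. Because [HE] is not normalised, the conditional entropies given the cells of [Z] add
    up without weights. *)
Lemma sum_HE_fibre mu E T U (Y : X -> T) (Z : X -> U) : measurable E -> mlab Y -> mlab Z ->
  \sum_u HE mu (E `&` Z @^-1` [set u]) Y = HE mu E (fun x => (Y x, Z x)) - HE mu E Z.
Proof.
move=> mE mY mZ; rewrite /HE sumrB exchange_big/= pair_bigA/= opprB addrA subrK.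
congr (_ - _); apply: eq_bigr => -[t u] _ /=; congr (entr (fm mu _)).
apply/seteqP; split => x /=; first by move=> [[Ex ->] ->].
by move=> [Ex [-> ->]].
Qed.

Lemma sum_HE_fibre_le mu E T U (Y : X -> T) (Z : X -> U) : measurable E -> mlab Y -> mlab Z ->
  \sum_u HE mu (E `&` Z @^-1` [set u]) Y <= HE mu E Y.
Proof.
by move=> mE mY mZ; rewrite sum_HE_fibre// lerBlDr HE_pair_le.
Qed.

(** * Names along finite windows and mean entropy *)

Section Names.
Variables (G : groupType) (act : G -> X -> X).
Hypothesis mact : forall g A, measurable A -> measurable (act g @^-1` A).
Implicit Types (F K : {fset G}).

Definition name T (Y : X -> T) F (x : X) : {ffun F -> T} :=
  [ffun g : F => Y (act (fsval g) x)].

Lemma mlab_act T (Y : X -> T) g : mlab Y -> mlab (fun x => Y (act g x)).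
Proof. by move=> mY t; exact: (mact _ (mY t)). Qed.

Lemma mlab_name T (Y : X -> T) F : mlab Y -> mlab (name Y F).
Proof.
move=> mY; apply: (@mlab_ffun F T (fun g x => Y (act (fsval g) x))) => g.
exact: mlab_act.
Qed.

Lemma nameP T (Y : X -> T) F x y :
  name Y F x = name Y F y <-> forall g, g \in F -> Y (act g x) = Y (act g y).
Proof.
split => [/ffunP h g gF|h]; first by have := h [` gF]%fset; rewrite !ffunE.
by apply/ffunP => g; rewrite !ffunE; apply: h; exact: fsvalP.
Qed.

Lemma HE_name0 mu E T (Y : X -> T) : measurable E -> mlab Y -> HE mu E (name Y fset0) = 0.
Proof.
move=> mE mY; rewrite (@HE_deteq mu E _ _ (name Y fset0) (fun=> tt)) ?HE_unit//.
- exact: mlab_name.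
- exact: mlab_cst.
- by move=> x y _ _; split => // _; apply/nameP => g; rewrite inE.
Qed.

Lemma HE_name_mono mu E T (Y : X -> T) F K : measurable E -> mlab Y -> (F `<=` K)%fset ->
  HE mu E (name Y F) <= HE mu E (name Y K).
Proof.
move=> mE mY /fsubsetP FK; apply: HE_det => //; try exact: mlab_name.
by move=> x y _ _ /nameP h; apply/nameP => g /FK; exact: h.
Qed.

(** Strong subadditivity conditioned on the name along the intersection; this is the submodularity
    required by Shearer's inequality. *)
Lemma HE_name_sub mu E T (Y : X -> T) F K : measurable E -> mlab Y ->
  HE mu E (name Y (F `|` K)%fset) + HE mu E (name Y (F `&` K)%fset) <=
  HE mu E (name Y F) + HE mu E (name Y K).
Proof.
move=> mE mY; have mn (H : {fset G}) : mlab (name Y H) by exact: mlab_name.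
have := @HE_ssa mu E _ _ _ (name Y F) (name Y K) (name Y (F `&` K)%fset) mE (mn _) (mn _) (mn _).
rewrite (@HE_deteq mu E _ _ (fun x => (name Y F x, name Y (F `&` K)%fset x)) (name Y F))//; last 2 first.
- exact: mlab_pair.
- move=> x y _ _; split => [h|[-> _]//]; congr pair => //; apply/nameP => g.
  by rewrite inE => /andP[gF _]; apply: ((nameP Y F x y).1 h).
rewrite (@HE_deteq mu E _ _ (fun x => (name Y K x, name Y (F `&` K)%fset x)) (name Y K))//; last 2 first.
- exact: mlab_pair.
- move=> x y _ _; split => [h|[-> _]//]; congr pair => //; apply/nameP => g.
  by rewrite inE => /andP[_ gK]; apply: ((nameP Y K x y).1 h).
apply: le_trans; rewrite lerD2r; apply: HE_det => //; first by do ?apply: mlab_pair.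
move=> x y _ _ [/nameP h1 /nameP h2 _]; apply/nameP => g; rewrite inE => /orP[]; [exact: h1|exact: h2].
Qed.

Lemma HE_name1 mu E T (Y : X -> T) g : measurable E -> mlab Y ->
  HE mu E (name Y [fset g]%fset) = HE mu E (fun x => Y (act g x)).
Proof.
move=> mE mY; apply: HE_deteq => //; [exact: mlab_name|exact: mlab_act|].
move=> x y _ _; split => [h|/nameP]; last by apply; rewrite inE.
by apply/nameP => k; rewrite inE => /eqP ->.
Qed.

Lemma HE_name_shearer mu E T (Y : X -> T) (J : Type) (js : seq J) (S : J -> {fset G}) F k :
  measurable E -> mlab Y ->
  (forall g, g \in F -> (k <= count (fun j => g \in S j) js)%N) ->
  k%:R * HE mu E (name Y F) <= \sum_(j <- js) HE mu E (name Y (S j)).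
Proof.
move=> mE mY; apply: (@shearer R G (fun F => HE mu E (name Y F))).
- exact: HE_name0.
- by move=> A B; exact: HE_name_mono.
- by move=> A B; exact: HE_name_sub.
Qed.

Lemma HE_name_le_sum mu E T (Y : X -> T) F : measurable E -> mlab Y ->
  HE mu E (name Y F) <= \sum_(g <- F) HE mu E (fun x => Y (act g x)).
Proof.
move=> mE mY; rewrite -[leLHS]mul1r.
under [leRHS]eq_bigr do rewrite -HE_name1//.
apply: (@HE_name_shearer mu E T Y G (enum_fset F) (fun g => [fset g]%fset) F 1 mE mY) => g gF.
by rewrite -has_count; apply/hasP; exists g => //; rewrite inE.
Qed.

Section Invariant.
Variable mu : probability X R.
Hypothesis muI : G_invariant act mu.

Lemma HE_act T (Y : X -> T) g : mlab Y -> HE mu setT (fun x => Y (act g x)) = HE mu setT Y.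
Proof.
move=> mY; rewrite /HE; congr (_ - _); apply: eq_bigr => t _; congr (entr _).
by rewrite !setTI /fm -(muI g (mY t)).
Qed.

Hypothesis actM : forall g h x, act (g * h)%g x = act g (act h x).

(** The name of [x] along [F g] carries the same information as the name of [g x] along [F], and
    [mu] is invariant. *)
Lemma HE_name_trans T (Y : X -> T) F g : mlab Y ->
  HE mu setT (name Y (rtrans F g)) = HE mu setT (name Y F).
Proof.
move=> mY; rewrite -[RHS](@HE_act _ (name Y F) g); last exact: mlab_name.
apply: HE_deteq => //; [exact: mlab_name|by apply: mlab_act; exact: mlab_name|].
move=> x y _ _; split => /nameP h; apply/nameP => k.
  move=> /imfsetP[f /= fF ->]; rewrite !actM; exact: h.
by move=> kF; rewrite -!actM; apply: h; rewrite mem_rtrans mulgK.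
Qed.

Lemma HE_inf_rule T (Y : X -> T) K F : mlab Y ->
  #|` K|%:R * HE mu setT (name Y F) <= #|` fmul (fsinv K) F|%:R * HE mu setT (name Y K).
Proof.
move=> mY; apply: (@inf_rule R G (fun F => HE mu setT (name Y F))).
- exact: HE_name0.
- by move=> A B; exact: HE_name_mono.
- by move=> A B; exact: HE_name_sub.
- by move=> A g; exact: HE_name_trans.
Qed.

(* Taking the infimum over all finite windows, rather than a limit along a Folner
   sequence, makes the mean entropy a well-defined real without convergence. *)
Definition hrate T (Y : X -> T) : R :=
  inf [set HE mu setT (name Y K) / #|` K|%:R | K in [set K : {fset G} | K != fset0]].

Lemma hrate_le T (Y : X -> T) K : mlab Y -> K != fset0 ->
  hrate Y <= HE mu setT (name Y K) / #|` K|%:R.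
Proof.
move=> mY K0; apply: ge_inf; last by exists K.
by exists 0 => _ [F _ <-]; rewrite divr_ge0// HE_ge0//; exact: mlab_name.
Qed.

Lemma hrate_ge T (Y : X -> T) c :
  (forall K, K != fset0 -> c <= HE mu setT (name Y K) / #|` K|%:R) -> c <= hrate Y.
Proof.
move=> h; apply: lb_le_inf.
  by exists (HE mu setT (name Y [fset 1%g]%fset) / #|` [fset 1%g : G]%fset|%:R); exists [fset 1%g]%fset => //;
    apply/fset0Pn; exists 1%g; rewrite inE.
by move=> _ [K K0 <-]; exact: h.
Qed.

Variable F : nat -> {fset G}.
Hypothesis FF : Folner R F.

Lemma Folner_neq0 n : F n != fset0. Proof. by case: FF. Qed.

(** A window [K] nearly attaining the infimum is compared with [F n] by the infimum rule, and
    [K^-1 F n] is only slightly larger than [F n]. *)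
Lemma hrate_Folner_le T (Y : X -> T) (e : R) : mlab Y -> 0 < e -> exists N, forall n, (N <= n)%N ->
  HE mu setT (name Y (F n)) <= (hrate Y + e) * #|` F n|%:R.
Proof.
move=> mY e0.
have [K K0 Kh] : exists2 K, K != fset0 & HE mu setT (name Y K) / #|` K|%:R < hrate Y + e / 2.
  apply: contrapT => h; suff : hrate Y + e / 2 <= hrate Y by rewrite gerDl; have := e0; lra.
  apply: hrate_ge => K K0; rewrite leNgt; apply/negP => h2; apply: h; by exists K.
have Kp : 0 < (#|` K|%:R : R) by rewrite ltr0n cardfs_gt0.
set b := HE mu setT (name Y K) / #|` K|%:R in Kh.
have b0 : 0 <= b by rewrite divr_ge0// HE_ge0//; exact: mlab_name.
(* The surplus [e' * b] is then at most [e / 2]; the other half of [e] is the slack in [Kh]. *)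
pose e' := e / 2 / (b + 1).
have e'0 : 0 < e' by rewrite !divr_gt0// ltr_wpDl.
have [N NP] := @Folner_fmul_card R G F FF (fsinv K) e' e'0.
exists N => n /NP {}NP.
have := @HE_inf_rule T Y K (F n) mY; rewrite -(ler_pdivlMl _ _ Kp) mulrCA -/b => /le_trans; apply.
rewrite [_^-1 * _]mulrC -/b; apply: (le_trans (ler_wpM2r b0 NP)).
rewrite mulrAC ler_wpM2r//.
have : e' * b <= e / 2.
  rewrite /e' -mulrA ler_piMr ?divr_ge0 ?(ltW e0)// mulrC ler_pdivrMr ?ltr_wpDl//.
  by rewrite mul1r lerDl.
by rewrite mulrDl mul1r; move: Kh; lra.
Qed.

Lemma hrate_cvg T (Y : X -> T) : mlab Y ->
  HE mu setT (name Y (F n)) / #|` F n|%:R @[n --> \oo] --> hrate Y.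
Proof.
move=> mY; apply/cvgrPdist_le => e e0; have [N NP] := hrate_Folner_le mY e0.
exists N => // n /= /NP {}NP; have Fp := Folner_card_gt0 FF n.
have h1 := hrate_le mY (Folner_neq0 n).
have h2 : HE mu setT (name Y (F n)) / #|` F n|%:R <= hrate Y + e by rewrite ler_pdivrMr.
by rewrite distrC ger0_norm ?subr_ge0// lerBlDl.
Qed.

(** [H_join] runs over maps from positions of [K] to cells, a name over elements of [K]; both induce
    the same equivalence relation on points, and entropy depends on nothing else. For the same
    reason [Y] may have any label type. *)
Lemma H_joinE k (alpha : 'I_k -> set X) (T : finType) (Y : X -> T) K :
  finite_partition alpha -> mlab Y ->
  (forall x y, Y x = Y y <-> exists2 i, alpha i x & alpha i y) ->
  H_join act mu K alpha = HE mu setT (name Y K).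
Proof.
move=> [ma [dis cov]] mY YP.
have ex x : exists i, alpha i x by have : [set: X] x by []; rewrite -cov => -[i _ h]; exists i.
pose Z x := sval (cid (ex x)).
have ZP x : alpha (Z x) x by rewrite /Z; case: cid.
have Zu x i : alpha i x -> Z x = i.
  move=> ix; apply: contrapT => /eqP h; have := dis _ _ h.
  by move/seteqP => [+ _] => /(_ x); apply; split => //; exact: ZP.
have Ze i : Z @^-1` [set i] = alpha i.
  by apply/seteqP; split => x /= => [<-//|]; exact: Zu.
have mZ : mlab Z by move=> i; rewrite Ze.
pose W x := [ffun j : 'I_(size (K : seq G)) => Z (act (nth 1%g (K : seq G) j) x)].
have mW : mlab W.
  by apply: (mlab_ffun (Y := fun (j : 'I_(size (K : seq G))) x => Z (act (nth 1%g (K : seq G) j) x))) => j; exact: mlab_act.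
have -> : HE mu setT (name Y K) = HE mu setT W.
  apply: HE_deteq => //; first exact: mlab_name.
  move=> x y _ _; split.
    move=> /ffunP h; apply/nameP => g gK; apply/YP.
    have jl : (index g (K : seq G) < size (K : seq G))%N by rewrite index_mem.
    have := h (Ordinal jl); rewrite !ffunE/= nth_index// => e.
    by exists (Z (act g x)); [|rewrite e].
  move=> /nameP h; apply/ffunP => j; rewrite !ffunE.
  have /h/YP[i ix iy] : nth 1%g (K : seq G) j \in K by exact: mem_nth.
  by rewrite (Zu _ _ ix) (Zu _ _ iy).
rewrite /HE fmT entr1 subr0 /H_join; apply: eq_bigr => c _; congr (entr (fine (mu _))).
rewrite setTI; apply/seteqP; split => x /=.
  by move=> h; apply/ffunP => j; rewrite ffunE; apply: Zu; exact: h.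
by move=> <- j; rewrite ffunE; exact: ZP.
Qed.

(** The averages along [F] converge to [hrate], so the [limn] in [h_part] is a genuine limit. *)
Lemma h_part_hrate k (alpha : 'I_k -> set X) (T : finType) (Y : X -> T) :
  finite_partition alpha -> mlab Y ->
  (forall x y, Y x = Y y <-> exists2 i, alpha i x & alpha i y) ->
  h_part act mu F alpha = hrate Y.
Proof.
move=> pa mY YP; rewrite /h_part; apply: cvg_lim => //.
under eq_fun do rewrite (H_joinE _ pa mY YP).
exact: hrate_cvg.
Qed.

End Invariant.
End Names.
End Labels.

(** * Weak compactness *)

Section NormedCopy.
Context {R : realType} {dd : measure_display} {T : measurableType dd}.
Variable m : {measure set T -> \bar R}.
(** The proof of total mass 1 is an argument so that the copy has a head symbol of its own, to which
    the probability structure can be attached. *)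
Definition normed_copy (_ : m setT = 1%E) : set T -> \bar R := m.
Section Instances.
Variable m1 : m setT = 1%E.
HB.instance Definition _ := Measure.copy (normed_copy m1) m.
HB.instance Definition _ := Measure_isProbability.Build _ _ R (normed_copy m1) m1.
End Instances.
Definition to_prob m1 : probability T R := normed_copy m1.
End NormedCopy.

Section Law.
Context {R : realType} {d1 d2 : measure_display}.
Context {T : measurableType d1} {X : measurableType d2}.
Variables (P : probability T R) (f : T -> X).
Definition law (_ : measurable_fun setT f) : set X -> \bar R := pushforward P f.
Section Instances.
Hypothesis mf : measurable_fun setT f.
Local Notation lw := (law mf).
Let law0 : lw set0 = 0%E.
Proof. by rewrite /law /pushforward preimage_set0 measure0. Qed.
Let law_ge0 A : (0 <= lw A)%E.
Proof. by apply: measure_ge0. Qed.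
Let law_sigma_additive : semi_sigma_additive lw.
Proof.
move=> F mF tF mUF; rewrite /law /pushforward preimage_bigcup.
apply: measure_semi_sigma_additive.
- by move=> n; rewrite -[X in measurable X]setTI; exact: mf.
- apply/trivIsetP => /= i j _ _ ij; rewrite -preimage_setI.
  by move/trivIsetP : tF => /(_ _ _ _ _ ij) ->//; rewrite preimage_set0.
- by rewrite -preimage_bigcup -[X in measurable X]setTI; exact: mf.
Qed.
HB.instance Definition _ := isMeasure.Build _ _ _ lw law0 law_ge0 law_sigma_additive.
Let lawT : lw setT = 1%E.
Proof. by rewrite /law /pushforward preimage_setT probability_setT. Qed.
HB.instance Definition _ := Measure_isProbability.Build _ _ R lw lawT.
Definition prob_law : probability X R := lw.

Lemma Ex_law phi : bmeas phi -> Ex prob_law phi = Ex P (phi \o f).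
Proof.
move=> bphi; apply: EFin_inj.
have bf : bmeas (phi \o f).
  case: bphi => m [M h]; split; first exact: (measurableT_comp m mf).
  by exists M => x /=.
rewrite -ExE// -(ExE P bf) /prob_law; apply: (integral_pushforward mf) => //.
- by apply/measurable_EFinP; case: bphi.
- rewrite preimage_setT; exact: (bmeas_integrable P bf).
Qed.
End Instances.
End Law.

Section Diagonal.
Variable R : realType.

Lemma diagonal_subseq (u : nat -> nat -> R) : (forall i, exists M : R, forall n, `|u i n| <= M) ->
  exists s : nat -> nat, {homo s : m n / (m < n)%N} /\ forall i, cvgn (u i \o s).
Proof.
move=> bu.
have step i (s : nat -> nat) : exists t : nat -> nat,
    {homo t : m n / (m < n)%N} /\ cvgn (u i \o (s \o t)).
  have [M hM] := bu i.
  have bs : bounded_fun (u i \o s).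
    by exists M; split; [exact: num_real|move=> x Mx n _; exact: (le_trans (hM _) (ltW Mx))].
  have [t it ct] := bolzano_weierstrass bs; exists t; split=> //.
  by move=> m n mn; rewrite ltnNge; apply/negP; rewrite [(_ <= _)%N]it; apply/negP; rewrite -ltnNge.
pose tt i s := sval (cid (step i s)).
have ttP i s : {homo tt i s : m n / (m < n)%N} /\ cvgn (u i \o (s \o tt i s)).
  by rewrite /tt; case: cid.
pose fix sg i : nat -> nat := if i is j.+1 then sg j \o tt j (sg j) else id.
have sgh i : {homo sg i : m n / (m < n)%N}.
  by elim: i => //= i IH m n mn; apply: IH; exact: (ttP i _).1.
have hge (f : nat -> nat) : {homo f : m n / (m < n)%N} -> forall n, (n <= f n)%N.
  by move=> hf; elim=> // n IH; apply: leq_ltn_trans IH _; exact: hf.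
exists (fun n => sg n n); split.
  apply: homo_ltn; first exact: ltn_trans.
  move=> n /=; apply: sgh; exact: (hge _ (ttP n _).1).
move=> i; have /cvg_ex[l hl] := (ttP i (sg i)).2.
apply/cvg_ex; exists l; apply/cvgrPdist_lt => e e0.
move/cvgrPdist_lt : hl => /(_ _ e0)[N _ NP]; exists (maxn N i.+1) => // n /=.
rewrite geq_max => /andP[Nn ni].
(* From index [i + 1] on, a diagonal term is a term of [sg i.+1] at a position no smaller than [n],
   which is all that convergence along [sg i.+1] requires. *)
have [m nm ->] : exists2 m, (n <= m)%N & sg n n = sg i.+1 m.
  have claim j : exists t : nat -> nat, {homo t : m n / (m < n)%N} /\ sg (j + i.+1)%N = sg i.+1 \o t.
    elim: j => [|j [t [ht te]]]; first by exists id; split.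
    exists (t \o tt (j + i.+1)%N (sg (j + i.+1)%N)); split.
      by move=> m p mp; apply: ht; exact: (ttP _ _).1.
    rewrite addSn; change (sg (j + i.+1)%N \o tt (j + i.+1)%N (sg (j + i.+1)%N) =
      sg i.+1 \o t \o tt (j + i.+1)%N (sg (j + i.+1)%N)); by rewrite {1}te.
  have [t [ht te]] := claim (n - i.+1)%N; exists (t n); first exact: hge.
  by rewrite subnK// in te; rewrite te.
by apply: NP => /=; exact: leq_trans Nn nm.
Qed.

End Diagonal.

Section ExLabel.
Context {R : realType} {dd : measure_display} {T : measurableType dd}.

Lemma Ex_label (mu : probability T R) (I : choiceType) (s : seq I) (Y : T -> I) (h : I -> R) :
  uniq s -> (forall x, Y x \in s) -> (forall i, measurable (Y @^-1` [set i])) ->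
  bmeas (h \o Y) /\ Ex mu (h \o Y) = \sum_(i <- s) h i * fm mu (Y @^-1` [set i]).
Proof.
move=> us sY mY.
have E : h \o Y = fun x => \sum_(i <- s) h i * \1_(Y @^-1` [set i]) x.
  apply/funext => x /=; rewrite (bigD1_seq (Y x))//= indicE mem_set//= mulr1 big1 ?addr0//.
  move=> i iY; rewrite indicE memNset ?mulr0//= => yi; by rewrite yi eqxx in iY.
have b i : bmeas (fun x => h i * \1_(Y @^-1` [set i]) x).
  by apply: bmeasZ; exact: bmeas_indic.
rewrite E; split; first exact: bmeas_sum.
rewrite Ex_sum//; apply: eq_bigr => i _; rewrite ExZ; last exact: bmeas_indic.
by rewrite Ex_indic.
Qed.

Lemma measurable_countlabel (I : countType) (Y : T -> I) (P : I -> Prop) :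
  (forall i, measurable (Y @^-1` [set i])) -> measurable [set x | P (Y x)].
Proof.
move=> mY; pose A n : set T := if (choice.unpickle n : option I) is Some i then
  (if `[< P i >] then Y @^-1` [set i] else set0) else set0.
rewrite (_ : [set x | P (Y x)] = \bigcup_n A n).
  apply: bigcup_measurable => n _; rewrite /A; case: choice.unpickle => // i.
  by case: asboolP.
apply/seteqP; split => [x Px|x [n _]].
  by exists (choice.pickle (Y x)) => //; rewrite /A choice.pickleK; case: asboolP.
by rewrite /A; case: choice.unpickle => // i; case: asboolP => // Pi /= ->.
Qed.

End ExLabel.

Lemma cvg_sum_seq (R : realType) (I : Type) (s : seq I) (u : I -> nat -> R) (l : I -> R) :
  (forall i, u i n @[n --> \oo] --> l i) ->
  \sum_(i <- s) u i n @[n --> \oo] --> \sum_(i <- s) l i.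
Proof.
move=> h; elim: s => [|i s IH].
  by rewrite big_nil; apply: cvg_near_cst; apply: nearW => n; rewrite big_nil.
by rewrite big_cons; under eq_fun do rewrite big_cons; exact: cvgD.
Qed.

Section WeakConvergence.
Context {R : realType} {disp : measure_display} {X : measurableType disp}.
Variable d : X -> X -> R.
Hypothesis dm : is_metric d.
Hypothesis dc : dcompact d.
Hypothesis db : borel_for_d d.
Local Notation dcont := (dcontinuous_real d).
Implicit Types (mu : probability X R).

Definition wconv (mus : nat -> probability X R) mu :=
  forall psi, dcont psi -> Ex (mus n) psi @[n --> \oo] --> Ex mu psi.

Section Construction.
Variable mus : nat -> probability X R.
Variable D : nat -> set X.
Hypothesis mD : forall i, measurable (D i).
Hypothesis sepD : forall e : R, 0 < e -> exists n, forall x y, same_bits D n x y -> d x y < e.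

(** The limit measure is built as a law. The limits [p w] of the masses of cells are consistent
    under splitting, so they cut [[0, 1[] into nested intervals of length [p w]. A number [u] reads
    off a word of every length, and points chosen in the cells of these words converge to [xi u].
    The limit is the law of [xi] under Lebesgue measure. It need not give a cell the mass [p w],
    since limit points may leave the cell; only integrals of continuous functions are compared. *)
Let bits n x : seq bool := mkseq (fun i => `[< D i x >]) n.
Let cell (w : seq bool) : set X := [set x | bits (size w) x = w].

Let size_bits n x : size (bits n x) = n. Proof. exact: size_mkseq. Qed.

Let bitsS n x : bits n.+1 x = rcons (bits n x) `[< D n x >]. Proof. exact: mkseqS. Qed.

Let fibre n w : bits n @^-1` [set w] = if size w == n then cell w else set0.
Proof.
case: eqP => [<-//|ne]; apply/seteqP; split => x //= bw.
by apply: ne; rewrite -bw size_bits.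
Qed.

Let cell_rcons w b : cell (rcons w b) = cell w `&` (if b then D (size w) else ~` D (size w)).
Proof.
apply/seteqP; split => x /=; rewrite /cell/= size_rcons bitsS.
  move=> /rcons_inj[-> <-]; split => //.
  by case: asboolP.
by move=> [-> h]; congr rcons; case: b h => h; case: asboolP.
Qed.

Let mcell w : measurable (cell w).
Proof.
elim/last_ind: w => [|w b IH].
  by rewrite (_ : cell [::] = setT)//; apply/seteqP; split.
by rewrite cell_rcons; apply: measurableI => //; case: b => //; apply: measurableC.
Qed.

Let same_bitsP n x y : bits n x = bits n y -> same_bits D n x y.
Proof.
move=> h i ni; have := congr1 (fun s => nth false s i) h.
by rewrite !nth_mkseq// => e; split => /asboolP; [rewrite e|rewrite -e] => /asboolP.
Qed.

Variable p : seq bool -> R.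
Hypothesis pE : forall w, fm (mus n) (cell w) @[n --> \oo] --> p w.

Let p_ge0 w : 0 <= p w.
Proof.
rewrite -(cvg_lim _ (@pE w))//; apply: limr_ge; first by apply/cvg_ex; exists (p w); exact: pE.
by apply: nearW => n; exact: fm_ge0.
Qed.

Let p_nil : p [::] = 1.
Proof.
rewrite -(cvg_lim _ (@pE [::]))//; apply: cvg_lim => //; apply: cvg_near_cst; apply: nearW => n.
by rewrite (_ : cell [::] = setT) ?fmT//; apply/seteqP; split.
Qed.

Let p_split w : p w = p (rcons w false) + p (rcons w true).
Proof.
rewrite -(cvg_lim _ (@pE w))//; apply: cvg_lim => //.
rewrite (_ : (fun n => _) = fun n => fm (mus n) (cell (rcons w false)) + fm (mus n) (cell (rcons w true))).
  exact: cvgD (@pE _) (@pE _).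
apply/funext => n; rewrite !cell_rcons.
by rewrite (fmID _ (mcell w) (mD (size w))) addrC setDE.
Qed.

Let p_cell w : 0 < p w -> exists x, cell w x.
Proof.
move=> pw; apply: contrapT => h; move: pw; rewrite -(cvg_lim _ (@pE w))//.
rewrite (_ : (fun n => _) = fun=> 0); first by rewrite lim_cst// ltxx.
apply/funext => n; rewrite (_ : cell w = set0) ?fm0//.
by apply/seteqP; split => x //= cx; apply: h; exists x.
Qed.

(* The interval [[lend w, lend w + p w[] of the unit interval is attributed to the word [w] *)
Let addr_step (st : seq bool * R) b := (rcons st.1 b, st.2 + if b then p (rcons st.1 false) else 0).
Let addr w := foldl addr_step ([::], 0) w.
Let lend w : R := (addr w).2.

Let addr1 w : (addr w).1 = w.
Proof. by elim/last_ind: w => // w b IH; rewrite /addr foldl_rcons /= -/(addr w) IH. Qed.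

Let lend_rcons w b : lend (rcons w b) = lend w + if b then p (rcons w false) else 0.
Proof. by rewrite /lend /addr foldl_rcons /= -/(addr w) addr1. Qed.

Fixpoint word_at (n : nat) (u : R) : seq bool :=
  if n is m.+1 then let w := word_at m u in rcons w (~~ (u < lend w + p (rcons w false))) else [::].

Let size_word n u : size (word_at n u) = n.
Proof. by elim: n => //= n IH; rewrite size_rcons IH. Qed.

Let word_in n u : 0 <= u < 1 -> lend (word_at n u) <= u < lend (word_at n u) + p (word_at n u).
Proof.
move=> u01; elim: n => [|n IH] /=; first by rewrite /lend /= p_nil add0r.
set w := word_at n u in IH *; rewrite lend_rcons; have := p_split w.
have := p_ge0 (rcons w true); have := p_ge0 (rcons w false); move: IH => /andP[].
by case: (ltP u (lend w + p (rcons w false))) => /= h1 h2 h3 h4 h5 h6; rewrite ?addr0; apply/andP; split => //; lra.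
Qed.

Let in_word w u : lend w <= u < lend w + p w -> 0 <= u < 1 /\ word_at (size w) u = w.
Proof.
elim/last_ind: w => [|w b IH]; first by rewrite /lend /= p_nil add0r.
rewrite lend_rcons size_rcons /= => h.
have := p_split w; have := p_ge0 (rcons w true); have := p_ge0 (rcons w false) => h1 h2 h3.
have /IH[u01 ->] : lend w <= u < lend w + p w.
  by move: h; case: b => /andP[]; rewrite ?addr0 => *; apply/andP; split; lra.
split => //; congr rcons; move: h; case: b => /andP[]; rewrite ?addr0 => h4 h5.
  by rewrite -leNgt.
by apply/negbTE; rewrite negbK.
Qed.

Let word_fibre n w : [set u : R | 0 <= u < 1 /\ word_at n u = w] =
  if size w == n then `[lend w, lend w + p w[%classic else set0.
Proof.
case: eqP => [<-|ne]; apply/seteqP; split => u /=.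
- by move=> [u01 <-]; rewrite in_itv/=; have := word_in (size w) u01.
- by rewrite in_itv/=; exact: in_word.
- by move=> [_ h]; apply: ne; rewrite -h size_word.
- by [].
Qed.

Let unit01 : set R := `[0, 1[%classic.
Let munit01 : measurable unit01. Proof. exact: measurable_itv. Qed.
Let leb01 : mrestr lebesgue_measure munit01 setT = 1%E.
Proof.
rewrite /mrestr setTI /unit01 lebesgue_measure_itv/= lte_fin ltr01.
by rewrite oppr0 adde0.
Qed.
Let P0 : probability (measurableTypeR R) R := to_prob leb01.

(** Extends the words to all reals, those outside [[0, 1[] being read as 0; [P0] does not charge
    them. *)
Let clamp (u : R) : R := if 0 <= u < 1 then u else 0.
Let clamp01 u : 0 <= clamp u < 1.
Proof. by rewrite /clamp; case: ifP => //; rewrite lexx ltr01. Qed.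

Let mword n w : measurable ([set u | word_at n (clamp u) = w] : set (measurableTypeR R)).
Proof.
pose A := [set u : R | 0 <= u < 1 /\ word_at n u = w].
have mA : measurable (A : set (measurableTypeR R)).
  by rewrite /A word_fibre; case: ifP => // _; exact: measurable_itv.
have m01 : measurable (unit01 : set (measurableTypeR R)) by exact: munit01.
rewrite (_ : [set u | _] = A `|` (~` unit01 `&` [set u | word_at n 0 = w])).
  apply: measurableU => //; apply: measurableI; first exact: measurableC.
  case: (pselect (word_at n 0 = w)) => h.
    by rewrite (_ : mkset _ = setT)//; apply/seteqP; split.
  by rewrite (_ : mkset _ = set0)//; apply/seteqP; split.
apply/seteqP; split => u /=; rewrite /clamp /unit01 /= in_itv/=.
  by case: ifP => u01 h; [left|right; split => //; rewrite u01].
by case => [[-> //]|[/negP/negbTE -> //]].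
Qed.

Let P0_word n w : size w = n -> fm P0 [set u | word_at n (clamp u) = w] = p w.
Proof.
move=> nw; rewrite /fm (_ : P0 _ = lebesgue_measure ([set u | word_at n (clamp u) = w] `&` unit01))//.
rewrite (_ : _ `&` _ = [set u : R | 0 <= u < 1 /\ word_at n u = w]); last first.
  apply/seteqP; split => u /=; rewrite /unit01 /= in_itv/= /clamp.
    by move=> [+ u01]; rewrite u01.
  by move=> [u01]; rewrite u01.
rewrite word_fibre nw eqxx lebesgue_measure_itv/= lte_fin.
by case: ltP => [_|h]; [rewrite -EFinD/= addrC addKr|have := p_ge0 w; rewrite /=; lra].
Qed.

Let pt w : X := if pselect (exists x, cell w x) is left h then sval (cid h) else point.
Let ptP w : (exists x, cell w x) -> cell w (pt w).
Proof. by move=> h; rewrite /pt; case: pselect => // k; case: cid. Qed.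

Let x_ n u := pt (word_at n (clamp u)).

Let x_cell n u : cell (word_at n (clamp u)) (x_ n u).
Proof.
by apply: ptP; apply: p_cell; have := word_in n (clamp01 u) => /andP[h1 h2]; lra.
Qed.

Let bits_x n m u : (n <= m)%N -> bits n (x_ m u) = word_at n (clamp u).
Proof.
move=> nm; have := x_cell m u; rewrite /cell /= size_word.
move: (x_ m u) => x h; elim: m nm h => [|m IH]; first by rewrite leqn0 => /eqP ->.
rewrite leq_eqVlt => /predU1P[->//|nm]; rewrite bitsS /= => /rcons_inj[h _].
exact: IH.
Qed.

Let x_cauchy u (e : R) : 0 < e -> exists N, forall m n, (N <= m)%N -> (N <= n)%N -> d (x_ m u) (x_ n u) < e.
Proof.
move=> e0; have [N NP] := sepD e0; exists N => m n Nm Nn.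
by apply: NP; apply: same_bitsP; rewrite !bits_x.
Qed.

Let xi u : X := sval (cid (dcomplete dm dc (@x_cauchy u))).
Let xiP u (e : R) : 0 < e -> exists N, forall n, (N <= n)%N -> d (x_ n u) (xi u) < e.
Proof. by rewrite /xi; case: cid => x /= h; exact: h. Qed.

Let cvg_xi phi u : dcont phi -> phi (x_ n u) @[n --> \oo] --> phi (xi u).
Proof.
move=> cphi; apply/cvgrPdist_lt => e e0.
have [r r0 hr] := cphi (xi u) e e0; have [N NP] := xiP u r0.
by exists N => // n /= /NP h; apply: hr; rewrite (dsym dm).
Qed.

Let mphi_xi phi : dcont phi -> measurable_fun [set: measurableTypeR R] (phi \o xi).
Proof.
move=> cphi; apply: (@measurable_fun_cvg _ _ _ _ (fun n u => phi (x_ n u))); last first.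
  by move=> u _; exact: cvg_xi.
move=> n; apply: (measurability _ (RGenOInfty.measurableE R)) => //.
move=> _ [_ [c ->] <-]; rewrite setTI.
rewrite (_ : _ @^-1` _ = [set u | c < phi (pt (word_at n (clamp u)))]); last first.
  by apply/seteqP; split => u /=; rewrite in_itv/= andbT.
apply: (@measurable_countlabel _ _ _ (fun u => word_at n (clamp u)) (fun w => c < phi (pt w))).
exact: mword.
Qed.

Let mxi : measurable_fun [set: measurableTypeR R] xi.
Proof.
move=> _ B mB; rewrite setTI; move: mB; rewrite db => mB.
have : [set B | measurable (xi @^-1` B : set (measurableTypeR R))] B.
  apply: mB; split.
    split => /=; first by rewrite preimage_set0.
      by move=> A mA; rewrite setTD preimage_setC; exact: measurableC.
    by move=> A mA; rewrite preimage_bigcup; exact: bigcup_measurable.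
  (* So far measurability is known only for continuous functions of [xi]; an open set is where the
     distance to its complement is positive. *)
  move=> U oU /=; rewrite (_ : xi @^-1` U = [set u | 0 < (dist1 d (~` U) \o xi) u]); last first.
    apply/seteqP; split => u /=; first exact: dist1_gt0.
    by move=> h; apply: contrapT => nU; move: h; rewrite dist1_in ?ltxx.
  rewrite -[X in measurable X]setTI.
  have mI : measurable (`]0, +oo[%classic : set R) by exact: measurable_itv.
  have := mphi_xi (dcont_dist1 dm (~` U)) measurableT mI.
  rewrite (_ : _ @^-1` _ = [set u | 0 < (dist1 d (~` U) \o xi) u])//.
  by apply/seteqP; split => u /=; rewrite in_itv/= andbT.
by [].
Qed.

Let mu0 : probability X R := prob_law P0 mxi.

Let words n : seq (seq bool) := [seq tval t | t <- enum {: n.-tuple bool}].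
Let words_uniq n : uniq (words n).
Proof. by rewrite map_inj_uniq ?enum_uniq//; exact: val_inj. Qed.
Let mem_words n w : (w \in words n) = (size w == n).
Proof.
apply/mapP/eqP => [[t _ ->]|wn]; first exact: size_tuple.
by exists (tcast wn (in_tuple w)); rewrite ?mem_enum// val_tcast.
Qed.

(** At a level [n] whose words fix [psi] up to [e / 4], every integral of [psi] is within [e / 4] of
    a finite sum [S] of cell masses, and [S] passes to the limit. *)
Lemma construction_wconv : exists mu, wconv mus mu.
Proof.
exists mu0 => psi cpsi; apply/cvgrPdist_lt => e e0.
have e4 : 0 < e / 4 by rewrite divr_gt0.
have [r r0 hr] := dcont_unif dm dc cpsi e4; have [n nP] := sepD r0.
have osc x y : bits n x = bits n y -> `|psi x - psi y| <= e / 4.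
  by move=> h; apply/ltW/hr/nP/same_bitsP.
have bpsi := dcont_bmeas dm db dc cpsi.
pose S q := \sum_(w <- words n) psi (pt w) * q w.
have approx nu : `|Ex nu psi - S (fun w => fm nu (cell w))| <= e / 4.
  have mfib w : measurable (bits n @^-1` [set w]) by rewrite fibre; case: ifP.
  have [b1 E1] := @Ex_label R _ X nu _ (words n) (bits n) (psi \o pt) (words_uniq n)
    (fun x => eq_trans (mem_words n (bits n x)) (introT eqP (size_bits n x)))
    mfib.
  have -> : S (fun w => fm nu (cell w)) = Ex nu ((psi \o pt) \o bits n).
    rewrite E1 /S big_seq [RHS]big_seq; apply: eq_bigr => w.
    by rewrite mem_words fibre => ->.
  rewrite -ExB//; apply: Ex_abs_le; first exact: bmeasB.
  move=> x /=; apply: osc.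
  have : cell (bits n x) (pt (bits n x)).
    by apply: ptP; exists x; rewrite /cell/= size_bits.
  by rewrite /cell/= size_bits.
have approx0 : `|Ex mu0 psi - S p| <= e / 4.
  rewrite /mu0 Ex_law//.
  have [b1 E1] := @Ex_label R _ _ P0 _ (words n) (fun u => word_at n (clamp u)) (psi \o pt) (words_uniq n)
    (fun u => eq_trans (mem_words n _) (introT eqP (size_word n _))) (mword n).
  have -> : S p = Ex P0 ((psi \o pt) \o (fun u => word_at n (clamp u))).
    rewrite E1 /S big_seq [RHS]big_seq; apply: eq_bigr => w.
    by rewrite mem_words => /eqP wn; rewrite -(P0_word wn).
  have bxi : bmeas (psi \o xi).
    by split; [exact: mphi_xi|case: bpsi => _ [M h]; exists M => u /=].
  rewrite -ExB//; apply: Ex_abs_le; first exact: bmeasB.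
  (* For [m >= n] the points [x_ m u] and [x_ n u] share their first [n] bits; the bound is passed
     to the limit in [m], which works even if [xi u] lies in another cell. *)
  move=> u; change (`|psi (xi u) - psi (x_ n u)| <= e / 4).
  have h : `|psi (x_ m u) - psi (x_ n u)| @[m --> \oo] --> `|psi (xi u) - psi (x_ n u)|.
    by apply: cvg_norm; apply: cvgB; [exact: cvg_xi|exact: cvg_cst].
  rewrite -(cvg_lim _ h)//; apply: limr_le; first by apply/cvg_ex; eexists; exact: h.
  by exists n => // m /= nm; apply: osc; rewrite !bits_x.
have cS : S (fun w => fm (mus k) (cell w)) @[k --> \oo] --> S p.
  by apply: cvg_sum_seq => w; apply: cvgM; [exact: cvg_cst|exact: pE].
move/cvgrPdist_lt : cS => /(_ _ e4)[N _ NP]; exists N => // k /= /NP {}NP.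
have a1 := approx (mus k).
rewrite (_ : Ex mu0 psi - Ex (mus k) psi = (Ex mu0 psi - S p) +
   (S p - S (fun w => fm (mus k) (cell w))) - (Ex (mus k) psi - S (fun w => fm (mus k) (cell w)))); last by ring.
rewrite (le_lt_trans (ler_normB _ _))// (@le_lt_trans _ _ (e / 4 + e / 4 + e / 4))//; last by lra.
by rewrite lerD// (le_trans (ler_normD _ _))// lerD// ltW.
Qed.

End Construction.

(** There are countably many words, so along a diagonal subsequence the masses of all cells
    converge, which is the starting point of the construction above. *)
Lemma weak_compact (mus : nat -> probability X R) :
  exists s : nat -> nat, {homo s : m n / (m < n)%N} /\ exists mu, wconv (mus \o s) mu.
Proof.
have [D [mD sepD]] := separating_sets dm db dc.
pose cl (w : seq bool) : set X := [set x | mkseq (fun i => `[< D i x >]) (size w) = w].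
pose u i n := fm (mus n) (cl (odflt [::] (choice.unpickle i))).
have [|s [hs cs]] := @diagonal_subseq R u.
  move=> i; exists 1 => n; rewrite ger0_norm ?fm_ge0// fm_le1//.
  pose Y := fun x => [ffun j : 'I_(size (odflt [::] (choice.unpickle i) : seq bool)) => `[< D j x >]].
  set w := odflt _ _ in Y *.
  rewrite (_ : cl w = [set x | Y x = [ffun j : 'I_(size w) => nth false w j]]).
    apply: (@mlab_pred _ _ _ Y (fun c => c = _)).
    by apply: (mlab_ffun (Y := fun (j : 'I_(size w)) x => `[< D j x >])) => j; exact: mlab_asbool.
  apply/seteqP; split => x /=.
    move=> h; apply/ffunP => j; rewrite !ffunE.
    by have := congr1 (fun t => nth false t j) h; rewrite nth_mkseq.
  move=> /ffunP h; apply: (@eq_from_nth _ false); first exact: size_mkseq.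
  rewrite size_mkseq => j jw; rewrite nth_mkseq//.
  by have := h (Ordinal jw); rewrite !ffunE.
exists s; split => //.
pose p w := limn (fun n => fm (mus (s n)) (cl w)).
have pE w : fm ((mus \o s) n) (cl w) @[n --> \oo] --> p w.
  have uE n : u (choice.pickle w) n = fm (mus n) (cl w) by rewrite /u choice.pickleK.
  have := cs (choice.pickle w); rewrite (_ : _ \o _ = fun n => fm (mus (s n)) (cl w))//.
  by apply/funext => n; exact: uE.
exact: (construction_wconv mD sepD pE).
Qed.

End WeakConvergence.

(** * Measures of large entropy at a given scale *)

Section SmallEntropy.
Context {R : realType} {dd : measure_display} {X : measurableType dd}.
Local Notation entr := (@entr_fun R).

Lemma sum_option (U : finType) (f : option U -> R) :
  \sum_o f o = f None + \sum_u f (Some u).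
Proof.
rewrite (bigD1 None)//=; congr (_ + _).
rewrite (reindex_omap (Some : U -> option U) id); last by case.
by apply: eq_bigl => u /=; rewrite eqxx.
Qed.

(** The letter [None] contributes [entr (1 - k)], and the remaining letters, of total mass [k], obey
    the unnormalised Gibbs inequality. *)
Lemma HE_option_gibbs (mu : probability X R) (U : finType) (Z : X -> option U) (a : U -> R) (k : R) :
  mlab Z -> k = fm mu [set x | Z x <> None] ->
  HE mu setT Z + \sum_u fm mu (Z @^-1` [set Some u]) * a u <=
  entr k + entr (1 - k) + k * ln (\sum_u expR (a u)).
Proof.
move=> mZ kD; have kE : k = \sum_u fm mu (Z @^-1` [set Some u]).
  have h : fm mu (Z @^-1` [set None]) + \sum_u fm mu (Z @^-1` [set Some u]) = 1.
    rewrite -(fmT mu) -(fm_partition mu measurableT mZ) sum_option setTI.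
    by congr (_ + _); apply: eq_bigr => u _; rewrite setTI.
  rewrite kD (_ : [set x | Z x <> None] = ~` (Z @^-1` [set None])) ?fmC//.
  by rewrite -h addrC addKr.
have := @gibbs R U (fun u => fm mu (Z @^-1` [set Some u])) a (fun _ => fm_ge0 _ _).
rewrite -kE /HE fmT entr1 subr0 sum_option/= setTI.
under [X in _ -> _ + X + _ <= _]eq_bigr do rewrite setTI.
have -> : fm mu (Z @^-1` [set None]) = 1 - k.
  by rewrite kD -fmC; [congr fm; apply/seteqP; split => x /=; [move=> ->|move/contrapT]|exact: (@mlab_pred _ _ _ Z (fun z => z <> None) mZ)].
by move=> h; lra.
Qed.

Lemma HE_option_le (mu : probability X R) (U : finType) (Z : X -> option U) (k : R) :
  mlab Z -> k = fm mu [set x | Z x <> None] ->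
  HE mu setT Z <= entr k + entr (1 - k) + k * ln (#|U|%:R).
Proof.
move=> mZ kD; have := @HE_option_gibbs mu U Z (fun=> 0) k mZ kD.
rewrite [X in _ + X <= _]big1 ?addr0; last by move=> u _; rewrite mulr0.
by under eq_bigr do rewrite expR0; rewrite sumr_const.
Qed.

(** Together with [HE_option_le] this is a Fano inequality: a label equal to [None] off a set of
    mass at most [k0] has entropy at most [e]. *)
Lemma entr2_small (N e : R) : 0 < e -> exists2 k0 : R, 0 < k0 &
  forall k, 0 <= k <= k0 -> entr k + entr (1 - k) + k * N <= e.
Proof.
move=> e0; pose f (k : R) : R := entr k + entr (1 - k) + k * N.
have cf : f @ (0 : R) --> f 0.
  apply: cvgD; last by apply: cvgM; [exact: cvg_id|exact: cvg_cst].
  apply: cvgD; first exact: entr_continuous.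
  apply: (@continuous_comp _ _ _ (fun k : R => 1 - k) entr); last exact: entr_continuous.
  by apply: cvgB; [exact: cvg_cst|exact: cvg_id].
have f0 : f 0 = 0 by rewrite /f subr0 entr0 entr1 mul0r !addr0.
move: cf; rewrite f0 => /cvgrPdist_lt/(_ _ e0); rewrite -nbhs_ballE => -[r /= r0 hr].
exists (r / 2); first by rewrite divr_gt0.
move=> k /andP[k0 kr]; have := hr k; rewrite /ball/= !sub0r !normrN ger0_norm// => h.
apply: (le_trans (ler_norm _)); apply: ltW; apply: h; lra.
Qed.

End SmallEntropy.

Section Mixtures.
Context {R : realType} {dd : measure_display} {X : measurableType dd}.
Implicit Types (mu : probability X R).

Lemma mix_prob n (lam : 'I_n -> R) (nu : 'I_n -> probability X R) :
  (forall i, 0 <= lam i) -> \sum_i lam i = 1 ->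
  exists mu, forall A, measurable A -> mu A = (\sum_(i < n) (lam i)%:E * nu i A)%E.
Proof.
move=> l0 l1.
pose m (k : nat) : {measure set X -> \bar R} :=
  if insub k is Some i then mscale (NngNum (l0 i)) (nu i) else mzero.
have mE A : msum m n A = (\sum_(i < n) (lam i)%:E * nu i A)%E.
  by rewrite /msum; apply: eq_bigr => i _; rewrite /m valK.
have m1 : msum m n setT = 1%E.
  rewrite mE; under eq_bigr do rewrite probability_setT mule1.
  by rewrite sumEFin l1.
by exists (to_prob m1) => A _; rewrite -mE.
Qed.

(** The identity is known on sets. After rounding [phi + M] down to multiples of [e / 2] both sides
    are finite sums over level sets. *)
Lemma Ex_mix mu n (lam : 'I_n -> R) (nu : 'I_n -> probability X R) phi :
  \sum_i lam i = 1 -> (forall i, 0 <= lam i) ->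
  (forall A, measurable A -> mu A = (\sum_(i < n) (lam i)%:E * nu i A)%E) ->
  bmeas phi -> Ex mu phi = \sum_i lam i * Ex (nu i) phi.
Proof.
move=> l1 l0 muE bphi.
have fmE' A : measurable A -> fm mu A = \sum_i lam i * fm (nu i) A.
  move=> mA; apply: EFin_inj; rewrite -fmE// muE// -sumEFin; apply: eq_bigr => i _.
  by rewrite EFinM -fmE.
have [mphi [M hM]] := bphi.
apply/eqP; rewrite -subr_eq0 -normr_le0; apply/ler_addgt0Pr => e e0; rewrite add0r.
have e2 : 0 < e / 2 by rewrite divr_gt0.
pose Y x := Num.truncn ((phi x + M) / (e / 2)).
pose h (k : nat) : R := k%:R * (e / 2) - M.
have pM x : 0 <= phi x + M by have := hM x; rewrite ler_norml => /andP[]; lra.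
have hY x : h (Y x) <= phi x <= h (Y x) + e / 2.
  have /andP[a1 a2] := truncn_itv (divr_ge0 (pM x) (ltW e2)).
  rewrite ler_pdivlMr// in a1; rewrite ltr_pdivrMr// -natr1 mulrDl mul1r in a2.
  by rewrite /h /Y; apply/andP; split; lra.
pose N := (Num.truncn ((M + M) / (e / 2))).+1.
have YN x : Y x \in iota 0 N.
  rewrite mem_iota/= add0n ltnS; apply: le_truncn.
  by rewrite ler_pM2r ?invr_gt0// lerD2r; have := hM x; rewrite ler_norml => /andP[].
have mY k : measurable (Y @^-1` [set k]).
  have mf : measurable_fun setT (fun x => (phi x + M) / (e / 2)).
    by apply: measurable_funM => //; apply: measurable_funD.
  rewrite (_ : _ @^-1` _ = (fun x => (phi x + M) / (e / 2)) @^-1` `[k%:R, k.+1%:R[%classic).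
    by rewrite -[X in measurable X]setTI; apply: mf => //; exact: measurable_itv.
  apply/seteqP; split => x /=; rewrite in_itv/=.
    by move=> <-; exact: (truncn_itv (divr_ge0 (pM x) (ltW e2))).
  by move=> hk; apply/eqP; rewrite truncn_eq// divr_ge0// ltW.
have ap nu' : `|Ex nu' phi - \sum_(k <- iota 0 N) h k * fm nu' (Y @^-1` [set k])| <= e / 2.
  have [b1 <-] := @Ex_label R _ X nu' _ (iota 0 N) Y h (iota_uniq _ _) YN mY.
  rewrite -ExB//; apply: Ex_abs_le; first exact: bmeasB.
  by move=> x /=; have := hY x => /andP[a1 a2]; rewrite ler_norml; apply/andP; split; lra.
have -> : Ex mu phi - \sum_i lam i * Ex (nu i) phi =
    (Ex mu phi - \sum_(k <- iota 0 N) h k * fm mu (Y @^-1` [set k])) -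
    \sum_i lam i * (Ex (nu i) phi - \sum_(k <- iota 0 N) h k * fm (nu i) (Y @^-1` [set k])).
  have -> : \sum_(k <- iota 0 N) h k * fm mu (Y @^-1` [set k]) =
      \sum_i lam i * \sum_(k <- iota 0 N) h k * fm (nu i) (Y @^-1` [set k]).
    under eq_bigr => k _ do rewrite fmE'// mulr_sumr.
    rewrite exchange_big/=; apply: eq_bigr => i _; rewrite mulr_sumr.
    by apply: eq_bigr => k _; rewrite mulrCA.
  under [X in _ = _ - X]eq_bigr do rewrite mulrBr.
  by rewrite sumrB; ring.
rewrite (le_trans (ler_normB _ _))// (splitr e) lerD//.
apply: (@le_trans _ _ (\sum_i lam i * (e / 2))); last by rewrite -mulr_suml l1 mul1r.
rewrite (le_trans (ler_norm_sum _ _ _))// ler_sum// => i _.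
by rewrite normrM (ger0_norm (l0 i)) ler_wpM2l.
Qed.

Lemma Ex_dirac (x : X) phi : bmeas phi -> Ex (\d_x : probability X R) phi = phi x.
Proof.
move=> bphi; apply: EFin_inj; rewrite -ExE// integral_dirac//.
  by rewrite diracT mul1e.
by apply/measurable_EFinP; case: bphi.
Qed.

Lemma atomic_prob (I : eqType) (s : seq I) (c : I -> R) (x : I -> X) :
  (forall i, 0 <= c i) -> \sum_(i <- s) c i = 1 ->
  exists mu, (forall A, measurable A -> fm mu A = \sum_(i <- s) c i * \1_A (x i)) /\
   forall phi, bmeas phi -> Ex mu phi = \sum_(i <- s) c i * phi (x i).
Proof.
move=> c0 c1; case: s c1 => [|i0 s0]; first by rewrite big_nil => /eqP; rewrite eq_sym oner_eq0.
set s := i0 :: s0 => c1.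
have key (f : I -> R) : \sum_(i <- s) f i = \sum_(j < size s) f (nth i0 s j).
  by rewrite (big_nth i0) big_mkord.
have [mu muE] := @mix_prob (size s) (fun j => c (nth i0 s j)) (fun j => (\d_(x (nth i0 s j)) : probability X R))
  (fun j => c0 _) (etrans (esym (key c)) c1).
have E2 phi : bmeas phi -> Ex mu phi = \sum_(i <- s) c i * phi (x i).
  move=> bphi; rewrite (Ex_mix (etrans (esym (key c)) c1) (fun j => c0 _) muE bphi).
  by rewrite key; apply: eq_bigr => j _; rewrite Ex_dirac.
exists mu; split => // A mA; rewrite -Ex_indic// E2//; exact: bmeas_indic.
Qed.

Lemma cond_prob mu A : measurable A -> 0 < fm mu A ->
  exists P : probability X R, forall B, measurable B -> fm P B = fm mu (B `&` A) / fm mu A.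
Proof.
move=> mA A0; have i0 : 0 <= (fm mu A)^-1 by rewrite invr_ge0 ltW.
pose m := mscale (NngNum i0) (mrestr mu mA).
have mE B : measurable B -> m B = (fm mu (B `&` A) / fm mu A)%:E.
  move=> mB; rewrite /m /mscale/= /mrestr fmE; last exact: measurableI.
  by rewrite -EFinM mulrC.
have m1 : m setT = 1%E by rewrite mE// setTI divff// gt_eqF.
by exists (to_prob m1) => B mB; apply: EFin_inj; rewrite -fmE// -mE.
Qed.

End Mixtures.

(** * Continuity sets of a measure *)

Section MetricAction.
Context {R : realType} {disp : measure_display} {X : measurableType disp}.
Variable d : X -> X -> R.
Hypothesis dm : is_metric d.
Hypothesis dc : dcompact d.
Hypothesis db : borel_for_d d.
Local Notation dcont := (dcontinuous_real d).
Local Notation wconv := (wconv d).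
Implicit Types (mu : probability X R) (A B : set X).

(* Functional form of [mu]-continuity sets (null boundary) *)
Definition cset mu A := measurable A /\ forall e : R, 0 < e -> exists l u : X -> R,
  [/\ dcont l, dcont u, (forall x, 0 <= l x <= \1_A x), (forall x, \1_A x <= u x <= 1) &
      Ex mu u - Ex mu l <= e].

Lemma cset_measurable mu A : cset mu A -> measurable A. Proof. by case. Qed.

Lemma csetT mu : cset mu setT.
Proof.
split=> // e e0; exists (fun=> 1), (fun=> 1); split; try exact: dcont_cst.
- by move=> x; rewrite indicT ler01 lexx.
- by move=> x; rewrite indicT lexx.
- by rewrite subrr ltW.
Qed.

Lemma csetC mu A : cset mu A -> cset mu (~` A).
Proof.
move=> [mA h]; split; first exact: measurableC.
move=> e /h[l [u [cl cu lA Au ul]]].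
have iC x : \1_(~` A) x = 1 - \1_A x :> R.
  by rewrite !indicE in_setC; case: (x \in A); rewrite ?subrr ?subr0.
exists (fun x => 1 - u x), (fun x => 1 - l x); split.
- by apply: dcontB => //; exact: dcont_cst.
- by apply: dcontB => //; exact: dcont_cst.
- by move=> x; rewrite iC; have := Au x; lra.
- by move=> x; rewrite iC; have := lA x; lra.
have bl := dcont_bmeas dm db dc cl; have bu := dcont_bmeas dm db dc cu.
by rewrite !ExB ?Ex_cst//; [lra|exact: bmeas_cst..].
Qed.

Lemma csetI mu A B : cset mu A -> cset mu B -> cset mu (A `&` B).
Proof.
move=> [mA hA] [mB hB]; split; first exact: measurableI.
move=> e e0; have e2 : 0 < e / 2 by rewrite divr_gt0.
have [l [u [cl cu lA Au ul]]] := hA _ e2; have [l' [u' [cl' cu' lB Bu ul']]] := hB _ e2.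
have iI x : \1_(A `&` B) x = \1_A x * \1_B x :> R.
  by rewrite !indicE in_setI; case: (x \in A); rewrite ?mul1r ?mul0r.
exists (fun x => l x * l' x), (fun x => u x * u' x); split; [exact: dcontM|exact: dcontM|..].
- move=> x; rewrite iI; have /andP[a1 a2] := lA x; have /andP[b1 b2] := lB x.
  by rewrite mulr_ge0// ler_pM.
- move=> x; rewrite iI; have /andP[a1 a2] := Au x; have /andP[b1 b2] := Bu x.
  rewrite ler_pM ?indicE//= mulr_ile1//; [exact: le_trans a1|exact: le_trans b1];
  by rewrite indicE.
have := dcont_bmeas dm db dc; move=> bm.
have bl := bm _ cl; have bu := bm _ cu; have bl' := bm _ cl'; have bu' := bm _ cu'.
have : Ex mu (fun x => u x * u' x - l x * l' x) <= Ex mu (fun x => (u x - l x) + (u' x - l' x)).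
  apply: Ex_le; first by apply: bmeasB; exact: bmeasM.
    by apply: bmeasD; exact: bmeasB.
  move=> x; have := lA x; have := Au x; have := lB x; have := Bu x.
  move=> /andP[b1 b2] /andP[b3 b4] /andP[a1 a2] /andP[a3 a4]; rewrite -subr_ge0.
  have -> : u x - l x + (u' x - l' x) - (u x * u' x - l x * l' x) =
    (u x - l x) * (1 - l' x) + (u' x - l' x) * (1 - u x) by ring.
  by rewrite addr_ge0// mulr_ge0//; lra.
rewrite (ExB mu (bmeasM bu bu') (bmeasM bl bl')) (ExD mu (bmeasB bu bl) (bmeasB bu' bl')).
by rewrite (ExB mu bu bl) (ExB mu bu' bl'); lra.
Qed.

Lemma cset_bigcap mu (I : eqType) (s : seq I) (A : I -> set X) : (forall i, cset mu (A i)) ->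
  cset mu [set x | forall i, i \in s -> A i x].
Proof.
move=> cA; elim: s => [|i s IH].
  by rewrite (_ : mkset _ = setT); [exact: csetT|apply/seteqP; split].
rewrite (_ : mkset _ = A i `&` [set x | forall i, i \in s -> A i x]); first exact: csetI.
apply/seteqP; split => x /=.
  by move=> h; split => [|j js]; apply: h; rewrite inE ?eqxx// js orbT.
by move=> [h1 h2] j; rewrite inE => /predU1P[->//|]; exact: h2.
Qed.

Lemma cset_fm_cvg mus mu A : wconv mus mu -> cset mu A ->
  fm (mus n) A @[n --> \oo] --> fm mu A.
Proof.
move=> w [mA h]; apply/cvgrPdist_lt => e e0; have e2 : 0 < e / 2 by rewrite divr_gt0.
have [l [u [cl cu lA Au ul]]] := h _ e2.
have bm := dcont_bmeas dm db dc; have bl := bm _ cl; have bu := bm _ cu.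
have bA := bmeas_indic (R := R) mA.
have lo nu : Ex nu l <= fm nu A by rewrite -Ex_indic//; apply: Ex_le => // x; have /andP[] := lA x.
have up nu : fm nu A <= Ex nu u by rewrite -Ex_indic//; apply: Ex_le => // x; have /andP[] := Au x.
have /cvgrPdist_lt/(_ _ e2)[N _ NP] := w _ cl.
have /cvgrPdist_lt/(_ _ e2)[M _ MP] := w _ cu.
exists (maxn N M) => // n /=; rewrite geq_max => /andP[/NP a1 /MP a2].
move: a1 a2; rewrite !ltr_norml => /andP[a1 a2] /andP[a3 a4].
have := lo mu; have := lo (mus n); have := up mu; have := up (mus n).
by move=> b1 b2 b3 b4; apply/andP; split; lra.
Qed.

(** At most countably many levels are charged; a null one is found in the intersection of nested
    intervals whose preimages lose half their mass at each step. *)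
Lemma null_level mu phi (a b : R) : dcont phi -> a < b ->
  exists r, a < r < b /\ fm mu [set x | phi x = r] = 0.
Proof.
move=> cphi ab.
have mphi := dcont_measurable db cphi.
pose S (I : R * R) := [set x | I.1 <= phi x <= I.2].
have mS I : measurable (S I).
  rewrite (_ : S I = phi @^-1` `[I.1, I.2]%classic).
    by rewrite -[X in measurable X]setTI; apply: mphi => //; exact: measurable_itv.
  by apply/seteqP; split => x /=; rewrite in_itv.
have step (I : R * R) : exists J : R * R, I.1 < I.2 ->
    [/\ I.1 < J.1, J.1 < J.2, J.2 < I.2 & fm mu (S J) <= fm mu (S I) / 2].
  case: (ltP I.1 I.2) => II; last by exists I.
  pose t := (I.2 - I.1) / 6; have t0 : 0 < t by rewrite divr_gt0// subr_gt0.
  (* Two disjoint closed intervals strictly inside [I]; the one whose preimage has the smaller mass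
     is kept. *)
  pose J1 := (I.1 + t, I.1 + 2 * t); pose J2 := (I.1 + 4 * t, I.1 + 5 * t).
  have I2 : I.2 = I.1 + 6 * t by rewrite /t; field.
  have : fm mu (S J1) + fm mu (S J2) <= fm mu (S I).
    rewrite -fmU//; last first.
      by apply/seteqP; split => x //=; rewrite /S /J1 /J2 /= => -[/andP[h1 h2] /andP[h3 h4]]; lra.
    apply: fm_le => //; first exact: measurableU.
    by move=> x [] /=; rewrite /S /J1 /J2 /= => /andP[h1 h2]; apply/andP; split; lra.
  move=> h; have [h1|h1] := leP (fm mu (S J1)) (fm mu (S J2)).
    by exists J1 => _; split; rewrite /J1/=; lra.
  by exists J2 => _; split; rewrite /J2/=; lra.
pose nx I := sval (cid (step I)).
have nxP I : I.1 < I.2 -> [/\ I.1 < (nx I).1, (nx I).1 < (nx I).2, (nx I).2 < I.2 & fm mu (S (nx I)) <= fm mu (S I) / 2].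
  by rewrite /nx; case: cid.
pose J n := iter n nx (a, b).
have J12 n : (J n).1 < (J n).2 by elim: n => // n IH /=; have [] := nxP _ IH.
have Jl n m : (n <= m)%N -> (J n).1 <= (J m).1 /\ (J m).2 <= (J n).2.
  elim: m => [|m IH]; first by rewrite leqn0 => /eqP ->.
  rewrite leq_eqVlt => /predU1P[->//|]; rewrite ltnS => /IH[h1 h2].
  by have [h3 _ h4 _] := nxP _ (J12 m); split; [exact: le_trans (ltW h3)|exact: le_trans (ltW h4) _].
have Jm n : fm mu (S (J n)) <= 2^-1 ^+ n.
  elim: n => [|n IH]; first by rewrite expr0 fm_le1.
  have [_ _ _ h] := nxP _ (J12 n); apply: (le_trans h).
  by rewrite exprS mulrC ler_wpM2l ?invr_ge0.
pose E := [set (J n).1 | n in [set: nat]].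
have ubE n : ubound E (J n).2.
  move=> _ [m _ <-]; case: (leqP n m) => [/Jl[_ h]|/ltnW/Jl[h _]].
    exact: le_trans (ltW (J12 m)) h.
  exact: le_trans h (ltW (J12 n)).
have hE : has_sup E by split; [exists (J 0%N).1; exists 0%N|exists (J 0%N).2].
pose r := sup E.
have rJ n : (J n).1 <= r <= (J n).2.
  apply/andP; split; first by apply: ub_le_sup; [exact: hE.2|exists n].
  by apply: ge_sup; [exact: hE.1|exact: ubE].
exists r; split.
  have /andP[h1 h2] := rJ 1%N; have [h3 _ h4 _] := nxP _ (J12 0%N).
  by apply/andP; split; [exact: lt_le_trans h1|exact: le_lt_trans h4].
have mr : measurable [set x | phi x = r].
  rewrite (_ : mkset _ = S (r, r)) //; apply/seteqP; split => x /=; rewrite /S /=.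
    by move=> ->; rewrite lexx.
  by move=> h; apply/eqP; rewrite eq_le andbC.
apply/eqP; rewrite eq_le fm_ge0 andbT; apply/ler_addgt0Pr => e e0; rewrite add0r.
have h2 : `|2^-1 : R| < 1 by rewrite ger0_norm ?invr_ge0// invf_lt1 ?ltr1n.
have /cvgrPdist_lt/(_ _ e0)[n _ /(_ n (leqnn n))] := cvg_expr h2.
rewrite sub0r normrN ger0_norm ?exprn_ge0 ?invr_ge0// => /ltW; apply: le_trans.
apply: le_trans (Jm n); apply: fm_le => // x /= xr.
by rewrite /S/= xr; exact: rJ.
Qed.

(** Steep ramps on the two sides of the level [r] squeeze the indicator; their difference tends to
    the indicator of the level set, which is null. *)
Lemma cset_lt mu phi (r : R) : dcont phi -> fm mu [set x | phi x = r] = 0 ->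
  cset mu [set x | phi x < r].
Proof.
move=> cphi h0; set A := [set x | phi x < r].
have mA : measurable A by apply: (dopen_measurable db); exact: dcont_open_lt.
split => // e e0.
pose l n x := Num.max 0 (Num.min 1 (n%:R * (r - phi x))).
pose u n x := 1 - Num.max 0 (Num.min 1 (n%:R * (phi x - r))).
have cl n : dcont (l n).
  by apply: dcont_max; apply: dcont_min; apply: dcontZ; apply: dcontB => //; exact: dcont_cst.
have cu n : dcont (u n).
  apply: dcontB; first exact: dcont_cst.
  by apply: dcont_max; apply: dcont_min; apply: dcontZ; apply: dcontB => //; exact: dcont_cst.
have bm := dcont_bmeas dm db dc.
have mr : measurable [set x | phi x = r].
  rewrite (_ : mkset _ = phi @^-1` [set r])// -[X in measurable X]setTI.
  by apply: (dcont_measurable db cphi) => //; exact: measurable_set1.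
have c01 (t : R) : 0 <= Num.max 0 (Num.min 1 t) <= 1.
  by rewrite le_max lexx ge_max ler01 ge_min lexx.
have lim n : Num.max 0 (Num.min 1 (n%:R * 0)) = 0 :> R by rewrite mulr0 (min_r ler01) maxxx.
have neg n (t : R) : t <= 0 -> Num.max 0 (Num.min 1 (n%:R * t)) = 0.
  move=> t0; apply: max_l; rewrite ge_min; apply/orP; right.
  by rewrite mulr_ge0_le0.
have pos (t : R) : 0 < t -> exists N, forall n, (N <= n)%N -> Num.max 0 (Num.min 1 (n%:R * t)) = 1.
  move=> t0; exists (Num.bound t^-1) => n Nn; rewrite min_l ?(max_r ler01)//.
  rewrite -ler_pdivrMr// mul1r; apply: ltW; apply: lt_le_trans (_ : (Num.bound t^-1)%:R <= _).
    by rewrite archi_boundP// invr_ge0 ltW.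
  by rewrite ler_nat.
have cv x : u n x - l n x @[n --> \oo] --> (\1_[set x | phi x = r] x : R).
  apply: cvg_near_cst; rewrite indicE; have [h|h|h] := ltgtP (phi x) r.
  - have [|N NP] := pos (r - phi x); first by rewrite subr_gt0.
    exists N => // n /= /NP e1; rewrite /u /l e1 neg ?subr_le0 ?(ltW h)// subr0 subrr.
    by rewrite memNset//= => e2; rewrite e2 ltxx in h.
  - have [|N NP] := pos (phi x - r); first by rewrite subr_gt0.
    exists N => // n /= /NP e1; rewrite /u /l e1 neg ?subr_le0 ?(ltW h)// subr0 subrr.
    by rewrite memNset//= => e2; rewrite e2 ltxx in h.
  - apply: nearW => n; rewrite /u /l h subrr lim !subr0 mem_set//.
have b1 n : bmeas (fun x => u n x - l n x) by apply: bmeasB; exact: bm.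
have b3 n x : `|u n x - l n x| <= 2.
  have := c01 (n%:R * (r - phi x)); have := c01 (n%:R * (phi x - r)).
  by rewrite /u /l ler_norml => /andP[? ?] /andP[? ?]; apply/andP; split; lra.
have := @Ex_dominated _ _ _ mu _ _ _ b1 (bmeas_indic mr) b3 cv.
rewrite Ex_indic// h0 => /cvgrPdist_lt/(_ _ e0)[n _ /(_ n (leqnn n)) hn].
exists (l n), (u n); split => //.
- move=> x; have /andP[h1 h2] := c01 (n%:R * (r - phi x)); rewrite h1/= /l indicE.
  case: (boolP (x \in A)) => // xA; rewrite neg// subr_le0 leNgt.
  by apply/negP => hx; move/negP: xA; apply; rewrite inE.
- move=> x; have /andP[h1 h2] := c01 (n%:R * (phi x - r)); rewrite /u lerBlDr lerDl h1 andbT indicE.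
  case: (boolP (x \in A)) => [|_]; last by rewrite subr_ge0.
  by rewrite inE => /= hx; rewrite neg ?subr0// subr_le0 ltW.
move: hn; rewrite ExB; [|exact: bm..]; rewrite sub0r normrN => /ltW; apply: le_trans.
exact: ler_norm.
Qed.

(** The sets approximable in this way form a sigma-algebra. An open set is approximated by the
    points at distance more than some small null level from its complement. *)
Lemma cset_approx mu A : measurable A -> forall e : R, 0 < e ->
  exists N, cset mu N /\ fm mu ((A `\` N) `|` (N `\` A)) <= e.
Proof.
move=> mA; have := mA; rewrite db => h.
pose C A := measurable A /\ forall e : R, 0 < e ->
  exists N, cset mu N /\ fm mu ((A `\` N) `|` (N `\` A)) <= e.
suff : C A by case.
apply: h; split; last first.
  move=> U oU; split; first exact: (dopen_measurable db).
  move=> e e0; pose V n := [set x | dist1 d (~` U) x > n.+1%:R^-1].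
  have mV n : measurable (V n).
    by apply: (dopen_measurable db); apply: dcont_open_gt; exact: dcont_dist1.
  have ndV : nondecreasing_seq V.
    move=> n m nm; apply/subsetPset => x; apply: le_lt_trans.
    by rewrite lef_pV2 ?posrE// ler_nat.
  have UV : \bigcup_n V n = U.
    apply/seteqP; split => [x [n _] h1|x Ux].
      apply: contrapT => nU; move: h1; rewrite /V/= dist1_in// => h1.
      by have := invr_ge0 (n.+1%:R : R); rewrite ler0n leNgt h1.
    have dx := dist1_gt0 oU Ux; set r := dist1 _ _ _ in dx.
    exists (Num.bound r^-1) => //=; rewrite /V/= -/r invf_plt ?posrE//.
    by rewrite (@lt_trans _ _ (Num.bound r^-1)%:R) ?ltr_nat// archi_boundP// invr_ge0 ltW.
  have := @fm_cvg_up _ _ _ mu _ mV ndV; rewrite UV => /cvgrPdist_lt/(_ _ e0)[n _ /(_ n (leqnn n)) hn].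
  have nV0 : - (n.+1%:R)^-1 < 0 :> R by rewrite oppr_lt0 invr_gt0.
  have [r [/andP[r1 r2] hr]] := @null_level mu (fun x => - dist1 d (~` U) x) (- (n.+1%:R)^-1) 0
     (dcontN (dcont_dist1 dm (~` U))) nV0.
  pose W := [set x | - dist1 d (~` U) x < r].
  have cW : cset mu W by apply: cset_lt => //; apply: dcontN; exact: dcont_dist1.
  exists W; split => //.
  have WU : W `<=` U.
    move=> x; apply: contraPP => nU; rewrite /W/= dist1_in// oppr0.
    by apply/negP; rewrite -leNgt ltW.
  rewrite (_ : W `\` U = set0) ?setU0; last by apply/seteqP; split => x //= [/WU].
  have mU := dopen_measurable db oU.
  have := fmID mu mU (mV n); have -> : U `&` V n = V n.
    by apply/seteqP; split => x //=; [case|move=> Vx; split => //; rewrite -UV; exists n].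
  move=> h1; rewrite (@le_trans _ _ (fm mu (U `\` V n)))//; last first.
    by move: hn; rewrite ltr_norml h1 => /andP[]; lra.
  apply: fm_le; [by apply: measurableD => //; exact: cset_measurable cW|exact: measurableD|].
  move=> x /= [Ux nW]; split => // Vx; apply: nW; rewrite /W/=.
  by rewrite (le_lt_trans _ r1)// lerN2 ltW.
split.
- split => // e e0; exists set0; split; first by rewrite -setCT; apply: csetC; exact: csetT.
  by rewrite setD0 setUid fm0 ltW.
- move=> B [mB hB]; rewrite setTD; split; first exact: measurableC.
  move=> e /hB[N [cN h1]]; exists (~` N); split; first exact: csetC.
  rewrite (_ : _ `|` _ = (B `\` N) `|` (N `\` B))//.
  apply/seteqP; split => x /= [[h2 h3]|[h2 h3]]; [right|left|right|left]; split => //;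
    try exact: contrapT; by move=> k; exact: h3.
move=> B CB; split; first by apply: bigcup_measurable => n _; case: (CB n).
move=> e e0; have e2 : 0 < e / 2 by rewrite divr_gt0.
have mB n : measurable (B n) by case: (CB n).
pose U n := \big[setU/set0]_(i < n) B i.
have mU n : measurable (U n) by exact: bigsetU_measurable.
have UE n x : U n x <-> exists2 i, (i < n)%N & B i x.
  rewrite /U -bigcup_mkord; split => [[i /= ni Bx]|[i ni Bx]]; by exists i.
have ndU : nondecreasing_seq U.
  move=> n m nm; apply/subsetPset => x /UE[i ni Bx]; apply/UE; exists i => //.
  exact: leq_trans nm.
have UB : \bigcup_n U n = \bigcup_n B n.
  apply/seteqP; split => [x [n _ /UE[i _ Bx]]|x [n _ Bx]]; first by exists i.
  by exists n.+1 => //; apply/UE; exists n.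
have := @fm_cvg_up _ _ _ mu _ mU ndU; rewrite UB => /cvgrPdist_lt/(_ _ e2)[n _ /(_ n (leqnn n)) hn].
have e2n : 0 < e / 2 / n.+1%:R by rewrite divr_gt0.
have apB i : exists N, cset mu N /\
    fm mu ((B i `\` N) `|` (N `\` B i)) <= e / 2 / n.+1%:R by have [_] := CB i; apply.
pose N i := sval (cid (apB i)).
have NP i : cset mu (N i) /\ fm mu ((B i `\` N i) `|` (N i `\` B i)) <= e / 2 / n.+1%:R.
  by rewrite /N; case: cid.
pose W := ~` [set x | forall i, i \in iota 0 n -> (~` N i) x].
have cW : cset mu W.
  by apply: csetC; apply: (@cset_bigcap _ _ _ (fun i => ~` N i)) => i; apply: csetC; exact: (NP i).1.
exists W; split => //.
have mD i : measurable ((B i `\` N i) `|` (N i `\` B i)).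
  have mN := cset_measurable (NP i).1.
  by apply: measurableU; exact: measurableD.
have mbB : measurable (\bigcup_n B n) by exact: bigcup_measurable.
have mW := cset_measurable cW.
apply: (@le_trans _ _ (fm mu ((\bigcup_n B n `\` U n) `|`
    \big[setU/set0]_(i <- iota 0 n) ((B i `\` N i) `|` (N i `\` B i))))).
  apply: fm_le.
  - by apply: measurableU; exact: measurableD.
  - by apply: measurableU; [exact: measurableD|exact: bigsetU_measurable].
  move=> x [[[i _ Bx] nW]|[Wx nB]].
    case: (pselect (U n x)) => [/UE[j jn Bj]|nU]; last by left; split => //; exists i.
    right; rewrite -bigcup_seq; exists j; first by rewrite /= mem_iota.
    left; split => // Nj; apply: nW => /(_ j); rewrite mem_iota/= add0n => /(_ jn); exact.
  right; rewrite -bigcup_seq; have [i /not_implyP[ii Ni]] := (existsNP _).2 Wx.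
  exists i => //; right; split; first exact: contrapT.
  by move=> Bi; apply: nB; exists i.
apply: (le_trans (fmU_le _ _ _)); [exact: measurableD|exact: bigsetU_measurable|].
rewrite (splitr e) lerD//.
  have := fmID mu mbB (mU n); have -> : (\bigcup_n B n) `&` U n = U n.
    by apply/seteqP; split => x //=; [case|move=> h1; split => //; rewrite -UB; exists n].
  by move=> h1; move: hn; rewrite ltr_norml h1 => /andP[]; lra.
apply: (le_trans (fm_bigU_le _ _ _)) => //.
apply: (@le_trans _ _ (\sum_(i <- iota 0 n) e / 2 / n.+1%:R)).
  by apply: ler_sum => i _; exact: (NP i).2.
rewrite big_const_seq count_predT size_iota iter_addr_0 -[_ *+ n]mulr_natr -[leRHS]mulr1 -mulrA.
rewrite ler_wpM2l ?(ltW e2)// mulrC ler_pdivrMr// mul1r ler_nat//.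
Qed.

End MetricAction.

Section GAction.
Context {R : realType} {G : groupType} {disp : measure_display} {X : measurableType disp}.
Variable d : X -> X -> R.
Variable act : G -> X -> X.
Hypothesis dm : is_metric d.
Hypothesis dc : dcompact d.
Hypothesis db : borel_for_d d.
Hypothesis ga : G_action d act.
Local Notation dcont := (dcontinuous_real d).
Local Notation wconv := (wconv d).
Local Notation cset := (cset d).
Local Notation name := (name act).
Implicit Types (mu : probability X R) (A B : set X) (T : finType) (K : {fset G}) (phi psi : X -> R).

Lemma act1 x : act 1%g x = x. Proof. by case: ga. Qed.
Lemma actM g h x : act (g * h)%g x = act g (act h x). Proof. by case: ga => _ []. Qed.
Lemma actK g x : act g^-1%g (act g x) = x. Proof. by rewrite -actM mulVg act1. Qed.
Lemma actKV g x : act g (act g^-1%g x) = x. Proof. by rewrite -actM mulgV act1. Qed.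

Lemma dcont_act phi g : dcont phi -> dcont (fun x => phi (act g x)).
Proof.
move=> cphi x e e0; have [r r0 hr] := cphi (act g x) e e0.
case: ga => _ [_ /(_ g x r r0)[s s0 hs]]; exists s => // y /hs; exact: hr.
Qed.

Lemma measurable_act g A : measurable A -> measurable (act g @^-1` A).
Proof.
move=> mA; have := mA; rewrite db => /(_ [set A | measurable (act g @^-1` A)]); apply.
split; last first.
  move=> U oU /=; apply: (dopen_measurable db) => x Ux.
  have [r r0 hr] := oU _ Ux; case: ga => _ [_ /(_ g x r r0)[s s0 hs]].
  by exists s => // y /hs; exact: hr.
split => /=; first by rewrite preimage_set0.
  by move=> B mB; rewrite setTD preimage_setC; exact: measurableC.
by move=> B mB; rewrite preimage_bigcup; exact: bigcup_measurable.
Qed.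

Lemma measurable_fun_act g : measurable_fun setT (act g).
Proof. by move=> _ A mA; rewrite setTI; exact: measurable_act. Qed.

Lemma Ex_ext mu mu' phi : (forall A, measurable A -> mu A = mu' A) -> bmeas phi ->
  Ex mu phi = Ex mu' phi.
Proof.
move=> h bphi; have l1 : \sum_(i < 1) (1 : R) = 1 by rewrite big_ord1.
rewrite (@Ex_mix _ _ _ mu 1 (fun=> 1) (fun=> mu') phi l1 (fun=> ler01))//.
  by rewrite big_ord1 mul1r.
by move=> A mA; rewrite big_ord1 mul1e h.
Qed.

Lemma bmeas_act phi g : bmeas phi -> bmeas (fun x => phi (act g x)).
Proof.
move=> [m [M h]]; split; first exact: (measurableT_comp m (measurable_fun_act g)).
by exists M => x.
Qed.

Lemma Ex_act mu phi g : G_invariant act mu -> bmeas phi -> Ex mu (fun x => phi (act g x)) = Ex mu phi.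
Proof.
move=> mi bphi; rewrite -[LHS](Ex_law mu (measurable_fun_act g) bphi).
by apply: Ex_ext => // A mA; exact: mi.
Qed.

Lemma invariant_Ex mu : (forall g psi, dcont psi -> Ex mu (fun x => psi (act g x)) = Ex mu psi) ->
  G_invariant act mu.
Proof.
move=> h g A mA.
apply: (@measure_eq_open _ _ _ d dm db (prob_law mu (measurable_fun_act g)) mu [set U | dopen d U]) => //.
- by move=> U V; exact: dopenI.
- exact: dopenT.
- by move=> V oV; exact: sub_gen_smallest.
- move=> U n _; rewrite Ex_law; last exact/dcont_bmeas/dcont_open_bump.
  by apply: h; exact: dcont_open_bump.
Qed.

Lemma wconv_invariant mus mu : (forall n, G_invariant act (mus n)) -> wconv mus mu ->
  G_invariant act mu.
Proof.
move=> mi w; apply: invariant_Ex => g psi cpsi.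
have h1 := w _ (@dcont_act psi g cpsi); have h2 := w _ cpsi.
rewrite -(cvg_lim _ h1)//; apply: cvg_lim => //.
rewrite (_ : (fun n => _) = fun n => Ex (mus n) psi)//; apply/funext => n.
by apply: (Ex_act _ (mi n)); exact: (dcont_bmeas dm db dc cpsi).
Qed.

Definition clab mu T (Y : X -> T) := forall t, cset mu (Y @^-1` [set t]).

Lemma clab_mlab mu T (Y : X -> T) : clab mu Y -> mlab Y.
Proof. by move=> h t; have [] := h t. Qed.

Lemma clab_pred mu T (Y : X -> T) (P : T -> Prop) : clab mu Y -> cset mu [set x | P (Y x)].
Proof.
move=> cY; rewrite (_ : mkset _ = [set x | forall t, t \in enum T ->
    (if `[< P t >] then setT else ~` (Y @^-1` [set t])) x]).
  apply: (@cset_bigcap _ _ _ _ dm dc db mu _ (enum T)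
   (fun t => if `[< P t >] then setT else ~` (Y @^-1` [set t]))) => t.
  by case: asboolP => _; [exact: csetT|apply: csetC].
apply/seteqP; split => x /=.
  by move=> Px t _; case: asboolP => //= nP yt; apply: nP; rewrite -yt.
by move=> /(_ (Y x)); rewrite mem_enum => /(_ isT); case: asboolP => //= _; exact.
Qed.

Lemma clab_comp mu T T' (h : T -> T') (Y : X -> T) : clab mu Y -> clab mu (fun x => h (Y x)).
Proof. by move=> cY t; exact: (@clab_pred mu T Y (fun s => h s = t)). Qed.

Lemma clab_ffun mu (I : finType) T (Y : I -> X -> T) : (forall i, clab mu (Y i)) ->
  clab mu (fun x => [ffun i => Y i x]).
Proof.
move=> cY c; rewrite (_ : _ @^-1` _ = [set x | forall i, i \in enum I -> (Y i @^-1` [set c i]) x]).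
  by apply: (@cset_bigcap _ _ _ _ dm dc db mu _ (enum I) (fun i => Y i @^-1` [set c i])) => i; exact: cY.
apply/seteqP; split => x /=; first by move=> <- i _; rewrite ffunE.
by move=> h; apply/ffunP => i; rewrite ffunE; apply: h; rewrite mem_enum.
Qed.

Lemma clab_pair mu T T' (Y : X -> T) (Z : X -> T') : clab mu Y -> clab mu Z ->
  clab mu (fun x => (Y x, Z x)).
Proof.
move=> cY cZ [t u]; rewrite (_ : _ @^-1` _ = Y @^-1` [set t] `&` Z @^-1` [set u]).
  exact: csetI.
by apply/seteqP; split => x /= [-> ->].
Qed.

Lemma clab_asbool mu A : cset mu A -> clab mu (fun x => `[< A x >]).
Proof.
move=> cA [].
  by rewrite (_ : _ @^-1` _ = A)//; apply/seteqP; split => x /= /asboolP.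
rewrite (_ : _ @^-1` _ = ~` A); first exact: csetC.
by apply/seteqP; split => x /=; [move/asboolPn|move=> ?; apply/asboolPn].
Qed.

Lemma cset_act mu A g : G_invariant act mu -> cset mu A -> cset mu (act g @^-1` A).
Proof.
move=> mi [mA h]; split; first exact: measurable_act.
move=> e /h[l [u [cl cu lA Au ul]]].
exists (fun x => l (act g x)), (fun x => u (act g x)); split.
- exact: dcont_act.
- exact: dcont_act.
- by move=> x; have := lA (act g x); rewrite !indicE.
- by move=> x; have := Au (act g x); rewrite !indicE.
rewrite (Ex_act g mi (dcont_bmeas dm db dc cl)).
by rewrite (Ex_act g mi (dcont_bmeas dm db dc cu)).
Qed.

Lemma clab_name mu T (Y : X -> T) K : G_invariant act mu -> clab mu Y -> clab mu (name Y K).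
Proof.
move=> mi cY; apply: (@clab_ffun mu K T (fun g x => Y (act (fsval g) x))) => g t.
exact: (cset_act (fsval g) mi (cY t)).
Qed.

(** Entropy is a continuous function of finitely many masses, and masses of continuity sets
    converge. For arbitrary measurable cells this fails, whence [approx_label]. *)
Lemma clab_HE_cvg mus mu T (Y : X -> T) : wconv mus mu -> clab mu Y ->
  HE (mus n) setT Y @[n --> \oo] --> HE mu setT Y.
Proof.
move=> w cY; rewrite /HE; apply: cvgB; last first.
  by rewrite fmT; apply: cvg_near_cst; apply: nearW => n; rewrite fmT.
apply: cvg_sum_seq => t.
apply: continuous_cvg; [exact: entr_continuous|].
by rewrite setTI; apply: (cset_fm_cvg dm dc db w (cY t)).
Qed.

End GAction.

Section LowerBound.
Context {R : realType} {G : groupType} {disp : measure_display} {X : measurableType disp}.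
Variable d : X -> X -> R.
Variable act : G -> X -> X.
Hypothesis dm : is_metric d.
Hypothesis dc : dcompact d.
Hypothesis db : borel_for_d d.
Hypothesis ga : G_action d act.
Local Notation dcont := (dcontinuous_real d).
Local Notation wconv := (wconv d).
Local Notation cset := (cset d).
Local Notation clab := (clab d).
Local Notation name := (name act).
Local Notation mact := (measurable_act db ga).
Local Notation entr := (@entr_fun R).
Implicit Types (mu : probability X R) (A B : set X) (T : finType) (K : {fset G}) (phi psi : X -> R).

(** The strict inequality leaves room to thicken the cells a little, which [approx_label] does. *)
Definition fine_label (eps : R) T (Y : X -> T) :=
  exists2 e : R, e < eps & forall x y, Y x = Y y -> d x y <= e.

(** Each cell is replaced by a continuity set [N t] close to it in measure, cut down to a thin
    neighbourhood [W t] of the cell so that diameters grow by at most [2 * del]; what is left over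
    is cut by small balls [V j]. The new label disagrees with the old one on a set of small mass, so
    a Fano bound charges at most [eta] per element of the window. *)
Lemma approx_label mu T (Y : X -> T) (eps eta : R) : G_invariant act mu -> mlab Y ->
  fine_label eps Y -> 0 < eta ->
  exists (T' : finType) (Y' : X -> T'), [/\ clab mu Y', fine_label eps Y' &
    forall K, HE mu setT (name Y' K) <= HE mu setT (name Y K) + #|` K|%:R * eta].
Proof.
move=> mi mY [e eeps eY] eta0.
have e0 : 0 <= e by rewrite -(dxx dm (point : X)); exact: eY.
pose del := Num.min 1 ((eps - e) / 4).
have del0 : 0 < del by rewrite lt_min ltr01 divr_gt0// subr_gt0.
have del1 : del <= 1 by rewrite ge_min lexx.
have del4 : e + 2 * del < eps.
  have : del <= (eps - e) / 4 by rewrite ge_min lexx orbT.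
  by lra.
pose cl t := Y @^-1` [set t].
pose rho t := sval (cid (null_level db mu (dcont_dist1 dm (cl t)) del0)).
have rhoP t : 0 < rho t < del /\ fm mu [set x | dist1 d (cl t) x = rho t] = 0.
  by rewrite /rho; case: cid.
pose W t := [set x | dist1 d (cl t) x < rho t].
have cW t : cset mu (W t) by apply: (cset_lt dm dc db); [exact: dcont_dist1|exact: (rhoP t).2].
pose rad c := sval (cid (null_level db mu (dcont_d dm c) del0)).
have radP c : 0 < rad c < del /\ fm mu [set x | d c x = rad c] = 0.
  by rewrite /rad; case: cid.
have rad0 c : 0 < rad c by have [/andP[]] := radP c.
have [s sP] := dcompact_ball dm dc rad0.
pose V (j : 'I_(size s)) := [set x | d (nth point s j) x < rad (nth point s j)].
have cV j : cset mu (V j) by apply: (cset_lt dm dc db); [exact: dcont_d|exact: (radP _).2].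
pose T' : finType := (T + 'I_(size s))%type.
have [k0 k00 k0P] := @entr2_small R (ln (#|T'|%:R)) eta eta0.
(* There are [#|T|] cells, so the approximation errors together stay below [k0]. *)
pose kap := k0 / #|T|.+1%:R; have kap0 : 0 < kap by rewrite divr_gt0.
pose N t := sval (cid (cset_approx dm dc db mu (mY t) kap0)).
have NP t : cset mu (N t) /\ fm mu ((cl t `\` N t) `|` (N t `\` cl t)) <= kap.
  by rewrite /N; case: cid.
pose b1 x := [ffun t => `[< (N t `&` W t) x >]].
pose b2 x := [ffun j => `[< V j x >]].
pose hh (p : {ffun T -> bool} * {ffun 'I_(size s) -> bool}) : T' :=
  if [pick t | p.1 t] is Some t then inl t else
  if [pick j | p.2 j] is Some j then inr j else inl (Y point).
pose Y' x := hh (b1 x, b2 x).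
have Y'P x : (exists2 t, Y' x = inl t & (N t `&` W t) x) \/ (exists2 j, Y' x = inr j & V j x).
  rewrite /Y' /hh /=; case: pickP => [t|_]; first by rewrite ffunE => /asboolP h; left; exists t.
  case: pickP => [j|h]; first by rewrite ffunE => /asboolP h; right; exists j.
  have [c cs cx] := sP x; have jl : (index c s < size s)%N by rewrite index_mem.
  by have := h (Ordinal jl); rewrite ffunE /V => /asboolP; case; rewrite /= nth_index.
have cY' : clab mu Y'.
  apply: (clab_comp dm dc db); apply: (clab_pair dm dc db).
    apply: (@clab_ffun _ _ _ _ dm dc db mu T _ (fun t x => `[< (N t `&` W t) x >])) => t.
    apply: (clab_asbool dm dc db); apply: (csetI dm dc db) => //; exact: (NP t).1.
  apply: (@clab_ffun _ _ _ _ dm dc db mu _ _ (fun j x => `[< V j x >])) => j.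
  exact: (clab_asbool dm dc db).
exists T', Y'; split => //.
  exists (e + 2 * del) => // x y xy.
  have [[t tx [_ Wx]]|[j jx Vx]] := Y'P x; have [[t' ty [_ Wy]]|[j' jy Vy]] := Y'P y.
  - move: Wy; move: tx ty; rewrite xy => -> [<-] Wy.
    have [/andP[_ rd] _] := rhoP t.
    have [a ca xa] := dist1_lt (le_trans (ltW rd) del1) Wx.
    have [b cb yb] := dist1_lt (le_trans (ltW rd) del1) Wy.
    have h1 : d a b <= e by apply: eY; rewrite ca cb.
    have h2 := dtri dm x a y; have h3 := dtri dm a b y; rewrite (dsym dm y b) in yb.
    by lra.
  - by move: tx jy; rewrite xy => ->.
  - by move: jx ty; rewrite xy => ->.
  - move: Vy; move: jx jy; rewrite xy => -> [<-] Vy; have [/andP[_ rd] _] := radP (nth point s j).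
    have := dtri dm x (nth point s j) y; rewrite (dsym dm x (nth point s j)); move: Vx Vy; rewrite /V/=.
    by lra.
(* [Z] records the new letter only where it disagrees with the old one; the old letter and [Z]
   together determine the new letter. *)
pose Z x : option T' := if Y' x == inl (Y x) then None else Some (Y' x).
have mY' := clab_mlab cY'.
have mZ : mlab Z.
  exact: (@mlab_comp _ _ _ _ (fun p : T' * T => if p.1 == inl p.2 then None else Some p.1) _ (mlab_pair mY' mY)).
have HZ : HE mu setT Z <= eta.
  apply: (le_trans (@HE_option_le _ _ _ mu T' Z _ mZ erefl)); apply: k0P; rewrite fm_ge0/=.
  have mD t : measurable ((cl t `\` N t) `|` (N t `\` cl t)).
    have mN := cset_measurable (NP t).1; have mc : measurable (cl t) by exact: mY.
    by apply: measurableU; exact: measurableD.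
  apply: (@le_trans _ _ (fm mu (\big[setU/set0]_(t <- enum T) ((cl t `\` N t) `|` (N t `\` cl t))))).
    apply: fm_le; [exact: (@mlab_pred _ _ _ Z (fun z => z <> None))|exact: bigsetU_measurable|].
    move=> x /=; rewrite /Z; case: eqP => // ne _; rewrite -bigcup_seq; apply: contrapT => nb.
    have good t : cl t x <-> N t x.
      split => h; apply: contrapT => h2; apply: nb; exists t; rewrite /= ?mem_enum//.
        by left.
      by right.
    apply: ne; have nx : N (Y x) x by apply/good.
    have wx : W (Y x) x.
      by rewrite /W/= (dist1_in dm) //; have [/andP[]] := rhoP (Y x).
    rewrite /Y' /hh; case: pickP => [t|] /=.
      by rewrite ffunE => /asboolP[/good /= -> _].
    by move=> /(_ (Y x)); rewrite ffunE => /asboolP; case.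
  apply: (le_trans (fm_bigU_le _ _ _)) => //.
  apply: (@le_trans _ _ (\sum_(t <- enum T) kap)).
    by apply: ler_sum => t _; exact: (NP t).2.
  rewrite big_const_seq count_predT iter_addr_0 -[_ *+ size _]mulr_natr -cardE /kap.
  rewrite -mulrA ler_piMr ?(ltW k00)// mulrC ler_pdivrMr// mul1r ler_nat//.
move=> K; have mn (T1 : finType) (Y1 : X -> T1) : mlab Y1 -> mlab (name Y1 K).
  exact: (mlab_name mact).
apply: (@le_trans _ _ (HE mu setT (fun x => (name Y K x, name Z K x)))).
  apply: HE_det => //; [exact: mn|by apply: mlab_pair; exact: mn|].
  move=> x y _ _ [/nameP h1 /nameP h2]; apply/nameP => g gK.
  have := h1 g gK; have := h2 g gK; rewrite /Z; do 2 case: eqP => //; last by move=> _ _ [].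
  by move=> -> -> _ ->.
apply: (le_trans (HE_pair_le _ measurableT _ _)); [exact: mn|exact: mn|rewrite lerD2l].
apply: (@le_trans _ _ (\sum_(g <- K) HE mu setT (fun x => Z (act g x)))).
  exact: (HE_name_le_sum mact).
apply: (@le_trans _ _ (\sum_(g <- K) eta)).
  by apply: ler_sum => g _; rewrite (HE_act mi).
by rewrite big_const_seq count_predT iter_addr_0 -[_ *+ size _]mulr_natl.
Qed.

Variable phi0 : X -> R.
Hypothesis cphi0 : dcont phi0.
Variable eps : R.
Hypothesis eps0 : 0 < eps.

(* Asking for a bound on every window [K], and not only on the mean entropy, is
   what makes the condition stable under weak limits. *)
Definition Good (c : R) mu := G_invariant act mu /\
  forall T (Y : X -> T) K, mlab Y -> fine_label eps Y -> K != fset0 ->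
    c <= HE mu setT (name Y K) / #|` K|%:R + Ex mu phi0.

(** For a given [Y] the bound is passed to the limit for a continuity labelling [Y'] of nearly the
    same entropy, and then returned to [Y]. The bounds along the sequence need only hold eventually
    and up to an arbitrary error. *)
Lemma Good_limit (c : R) mus mu : wconv mus mu -> G_invariant act mu ->
  (forall T (Y : X -> T) K (e : R), mlab Y -> fine_label eps Y -> K != fset0 -> 0 < e ->
     exists N, forall n, (N <= n)%N ->
     c - e <= HE (mus n) setT (name Y K) / #|` K|%:R + Ex (mus n) phi0) ->
  Good c mu.
Proof.
move=> w mi h; split => // T Y K mY fY K0; apply/ler_addgt0Pr => e e0.
have e2 : 0 < e / 2 by rewrite divr_gt0.
have Kp : 0 < (#|` K|%:R : R) by rewrite ltr0n cardfs_gt0.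
have [T' [Y' [cY' fY' hK]]] := approx_label mi mY fY e2.
have [N NP] := h T' Y' K (e / 2) (clab_mlab cY') fY' K0 e2.
have cv : HE (mus n) setT (name Y' K) / #|` K|%:R + Ex (mus n) phi0 @[n --> \oo] -->
    HE mu setT (name Y' K) / #|` K|%:R + Ex mu phi0.
  apply: cvgD; last exact: w.
  apply: cvgM; last exact: cvg_cst.
  by apply: (clab_HE_cvg dm dc db w); exact: (clab_name dm dc db ga mi).
have : c - e / 2 <= HE mu setT (name Y' K) / #|` K|%:R + Ex mu phi0.
  rewrite -(cvg_lim _ cv)//; apply: limr_ge; first by apply/cvg_ex; eexists; exact: cv.
  by exists N => // n /= /NP.
have : HE mu setT (name Y' K) / #|` K|%:R <= HE mu setT (name Y K) / #|` K|%:R + e / 2.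
  by rewrite ler_pdivrMr// mulrDl divfK ?gt_eqF// [e / 2 * _]mulrC; exact: hK.
by move=> h1 h2; lra.
Qed.

End LowerBound.

(** * Averaged Gibbs weights on a separated set *)

Section Misiurewicz.
Context {R : realType} {G : groupType} {disp : measure_display} {X : measurableType disp}.
Variable d : X -> X -> R.
Variable act : G -> X -> X.
Hypothesis dm : is_metric d.
Hypothesis dc : dcompact d.
Hypothesis db : borel_for_d d.
Hypothesis ga : G_action d act.
Local Notation dcont := (dcontinuous_real d).
Local Notation name := (name act).
Local Notation mact := (measurable_act db ga).
Local Notation entr := (@entr_fun R).
Implicit Types (mu : probability X R) (A B : set X) (T : finType) (K F : {fset G}) (phi psi : X -> R).

Lemma sum_uniq_le T (s : seq T) (f : T -> R) : uniq s -> (forall t, 0 <= f t) ->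
  \sum_(t <- s) f t <= \sum_t f t.
Proof.
move=> us f0; rewrite big_uniq//= big_mkcond/=; apply: ler_sum => t _.
by case: ifP.
Qed.

Lemma fset_sum_split (D F : {fset G}) (f : G -> R) : (forall h, 0 <= f h) ->
  \sum_(h <- D) f h <= \sum_(h <- F) f h + \sum_(h <- (D `\` F)%fset) f h.
Proof.
move=> f0; rewrite (big_fsetID _ (mem F) D)/= (big_fsetID _ (mem D) F)/= -addrA.
have -> : [fset x in D | x \in F]%fset = [fset x in F | x \in D]%fset.
  by apply/fsetP => h; rewrite !inE andbC.
have -> : [fset x in D | ~~ (x \in F)]%fset = (D `\` F)%fset.
  by apply/fsetP => h; rewrite !inE andbC.
by rewrite lerD2l lerDr sumr_ge0.
Qed.

Lemma HE_atomic_ge sg (E : seq X) (w : X -> R) T (N : X -> T) :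
  uniq E -> (forall A, measurable A -> fm sg A = \sum_(x <- E) w x * \1_A x) -> mlab N ->
  {in E &, injective N} -> \sum_(x <- E) entr (w x) <= HE sg setT N.
Proof.
move=> uE sE mN inj; rewrite /HE fmT entr1 subr0.
have -> : \sum_(x <- E) entr (w x) = \sum_(c <- map N E) entr (fm sg (setT `&` N @^-1` [set c])).
  rewrite big_map big_seq [RHS]big_seq; apply: eq_bigr => x xE; congr entr.
  rewrite setTI sE; last exact: mN.
  rewrite (bigD1_seq x)//= indicE mem_set//= mulr1 big1_seq ?addr0// => y /andP[yx yE].
  by rewrite indicE memNset ?mulr0//= => e; move/eqP: yx; apply; apply: inj.
apply: sum_uniq_le; first by rewrite map_inj_in_uniq.
by move=> t; apply: entr_ge0; apply: fm_le1; rewrite setTI.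
Qed.

Variable phi0 : X -> R.
Hypothesis cphi0 : dcont phi0.

(** [sg] puts the Gibbs weights [exp (S x) / Z] on [E], and [mu] averages its translates over [F].
    Names along [F] separate [E], so under [sg] their entropy is at least [ln Z] minus the mean of
    [S]. Shearer's inequality spreads it over the translates [K h] with [h] in [K^-1 F]: those with
    [h] in [F] are averaged into [mu] by concavity, the others form the error term. The second
    estimate measures the failure of invariance. *)
Lemma misiurewicz_step (E : seq X) F : uniq E -> E != [::] -> F != fset0 ->
  exists mu,
   (forall T (Y : X -> T) K, mlab Y -> {in E &, injective (name Y F)} -> K != fset0 ->
     ln (\sum_(x <- E) expR (SF act F phi0 x)) / #|` F|%:R <=
     HE mu setT (name Y K) / #|` K|%:R + Ex mu phi0 +
     #|` fmul (fsinv K) F `\` F|%fset%:R / #|` F|%:R * ln (#|T|%:R)) /\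
   (forall g psi (M : R), dcont psi -> (forall x, `|psi x| <= M) ->
     `|Ex mu (fun x => psi (act g x)) - Ex mu psi| <=
       2 * M * (#|` lmul_fset g F `\` F|%fset%:R / #|` F|%:R)).
Proof.
move=> uE E0 F0; set S := SF act F phi0; set Z := \sum_(x <- E) expR (S x).
have Z0 : 0 < Z.
  rewrite /Z; case: (E) E0 => // x s _; rewrite big_cons ltr_wpDr ?expR_gt0//.
  by apply: sumr_ge0 => y _; exact: expR_ge0.
pose w x := expR (S x) / Z.
have w0 x : 0 <= w x by rewrite divr_ge0 ?expR_ge0// ltW.
have w1 : \sum_(x <- E) w x = 1 by rewrite -mulr_suml divff// gt_eqF.
have Fp : 0 < (#|` F|%:R : R) by rewrite ltr0n cardfs_gt0.
have Fn : (#|` F|%:R : R) != 0 by rewrite gt_eqF.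
have [sg [sgE _]] := @atomic_prob R disp X X E w id w0 w1.
pose c (p : X * G) := w p.1 / #|` F|%:R.
pose s := [seq (x, g) | x <- E, g <- (F : seq G)].
have c0 p : 0 <= c p by rewrite divr_ge0// ltW.
have sumE (f : X * G -> R) : \sum_(p <- s) f p = \sum_(x <- E) \sum_(g <- F) f (x, g).
  exact: big_allpairs.
have c1 : \sum_(p <- s) c p = 1.
  rewrite sumE -[RHS]w1; apply: eq_bigr => x _.
  by rewrite /c/= big_const_seq count_predT iter_addr_0 -[_ *+ size _]mulr_natl mulrCA divff ?mulr1.
have [mu [muE muX]] := @atomic_prob R disp X (X * G)%type s c (fun p => act p.2 p.1) c0 c1.
have muX' phi : bmeas phi -> Ex mu phi = (\sum_(x <- E) w x * SF act F phi x) / #|` F|%:R.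
  move=> bphi; rewrite muX// sumE mulr_suml; apply: eq_bigr => x _.
  rewrite /SF mulrAC mulr_sumr; apply: eq_bigr => g _; by rewrite /c/=.
exists mu; split.
  move=> T Y K mY inj K0; have Kp : 0 < (#|` K|%:R : R) by rewrite ltr0n cardfs_gt0.
  have mn K' : mlab (name Y K') by exact: (mlab_name mact).
  (* [- ln (w x) = ln Z - S x], and the [w]-mean of [S] is [#|F|] times the integral of [phi0]
     against [mu]. *)
  have ent : \sum_(x <- E) entr (w x) = ln Z - #|` F|%:R * Ex mu phi0.
    rewrite muX'; last exact: (dcont_bmeas dm db dc cphi0).
    rewrite mulrC divfK// -[ln Z]mul1r -w1 mulr_suml -sumrB; apply: eq_bigr => x _.
    rewrite /entr_fun {2}/w ln_div ?posrE ?expR_gt0// expRK -/S; ring.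
  have lb := HE_atomic_ge uE sgE (mn F) inj; rewrite ent in lb.
  set D := fmul (fsinv K) F.
  have sh : #|` K|%:R * HE sg setT (name Y F) <= \sum_(h <- D) HE sg setT (name Y (rtrans K h)).
    apply: (HE_name_shearer mact) => // g gF; rewrite -size_filter.
    apply: (@leq_trans (size (enum_fset [fset (k^-1 * g)%g | k in K]%fset))).
      by rewrite card_imfset//= => x y /mulIg/invg_inj.
    apply: uniq_leq_size; first exact: fset_uniq.
    move=> x /imfsetP[k /= kK ->]; rewrite mem_filter mem_rtrans invgM invgK mulVKg kK/=.
    by apply: mem_fmul => //; rewrite mem_fsinv invgK.
  have Hge h : 0 <= HE sg setT (name Y (rtrans K h)) by apply: HE_ge0.
  have spl : \sum_(h <- D) HE sg setT (name Y (rtrans K h)) <=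
      \sum_(h <- F) HE sg setT (name Y (rtrans K h)) + \sum_(h <- (D `\` F)%fset) HE sg setT (name Y (rtrans K h)).
    exact: fset_sum_split.
  have last_ : \sum_(h <- (D `\` F)%fset) HE sg setT (name Y (rtrans K h)) <=
      #|` D `\` F|%fset%:R * (#|` K|%:R * ln (#|T|%:R)).
    apply: (@le_trans _ _ (\sum_(h <- (D `\` F)%fset) #|` K|%:R * ln (#|T|%:R))).
      apply: ler_sum => h _.
      apply: (@le_trans _ _ (\sum_(g <- rtrans K h) HE sg setT (fun x => Y (act g x)))).
        exact: (HE_name_le_sum mact).
      apply: (@le_trans _ _ (\sum_(g <- rtrans K h) ln (#|T|%:R))).
        apply: ler_sum => g _; have := @HE_le_ln _ _ _ sg setT T (fun x => Y (act g x)) measurableT (mlab_act mact g mY).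
        by rewrite fmT mul1r.
      by rewrite big_const_seq count_predT iter_addr_0 -[_ *+ size _]mulr_natl card_rtrans.
    by rewrite big_const_seq count_predT iter_addr_0 -[_ *+ size _]mulr_natl.
  (* The mass of a name under [mu] is the average over [h] of its masses under the translates of
     [sg], so concavity of [entr] applies cell by cell. *)
  have conc : \sum_(h <- F) HE sg setT (name Y (rtrans K h)) <= #|` F|%:R * HE mu setT (name Y K).
    have tr h : HE sg setT (name Y (rtrans K h)) = HE sg setT (fun x => name Y K (act h x)).
      apply: HE_deteq => //; first exact: (mlab_act mact).
      move=> x y _ _; split => /nameP H; apply/nameP => g.
        by move=> /imfsetP[f /= fK ->]; rewrite !(actM ga); exact: H.
      by move=> gK; rewrite -!(actM ga); apply: H; rewrite mem_rtrans mulgK.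
    under eq_bigr do rewrite tr.
    rewrite /HE !fmT entr1; under eq_bigr do rewrite subr0.
    rewrite subr0 exchange_big/= mulr_sumr; apply: ler_sum => t _.
    rewrite (_ : fm mu _ = (\sum_(h <- F) fm sg (setT `&` (fun x => name Y K (act h x)) @^-1` [set t])) / (size (F : seq G))%:R).
      apply: (@entr_concave R G (F : seq G) (fun h => fm sg (setT `&` (fun x => name Y K (act h x)) @^-1` [set t]))) => [h|].
        exact: fm_ge0.
      by rewrite cardfs_gt0.
    rewrite setTI muE; last exact: mn.
    rewrite sumE exchange_big/= mulr_suml; apply: eq_bigr => h _.
    rewrite setTI sgE; last exact: (mlab_act mact h (mn K)).
    by rewrite mulr_suml; apply: eq_bigr => x _; rewrite /c/= mulrAC !indicE.
  have tot : #|` K|%:R * (ln Z - #|` F|%:R * Ex mu phi0) <=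
      #|` F|%:R * HE mu setT (name Y K) + #|` D `\` F|%fset%:R * (#|` K|%:R * ln (#|T|%:R)).
    apply: (@le_trans _ _ (#|` K|%:R * HE sg setT (name Y F))); first by rewrite ler_pM2l.
    by apply: (le_trans sh); apply: (le_trans spl); exact: lerD.
  rewrite -(ler_pM2l Kp) -(ler_pM2l Fp).
  have -> : #|` F|%:R * (#|` K|%:R * (ln Z / #|` F|%:R)) = #|` K|%:R * ln Z.
    by field.
  have -> : #|` F|%:R * (#|` K|%:R * (HE mu setT (name Y K) / #|` K|%:R + Ex mu phi0 +
      #|` D `\` F|%fset%:R / #|` F|%:R * ln #|T|%:R)) =
     (#|` F|%:R * HE mu setT (name Y K) + #|` D `\` F|%fset%:R * (#|` K|%:R * ln (#|T|%:R))) +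
     #|` K|%:R * (#|` F|%:R * Ex mu phi0).
    by field; rewrite Fn gt_eqF.
  by move: tot; rewrite mulrBr lerBlDr.
move=> g psi M cpsi hM.
have bpsi := dcont_bmeas dm db dc cpsi.
have M0 : 0 <= M by apply: le_trans (hM point).
rewrite !muX' //; last exact: (bmeas_act db ga).
rewrite -mulrBl -sumrB normrM (gtr0_norm (_ : 0 < #|` F|%:R^-1)) ?invr_gt0// mulrA ler_wpM2r ?invr_ge0 ?ler0n//.
set C := (X in _ <= X); have -> : C = \sum_(x <- E) w x * C by rewrite -mulr_suml w1 mul1r.
rewrite (le_trans (ler_norm_sum _ _ _))// ler_sum// => x _.
rewrite -mulrBr normrM (ger0_norm (w0 x)) ler_wpM2l//.
pose f h := psi (act h x).
have -> : SF act F (fun x => psi (act g x)) x = \sum_(h <- lmul_fset g F) f h.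
  rewrite /SF /lmul_fset big_imfset/=; last by move=> a b _ _; exact: mulgI.
  by apply: eq_bigr => h _; rewrite /f (actM ga).
have -> : SF act F psi x = \sum_(h <- F) f h by [].
rewrite (big_fsetID _ (mem F) (lmul_fset g F))/= (big_fsetID _ (mem (lmul_fset g F)) F)/=.
rewrite (_ : [fset x0 in lmul_fset g F | x0 \in F]%fset = [fset x0 in F | x0 \in lmul_fset g F]%fset); last first.
  by apply/fsetP => h; rewrite !inE andbC.
rewrite addrC opprD addrACA addrA subrK.
have bd (B : {fset G}) : `|\sum_(h <- B) f h| <= #|` B|%:R * M.
  apply: (le_trans (ler_norm_sum _ _ _)).
  apply: (@le_trans _ _ (\sum_(h <- B) M)); first by apply: ler_sum => h _; exact: hM.
  by rewrite big_const_seq count_predT iter_addr_0 -[_ *+ size _]mulr_natl.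
apply: (le_trans (ler_normB _ _)).
have -> : C = #|` lmul_fset g F `\` F|%fset%:R * M +
  #|` lmul_fset g F `\` F|%fset%:R * M by rewrite /C; ring.
have e1 : [fset x0 in lmul_fset g F | ~~ (x0 \in F)]%fset = (lmul_fset g F `\` F)%fset.
  by apply/fsetP => h; rewrite !inE andbC.
have e2 : [fset x0 in F | ~~ (x0 \in lmul_fset g F)]%fset = (F `\` lmul_fset g F)%fset.
  by apply/fsetP => h; rewrite !inE andbC.
have e3 : #|` F `\` lmul_fset g F|%fset = #|` lmul_fset g F `\` F|%fset.
  by apply/eqP; rewrite -(eqn_add2l #|` F `&` lmul_fset g F|%fset) cardfsID fsetIC cardfsID card_lmul.
rewrite e1 e2; apply: lerD; first exact: bd.
by rewrite -e3; exact: bd.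
Qed.

End Misiurewicz.

(** * Measures realising the pressure, and the maximal face *)

Section ErgodicLowerBound.
Context {R : realType} {G : groupType} {disp : measure_display} {X : measurableType disp}.
Variable d : X -> X -> R.
Variable act : G -> X -> X.
Hypothesis dm : is_metric d.
Hypothesis dc : dcompact d.
Hypothesis db : borel_for_d d.
Hypothesis ga : G_action d act.
Local Notation dcont := (dcontinuous_real d).
Local Notation wconv := (wconv d).
Local Notation name := (name act).
Local Notation mact := (measurable_act db ga).
Local Notation entr := (@entr_fun R).
Implicit Types (mu : probability X R) (A B : set X) (T : finType) (K F : {fset G}) (phi psi : X -> R).

Lemma fine_label_exists (eps : R) : 0 < eps -> exists T (Y : X -> T), mlab Y /\
  forall x y, Y x = Y y -> d x y <= eps / 2.
Proof.
move=> e0; have e4 : 0 < eps / 4 by rewrite divr_gt0.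
have [s sP] := dcompact_ball dm dc (fun=> e4).
pose V (j : 'I_(size s)) := [set x | d (nth point s j) x < eps / 4].
pose b x := [ffun j => `[< V j x >]].
pose h (p : {ffun 'I_(size s) -> bool}) := [pick j | p j].
exists (option 'I_(size s)), (fun x => h (b x)); split.
  apply: mlab_comp; apply: (mlab_ffun (Y := fun j x => `[< V j x >])) => j.
  by apply: mlab_asbool; apply: (dopen_measurable db); apply: dball_open.
have hP x : exists2 j, h (b x) = Some j & V j x.
  rewrite /h; case: pickP => [j|n]; first by rewrite ffunE => /asboolP Vj; exists j.
  have [c cs cx] := sP x; have jl : (index c s < size s)%N by rewrite index_mem.
  by have := n (Ordinal jl); rewrite ffunE /V => /asboolP; case; rewrite /= nth_index.
move=> x y; have [j -> Vx] := hP x; have [j' -> Vy] := hP y; move=> [jj].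
move: Vy; rewrite -jj => Vy.
have := dtri dm x (nth point s j) y; rewrite (dsym dm x (nth point s j)); move: Vx Vy; rewrite /V/=.
by lra.
Qed.

Lemma separated_inj eps F (E : seq X) T (Y : X -> T) : Defs.separated d act F eps E ->
  fine_label d eps Y -> {in E &, injective (name Y F)}.
Proof.
move=> [_ sE] [e ee hY] x y xE yE /nameP h; apply: contrapT => /eqP xy.
have := sE x y xE yE xy; apply/negP; rewrite -leNgt /dF.
rewrite big_seq; apply: bigmax_le => [|g gF].
  by apply: le_trans (ltW ee); rewrite -(dxx dm x); exact: hY.
by apply: le_trans (ltW ee); apply: hY; apply: h.
Qed.

Section Potential.
Variable phi0 : X -> R.
Hypothesis cphi0 : dcont phi0.
Variable eps : R.
Hypothesis eps0 : 0 < eps.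

(** Fine names inject a separated set into a finite type. Hence the real [sup] in [PF] is taken over
    a bounded set and is a true supremum. *)
Lemma PF_bounded F : exists M : R, forall E, Defs.separated d act F eps E ->
  \sum_(x <- E) expR (SF act F phi0 x) <= M.
Proof.
have [T [Y [mY hY]]] := fine_label_exists eps0.
have fY : fine_label d eps Y by exists (eps / 2) => //; have := eps0; lra.
have [M M0 hM] := dcont_bounded dm dc cphi0.
exists (#|{ffun F -> T}|%:R * expR (#|` F|%:R * M)) => E sE.
have inj := separated_inj sE fY.
apply: (@le_trans _ _ (\sum_(x <- E) expR (#|` F|%:R * M))).
  apply: ler_sum => x _; rewrite ler_expR /SF.
  apply: (@le_trans _ _ (\sum_(g <- F) M)).
    by apply: ler_sum => g _; apply: le_trans (hM (act g x)); exact: ler_norm.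
  by rewrite big_const_seq count_predT iter_addr_0 -[_ *+ size _]mulr_natl.
rewrite big_const_seq count_predT iter_addr_0 -[_ *+ size _]mulr_natl ler_wpM2r ?expR_ge0// ler_nat.
rewrite -(size_map (name Y F)) cardE; apply: uniq_leq_size; last by move=> c _; rewrite mem_enum.
by rewrite map_inj_in_uniq//; case: sE.
Qed.

Lemma sum_le_PF F E : Defs.separated d act F eps E ->
  \sum_(x <- E) expR (SF act F phi0 x) <= PF d act F phi0 eps.
Proof.
move=> sE; have [M hM] := PF_bounded F; apply: ub_le_sup; last by exists E.
by exists M => _ [E' sE' <-]; exact: hM.
Qed.

Lemma separated1 F (x : X) : Defs.separated d act F eps [:: x].
Proof. by split => // y z; rewrite !inE => /eqP -> /eqP ->; rewrite eqxx. Qed.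

Lemma PF_gt0 F : 0 < PF d act F phi0 eps.
Proof.
apply: lt_le_trans (sum_le_PF (separated1 F point)).
by rewrite big_seq1 expR_gt0.
Qed.

Lemma PF_gt F (c : R) : c < PF d act F phi0 eps -> exists2 E, Defs.separated d act F eps E &
  c < \sum_(x <- E) expR (SF act F phi0 x).
Proof.
move=> h; have [|_ [E sE <-] cE] := sup_gt _ h; first by eexists; exists [:: point] => //; exact: separated1.
by exists E.
Qed.

Variable F : nat -> {fset G}.
Hypothesis FF : Folner R F.
Hypothesis Ginf : exists e : nat -> G, injective e.

Lemma limn_esup_gt (u : nat -> \bar R) (c : \bar R) : (c < limn_esup u)%E ->
  forall N, exists2 n, (N <= n)%N & (c < u n)%E.
Proof.
move=> h N; have : (c < ereal_sup (u @` [set n | (N <= n)%N]))%E.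
  apply: lt_le_trans h _; apply: ereal_inf_lbound; exists [set n | (N <= n)%N] => //.
  by exists N.
by move=> /ereal_sup_gt[_ [n Nn <-] cn]; exists n.
Qed.

(** A limsup above [c] gives, for arbitrarily large [n], separated sets with weighted sums above
    [exp (c #|F n|)]; both error terms of [misiurewicz_step] vanish along them, hence in a weak
    limit. *)
Lemma pressure_Good (c : R) : (c%:E < pressure d act phi0 F eps)%E ->
  exists mu, Good d act phi0 eps c mu.
Proof.
move=> h.
have st N : exists p : nat * seq X, (N <= p.1)%N /\ Defs.separated d act (F p.1) eps p.2 /\ p.2 != [::] /\
    c < ln (\sum_(x <- p.2) expR (SF act (F p.1) phi0 x)) / #|` F p.1|%:R.
  have [n Nn] := limn_esup_gt h N; rewrite lte_fin.
  have Fp := Folner_card_gt0 FF n; rewrite ltr_pdivlMr// => h1.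
  have h2 : expR (c * #|` F n|%:R) < PF d act (F n) phi0 eps.
    by rewrite -[ltRHS]lnK ?posrE ?PF_gt0// ltr_expR.
  have [E sE hE] := PF_gt h2; exists (n, E); split => //; split => //=; split.
    by apply: contraTneq hE => ->; rewrite big_nil -leNgt expR_ge0.
  rewrite ltr_pdivlMr// -ltr_expR lnK// posrE.
  exact: lt_trans (expR_gt0 _) hE.
pose p N := sval (cid (st N)); pose nn N := (p N).1; pose EE N := (p N).2.
have pP N : (N <= nn N)%N /\ Defs.separated d act (F (nn N)) eps (EE N) /\ EE N != [::] /\
    c < ln (\sum_(x <- EE N) expR (SF act (F (nn N)) phi0 x)) / #|` F (nn N)|%:R.
  by rewrite /nn /EE /p; case: cid.
have mk N := @misiurewicz_step R G disp X d act dm dc db ga phi0 cphi0 (EE N) (F (nn N))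
   (proj1 (proj1 (proj2 (pP N)))) (proj1 (proj2 (proj2 (pP N)))) (Folner_neq0 FF (nn N)).
pose mus N := sval (cid (mk N)).
have musP N := svalP (cid (mk N)); rewrite -/(mus _) in musP.
have [s [hs [mu w]]] := weak_compact dm dc db mus.
have hge n : (n <= nn (s n))%N.
  apply: leq_trans (pP (s n)).1; elim: n => // n IH; apply: leq_ltn_trans IH _; exact: hs.
exists mu; apply: (Good_limit dm dc db ga cphi0 w).
  apply: (invariant_Ex dm dc db ga) => g psi cpsi.
  have [M M0 hM] := dcont_bounded dm dc cpsi.
  have cv : Ex ((mus \o s) n) (fun x => psi (act g x)) - Ex ((mus \o s) n) psi @[n --> \oo] -->
      Ex mu (fun x => psi (act g x)) - Ex mu psi.
    by apply: cvgB; apply: w => //; exact: (dcont_act ga).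
  apply/eqP; rewrite -subr_eq0; apply/eqP.
  rewrite -(cvg_lim _ cv)//; apply: cvg_lim => //; apply/cvgrPdist_le => e e0.
  have e' : 0 < e / (2 * (M + 1)) by rewrite divr_gt0// mulr_gt0// ltr_wpDl.
  have [N NP] := Folner_lmul FF g e'; exists N => // n /= Nn; rewrite sub0r normrN.
  have Fp := Folner_card_gt0 FF (nn (s n)).
  apply: (le_trans ((musP (s n)).2 g psi M cpsi hM)).
  have := NP _ (leq_trans Nn (hge n)); rewrite -ler_pdivrMr// => h1.
  apply: (@le_trans _ _ (2 * (M + 1) * (e / (2 * (M + 1))))).
    by rewrite ler_pM ?mulr_ge0 ?divr_ge0 ?ler_wpM2l ?lerDl.
  by rewrite mulrC divfK// mulf_neq0// gt_eqF// ltr_wpDl.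
move=> T Y K e mY fY K0 e0.
have l0 : 0 <= ln (#|T|%:R : R).
  by apply: ln_ge0; rewrite ler1n; apply/card_gt0P; exists (Y point).
have e' : 0 < e / (ln (#|T|%:R) + 1) by rewrite divr_gt0// ltr_wpDl.
have [N NP] := Folner_fmul FF (fsinv K) e'; exists N => n Nn.
have [_ [sE [_ hc]]] := pP (s n).
have := (musP (s n)).1 T Y K mY (separated_inj sE fY) K0.
have := NP _ (leq_trans Nn (hge n)); rewrite -ler_pdivrMr ?Folner_card_gt0// => h1.
set t := #|` _|%:R / _ in h1 * => h2.
have : t * ln (#|T|%:R) <= e.
  apply: (le_trans (ler_wpM2r l0 h1)); rewrite mulrAC ler_pdivrMr ?ltr_wpDl//.
  by rewrite ler_wpM2l ?(ltW e0)// lerDl.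
move=> h3; rewrite /=; move: hc h2 h3; rewrite -/(mus _).
by set u := ln _ / _ => hc h2 h3; lra.
Qed.

Lemma Good_bounded : exists M : R, forall c mu, Good d act phi0 eps c mu -> c <= M.
Proof.
have [T [Y [mY hY]]] := fine_label_exists eps0.
have fY : fine_label d eps Y by exists (eps / 2) => //; have := eps0; lra.
have [M M0 hM] := dcont_bounded dm dc cphi0.
exists (ln (#|T|%:R) + M) => c mu [mi /(_ T Y [fset 1%g]%fset mY fY)].
have K0 : [fset 1%g]%fset != fset0 :> {fset G} by apply/fset0Pn; exists 1%g; rewrite inE.
move=> /(_ K0) /le_trans; apply; rewrite cardfs1 divr1; apply: lerD.
  rewrite (HE_name1 mact)//.
  have := @HE_le_ln _ _ _ mu setT T (fun x => Y (act 1%g x)) measurableT (mlab_act mact _ mY).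
  by rewrite fmT mul1r.
exact: le_trans (ler_norm _) (Ex_abs_le mu (dcont_bmeas dm db dc cphi0) hM).
Qed.

Definition maxGood : R := sup [set c | exists mu, Good d act phi0 eps c mu].

Lemma Good_le c c' mu : c' <= c -> Good d act phi0 eps c mu -> Good d act phi0 eps c' mu.
Proof. by move=> cc [mi h]; split => // T Y K mY fY K0; exact: le_trans cc (h T Y K mY fY K0). Qed.

Lemma Good_closed c mus mu : (forall n, Good d act phi0 eps c (mus n)) -> wconv mus mu ->
  Good d act phi0 eps c mu.
Proof.
move=> h w; apply: (Good_limit dm dc db ga cphi0 w).
  by apply: (wconv_invariant dm dc db ga _ w) => n; case: (h n).
move=> T Y K e mY fY K0 e0; exists 0%N => n _; have [_ /(_ T Y K mY fY K0)] := h n.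
by apply: le_trans; rewrite gerBl ltW.
Qed.

Lemma Good_le_max c mu : Good d act phi0 eps c mu -> c <= maxGood.
Proof.
move=> h; apply: ub_le_sup; last by exists mu.
by have [M hM] := Good_bounded; exists M => c' [mu' /hM].
Qed.

Lemma maxGood_attained c mu : Good d act phi0 eps c mu ->
  exists mu', Good d act phi0 eps maxGood mu'.
Proof.
move=> h0.
have hs : has_sup [set c | exists mu, Good d act phi0 eps c mu].
  split; first by exists c, mu.
  by have [M hM] := Good_bounded; exists M => c' [mu' /hM].
have st n : exists mu, Good d act phi0 eps (maxGood - n.+1%:R^-1) mu.
  have [|c' [mu' h'] lc] := @sup_adherent _ _ (n.+1%:R^-1) _ hs; first by rewrite invr_gt0.
  by exists mu'; apply: Good_le h'; exact: ltW.
pose mus n := sval (cid (st n)).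
have musP n : Good d act phi0 eps (maxGood - n.+1%:R^-1) (mus n) by rewrite /mus; case: cid.
have [s [hs' [mu' w]]] := weak_compact dm dc db mus.
have hge n : (n <= s n)%N by elim: n => // n IH; apply: leq_ltn_trans IH _; exact: hs'.
exists mu'; apply: (Good_limit dm dc db ga cphi0 w).
  by apply: (wconv_invariant dm dc db ga _ w) => n; case: (musP (s n)).
move=> T Y K e mY fY K0 e0; exists (Num.bound e^-1) => n ln.
have [_ /(_ T Y K mY fY K0)] := musP (s n); apply: le_trans; rewrite lerD2l lerN2.
rewrite invf_ple ?posrE//; apply: ltW; apply: (@lt_le_trans _ _ (Num.bound e^-1)%:R).
  by rewrite archi_boundP// invr_ge0 ltW.
by rewrite ler_nat (leq_trans ln)// (leq_trans (hge n)).
Qed.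

(** Suppose [P1] violates its bound for [Y1]. By maximality [P2] is not good for [maxGood + tau'],
    so some [Y2] keeps it below that value. The label equal to [Y1] on [A] and [Y2] off [A] is again
    fine, and since [A] is invariant the entropy of its names along large [F n] is at most about the
    weighted mean of the two. This contradicts the bound for [mu]. *)
Lemma Good_face mu A P1 P2 : Good d act phi0 eps maxGood mu -> measurable A ->
  (forall g x, A (act g x) <-> A x) ->
  (forall B, measurable B -> fm mu (B `&` A) = fm mu A * fm P1 B) ->
  (forall B, measurable B -> fm mu (B `&` ~` A) = (1 - fm mu A) * fm P2 B) ->
  0 < fm mu A < 1 -> G_invariant act P1 -> G_invariant act P2 ->
  Ex mu phi0 = fm mu A * Ex P1 phi0 + (1 - fm mu A) * Ex P2 phi0 ->
  Good d act phi0 eps maxGood P1.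
Proof.
set lam := fm mu A; set s := maxGood.
move=> [mi hmu] mA Ainv P1E P2E /andP[lam0 lam1] i1 i2 muX; split => // T1 Y1 K1 mY1 fY1 K10.
rewrite leNgt; apply/negP => bad1.
set a1 := HE P1 _ _ / _ + _ in bad1.
pose tau := s - a1; have tau0 : 0 < tau by rewrite subr_gt0.
(* The gain is [lam * tau]. The losses are at most [tau'] from [P2] and [2 * e] from the Folner
   window, where [e = lam * tau / 8]: together half of the gain. *)
pose tau' := lam * tau / 4; have tau'0 : 0 < tau' by rewrite divr_gt0// mulr_gt0.
have [T2 [Y2 [K2 [mY2 fY2 K20 bad2]]]] : exists T2 (Y2 : X -> T2) K2, [/\ mlab Y2, fine_label d eps Y2,
    K2 != fset0 & HE P2 setT (name Y2 K2) / #|` K2|%:R + Ex P2 phi0 < s + tau'].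
  apply: contrapT => h; have : Good d act phi0 eps (s + tau') P2.
    split => // T Y K mY fY K0; rewrite leNgt; apply/negP => h2; apply: h.
    by exists T, Y, K.
  by move=> /Good_le_max; rewrite gerDl leNgt tau'0.
pose Y x : T1 + T2 := if `[< A x >] then inl (Y1 x) else inr (Y2 x).
have mY : mlab Y.
  exact: (@mlab_comp _ _ _ _ (fun p : bool * T1 * T2 => if p.1.1 then inl p.1.2 else inr p.2) _
    (mlab_pair (mlab_pair (mlab_asbool mA) mY1) mY2)).
have fY : fine_label d eps Y.
  have [e1 ee1 h1] := fY1; have [e2 ee2 h2] := fY2.
  exists (Num.max e1 e2); first by rewrite gt_max ee1.
  move=> x y; rewrite /Y; do 2 case: asboolP => //= _; move=> [] h.
    by rewrite le_max h1.
  by rewrite le_max h2 ?orbT.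
pose e := lam * tau / 8; have e0 : 0 < e by rewrite divr_gt0// mulr_gt0.
(* [K1] and [K2] are unrelated windows; through the mean entropy both bounds move to a common window
   [F n], long enough to absorb the cost [C] of telling [A] from its complement. *)
have [N1 N1P] := hrate_Folner_le mact i1 (actM ga) FF mY1 e0.
have [N2 N2P] := hrate_Folner_le mact i2 (actM ga) FF mY2 e0.
pose C := entr lam + entr (1 - lam).
have [N3 N3P] := Folner_card_infty FF Ginf (Num.bound (`|C| / e)).
pose n := maxn N1 (maxn N2 N3).
have {}N1P := N1P n (leq_maxl _ _).
have {}N2P := N2P n (leq_trans (leq_maxl _ _) (leq_maxr _ _)).
have {}N3P := N3P n (leq_trans (leq_maxr _ _) (leq_maxr _ _)).
have Fp := Folner_card_gt0 FF n.
have CF : C <= e * #|` F n|%:R.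
  apply: (le_trans (ler_norm _)); rewrite mulrC -ler_pdivrMr//; apply: ltW.
  apply: (@lt_le_trans _ _ (Num.bound (`|C| / e))%:R); last by rewrite ler_nat.
  by rewrite archi_boundP// divr_ge0// ltW.
pose W x : {ffun F n -> T1} + {ffun F n -> T2} :=
  if `[< A x >] then inl (name Y1 (F n) x) else inr (name Y2 (F n) x).
have mn1 := mlab_name mact (F := F n) mY1; have mn2 := mlab_name mact (F := F n) mY2.
have mW : mlab W.
  exact: (@mlab_comp _ _ _ _ (fun p : bool * {ffun F n -> T1} * {ffun F n -> T2} => if p.1.1 then inl p.1.2 else inr p.2) _
    (mlab_pair (mlab_pair (mlab_asbool mA) mn1) mn2)).
have HW : HE mu setT W = lam * HE P1 setT (name Y1 (F n)) + (1 - lam) * HE P2 setT (name Y2 (F n)) + C.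
  have l1 : 0 <= 1 - lam by rewrite subr_ge0 ltW.
  rewrite /HE !fmT entr1 !subr0 big_sumType/=.
  have -> : \sum_c entr (fm mu (setT `&` W @^-1` [set inl c])) =
      lam * (\sum_c entr (fm P1 (setT `&` name Y1 (F n) @^-1` [set c]))) + entr lam.
    rewrite -[entr lam]mul1r -[X in X * entr lam](fmT P1) -(fm_partition P1 measurableT mn1).
    rewrite mulr_sumr mulr_suml -big_split/=; apply: eq_bigr => c _.
    rewrite -entrM ?fm_ge0// ?(ltW lam0)// !setTI -(P1E _ (mn1 c)); congr (entr (fm mu _)).
    apply/seteqP; split => x; rewrite /W/=; case: asboolP => // h; first by move=> [->].
      by move=> [->].
    by move=> [].
  have -> : \sum_c entr (fm mu (setT `&` W @^-1` [set inr c])) =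
      (1 - lam) * (\sum_c entr (fm P2 (setT `&` name Y2 (F n) @^-1` [set c]))) + entr (1 - lam).
    rewrite -[entr (1 - lam)]mul1r -[X in X * entr (1 - lam)](fmT P2) -(fm_partition P2 measurableT mn2).
    rewrite mulr_sumr mulr_suml -big_split/=; apply: eq_bigr => c _.
    rewrite -entrM ?fm_ge0// !setTI -(P2E _ (mn2 c)); congr (entr (fm mu _)).
    apply/seteqP; split => x; rewrite /W/=; case: asboolP => // h; first by move=> [->].
      by move=> [].
    by move=> [->].
  by rewrite /C; ring.
have HY : HE mu setT (name Y (F n)) <= HE mu setT W.
  apply: HE_det => //; first exact: (mlab_name mact).
  move=> x y _ _; rewrite /W; do 2 case: asboolP => //; move=> Ax Ay [] /nameP h; apply/nameP => g gF.
    have a1' := (Ainv g x).2 Ay; have a2' := (Ainv g y).2 Ax.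
    by rewrite /Y; do 2 case: asboolP => //; rewrite h.
  rewrite /Y; case: asboolP => [/Ainv//|_]; case: asboolP => [/Ainv//|_].
  by rewrite h.
have := hmu _ Y (F n) mY fY (Folner_neq0 FF n).
have b1 := hrate_le mact P1 mY1 K10; have b2 := hrate_le mact P2 mY2 K20.
apply/negP; rewrite -ltNge muX.
apply: (@le_lt_trans _ _ (lam * (hrate act P1 Y1 + e) + (1 - lam) * (hrate act P2 Y2 + e) + e
   + (lam * Ex P1 phi0 + (1 - lam) * Ex P2 phi0))).
  rewrite lerD2r ler_pdivrMr//; apply: (le_trans HY); rewrite HW.
  have -> : (lam * (hrate act P1 Y1 + e) + (1 - lam) * (hrate act P2 Y2 + e) + e) * #|` F n|%:R =
    lam * ((hrate act P1 Y1 + e) * #|` F n|%:R) + (1 - lam) * ((hrate act P2 Y2 + e) * #|` F n|%:R) +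
    e * #|` F n|%:R by ring.
  by rewrite lerD// lerD// ler_pM2l// subr_gt0.
have l1 : 0 < 1 - lam by rewrite subr_gt0.
have c1 : lam * (hrate act P1 Y1 + Ex P1 phi0) <= lam * a1 by rewrite ler_pM2l// lerD2r.
have c2 : (1 - lam) * (hrate act P2 Y2 + Ex P2 phi0) <= (1 - lam) * (s + tau').
  by rewrite ler_pM2l// (le_trans _ (ltW bad2))// lerD2r.
have c3 : (1 - lam) * tau' <= tau' by rewrite -[leRHS]mul1r ler_pM2r// gerBl ltW.
have a1E : lam * a1 = lam * s - lam * tau by rewrite /tau; ring.
have t1 : tau' = lam * tau / 4 by []. have t2 : e = lam * tau / 8 by [].
have lt0 : 0 < lam * tau by rewrite mulr_gt0.
move: c1 c2; rewrite a1E => c1 c2; clearbody a1 tau tau' e s lam; move: c1 c2; rewrite !mulrDr => c1 c2.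
by move: (lam * tau) t1 t2 lt0 c1 c2 c3 => q t1 t2 lt0; rewrite mulrBl !mulrBl !mul1r; lra.
Qed.

End Potential.
End ErgodicLowerBound.

Section Determining.
Context {R : realType} {disp : measure_display} {X : measurableType disp}.
Variable d : X -> X -> R.
Hypothesis dm : is_metric d.
Hypothesis dc : dcompact d.
Hypothesis db : borel_for_d d.
Local Notation dcont := (dcontinuous_real d).
Implicit Types (mu : probability X R).

Lemma open_base : exists D : nat -> set X, (forall i, dopen d (D i)) /\
  forall V x, dopen d V -> V x -> exists i, D i x /\ D i `<=` V.
Proof.
have net k : exists s : seq X, forall x, exists2 c, c \in s & d c x < (k.+1%:R)^-1.
  by apply: (dcompact_ball dm dc) => x; rewrite invr_gt0.
pose s k := sval (cid (net k)).
have sP k x : exists2 c, c \in s k & d c x < (k.+1%:R)^-1.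
  by rewrite /s; case: (cid (net k)).
pose D i : set X := if (choice.unpickle i : option (nat * nat)) is Some kj then
   [set y | d (nth point (s kj.1) kj.2) y < (kj.1.+1%:R)^-1] else set0.
exists D; split.
  by move=> i; rewrite /D; case: choice.unpickle => [kj|]; [exact: dball_open|exact: dopen0].
move=> V x oV Vx; have [r r0 hr] := oV x Vx; pose k := Num.bound (2 / r).
have kr : 2 * (k.+1%:R)^-1 < r.
  rewrite ltr_pdivrMr// mulrC -ltr_pdivrMr//.
  apply: (@lt_trans _ _ k%:R); last by rewrite ltr_nat.
  by rewrite archi_boundP// divr_ge0// ltW.
have [c cs cx] := sP k x.
exists (choice.pickle (k, index c (s k))); rewrite /D choice.pickleK /= nth_index//.
split => // y cy; apply: hr => /=; have := dtri dm x c y; rewrite (dsym dm x c).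
by move: cx cy kr => /=; move: (k.+1%:R^-1) => q; lra.
Qed.

(** Finite intersections of a countable base form a countable generating family closed under
    intersection, and the bumps of its members determine a measure. *)
Lemma determining_family : exists psi : nat -> X -> R, (forall i, dcont (psi i)) /\
  forall mu mu', (forall i, Ex mu (psi i) = Ex mu' (psi i)) ->
    forall A, measurable A -> mu A = mu' A.
Proof.
have [D [oD bD]] := open_base.
pose U (w : seq nat) : set X := foldr (fun i V => D i `&` V) setT w.
have oU w : dopen d (U w) by elim: w => [|i w IH] /=; [exact: dopenT|exact: dopenI].
have UI v w : U v `&` U w = U (v ++ w).
  by elim: v => [|i v IH] /=; rewrite ?setTI// -setIA IH.
pose psi i := if (choice.unpickle i : option (seq nat * nat)) is Some p
  then open_bump d (U p.1) p.2 else fun=> 0.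
exists psi; split.
  by move=> i; rewrite /psi; case: choice.unpickle => [p|]; [exact: dcont_open_bump|exact: dcont_cst].
move=> mu mu' h; apply: (@measure_eq_open _ _ _ d dm db mu mu' (range U)).
- by move=> _ _ [v _ <-] [w _ <-]; rewrite UI; exists (v ++ w).
- by exists [::].
- by move=> _ [w _ <-].
- move=> V oV; rewrite (_ : V = \bigcup_i (if `[< D i `<=` V >] then D i else set0)).
    apply: sigma_algebra_bigcup => i; case: asboolP => _; last exact: sigma_algebra0.
    by apply: sub_gen_smallest; exists [:: i] => //=; rewrite setIT.
  apply/seteqP; split => x.
    by move=> /(bD V x oV)[i [Dx DV]]; exists i => //; case: asboolP.
  by move=> [i _]; case: asboolP => // DV /DV.
- move=> _ n [w _ <-]; have := h (choice.pickle (w, n)).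
  by rewrite /psi choice.pickleK.
Qed.

End Determining.

(** * Ergodic measures in the maximal face *)

Section ErgodicGood.
Context {R : realType} {G : groupType} {disp : measure_display} {X : measurableType disp}.
Variable d : X -> X -> R.
Variable act : G -> X -> X.
Hypothesis dm : is_metric d.
Hypothesis dc : dcompact d.
Hypothesis db : borel_for_d d.
Hypothesis ga : G_action d act.
Local Notation dcont := (dcontinuous_real d).
Local Notation wconv := (wconv d).
Implicit Types (mu : probability X R) (A B : set X) (phi : X -> R).
Variable phi0 : X -> R.
Hypothesis cphi0 : dcont phi0.
Variable eps : R.
Hypothesis eps0 : 0 < eps.
Variable F : nat -> {fset G}.
Hypothesis FF : Folner R F.
Hypothesis Ginf : exists e : nat -> G, injective e.
Local Notation Good := (Good d act phi0 eps).
Local Notation smax := (maxGood d act phi0 eps).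

Section Lexicographic.
Variable psi : nat -> X -> R.
Hypothesis cpsi : forall i, dcont (psi i).

(* Successive maximisation of the [Ex mu (psi i)] over the closed face of maximal [Good] measures *)
Fixpoint lexmax (i : nat) (mu : probability X R) : Prop :=
  if i is j.+1 then lexmax j mu /\ forall mu', lexmax j mu' -> Ex mu' (psi j) <= Ex mu (psi j)
  else Good smax mu.

Lemma lexmax_closed i mus mu : (forall n, lexmax i (mus n)) -> wconv mus mu -> lexmax i mu.
Proof.
elim: i mus mu => [|i IH] mus mu h w /=; first exact: (Good_closed dm dc db ga cphi0 h w).
split; first by apply: (IH mus) => // n; case: (h n).
move=> mu' hmu'; have cv := w _ (@cpsi i).
rewrite -(cvg_lim _ cv)//; apply: limr_ge; first by apply/cvg_ex; eexists; exact: cv.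
by apply: nearW => n; have [_] := h n; exact.
Qed.

Lemma lexmax_nonempty i mu0 : Good smax mu0 -> exists mu, lexmax i mu.
Proof.
move=> h0; elim: i => [|i [mu hmu]]; first by exists mu0.
pose E := [set Ex mu (psi i) | mu in [set mu | lexmax i mu]].
have [M M0 hM] := dcont_bounded dm dc (@cpsi i).
have hs : has_sup E.
  split; first by exists (Ex mu (psi i)); exists mu.
  exists M => _ [mu' _ <-]; apply: le_trans (ler_norm _) _.
  by apply: Ex_abs_le => //; exact: (dcont_bmeas dm db dc).
have st n : exists mu', lexmax i mu' /\ sup E - n.+1%:R^-1 < Ex mu' (psi i).
  have [|_ [mu' h' <-] lc] := @sup_adherent _ _ (n.+1%:R^-1) _ hs; first by rewrite invr_gt0.
  by exists mu'.
pose mus n := sval (cid (st n)).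
have musP n : lexmax i (mus n) /\ sup E - n.+1%:R^-1 < Ex (mus n) (psi i) by rewrite /mus; case: cid.
have [s [hs' [mu' w]]] := weak_compact dm dc db mus.
have hge n : (n <= s n)%N by elim: n => // n IHn; apply: leq_ltn_trans IHn _; exact: hs'.
exists mu'; split; first by apply: lexmax_closed w => n; case: (musP (s n)).
move=> nu hnu; apply: (@le_trans _ _ (sup E)); first by apply: ub_le_sup; [exact: hs.2|exists nu].
apply/ler_addgt0Pr => e e0; rewrite -lerBlDr.
have cv := w _ (@cpsi i).
rewrite -(cvg_lim _ cv)//; apply: limr_ge; first by apply/cvg_ex; eexists; exact: cv.
exists (Num.bound e^-1) => // n /= ln; have [_ /ltW] := musP (s n); apply: le_trans.
rewrite lerD2l lerN2 invf_ple ?posrE//; apply: ltW; apply: (@lt_le_trans _ _ (Num.bound e^-1)%:R).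
  by rewrite archi_boundP// invr_ge0 ltW.
by rewrite ler_nat (leq_trans ln)// (leq_trans (hge n)).
Qed.

(** The conditions are closed and nested, so a weak limit of measures satisfying more and more of
    them satisfies all. *)
Lemma lexmax_all mu0 : Good smax mu0 -> exists mu, forall i, lexmax i mu.
Proof.
move=> h0; pose mus i := sval (cid (lexmax_nonempty i h0)).
have musP i : lexmax i (mus i) by rewrite /mus; case: cid.
have mono i j mu : (i <= j)%N -> lexmax j mu -> lexmax i mu.
  by elim: j => [|j IH]; [rewrite leqn0 => /eqP ->|rewrite leq_eqVlt => /predU1P[->//|ij] [/(IH ij)]].
have [s [hs [mu w]]] := weak_compact dm dc db mus.
have hge n : (n <= s n)%N by elim: n => // n IHn; apply: leq_ltn_trans IHn _; exact: hs.
(* After the shift by [i] every term of the sequence satisfies condition [i]. *)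
exists mu => i; apply: (@lexmax_closed i (fun n => mus (s (n + i)%N))).
  by move=> n; apply: mono (musP _); apply: leq_trans (hge _); exact: leq_addl.
move=> phi cphi; have h := w _ cphi; apply/cvgrPdist_lt => e e0.
move/cvgrPdist_lt : h => /(_ _ e0)[N _ NP]; exists N => // n /= Nn.
by apply: (NP (n + i)%N); exact: leq_trans Nn (leq_addr _ _).
Qed.

(** A proper convex combination attains a maximum only if both components do. Inductively both
    components attain every successive maximum and so have equal integrals. *)
Lemma lexmax_split i mu P1 P2 (lam : R) : 0 < lam < 1 -> (forall i, lexmax i mu) ->
  Good smax P1 -> Good smax P2 ->
  (forall phi, bmeas phi -> Ex mu phi = lam * Ex P1 phi + (1 - lam) * Ex P2 phi) ->
  lexmax i P1 /\ lexmax i P2 /\ (forall j, (j < i)%N -> Ex P1 (psi j) = Ex P2 (psi j)).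
Proof.
move=> /andP[l0 l1] hmu g1 g2 muE; elim: i => [//|i [h1 [h2 h3]]].
have bpsi := dcont_bmeas dm db dc (@cpsi i).
have [_ hm] := hmu i.+1; have e := muE _ bpsi.
have m1 := hm _ h1; have m2 := hm _ h2; have l1' : 0 < 1 - lam by rewrite subr_gt0.
have E1 : Ex P1 (psi i) = Ex mu (psi i).
  apply/eqP; rewrite eq_le m1/= leNgt; apply/negP => lt1.
  have : lam * Ex P1 (psi i) < lam * Ex mu (psi i) by rewrite ltr_pM2l.
  have : (1 - lam) * Ex P2 (psi i) <= (1 - lam) * Ex mu (psi i) by rewrite ler_pM2l.
  by move=> a b; lra.
have E2 : Ex P2 (psi i) = Ex mu (psi i).
  have : (1 - lam) * Ex P2 (psi i) = (1 - lam) * Ex mu (psi i) by move: e; rewrite E1 => e; lra.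
  by move/mulfI; apply; rewrite gt_eqF.
split; first by split => // mu' /hm; rewrite E1.
split; first by split => // mu' /hm; rewrite E2.
move=> j; rewrite ltnS leq_eqVlt => /predU1P[->|/h3//]; by rewrite E1 E2.
Qed.

End Lexicographic.

(** If an invariant [A] had measure strictly between 0 and 1, the conditional measures on [A] and on
    its complement would both lie in the maximal face, agree on the determining family and be equal;
    but only one of them charges [A]. *)
Lemma ergodic_Good (c : R) mu0 : Good c mu0 -> exists nu, G_ergodic act nu /\ Good c nu.
Proof.
move=> h0; have cs := Good_le_max dm dc db ga cphi0 eps0 h0.
have [mu1 g1] := maxGood_attained dm dc db ga cphi0 eps0 h0.
have [psi [cpsi det]] := determining_family dm dc db.
have [mu hmu] := lexmax_all cpsi g1.
have gmu : Good smax mu := hmu 0%N.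
exists mu; split; last exact: Good_le cs gmu.
have mi : G_invariant act mu by case: gmu.
split => // A mA Ainv; apply: contrapT => /not_orP[n0 n1].
have Ai g x : A (act g x) <-> A x by rewrite -[in X in _ <-> X](Ainv g).
have CAi g x : (~` A) (act g x) <-> (~` A) x by split => h k; apply: h; [exact: (Ai g x).2|exact: (Ai g x).1].
set lam := fm mu A.
have lam0 : 0 < lam.
  rewrite lt_neqAle fm_ge0 andbT; apply/eqP => e; apply: n0.
  by rewrite (fmE mu mA) -/lam -e.
have lam1 : lam < 1.
  rewrite lt_neqAle fm_le1// andbT; apply/eqP => e; apply: n1.
  by rewrite (fmE mu mA) -/lam e.
have mCA : measurable (~` A) by exact: measurableC.
have lamC : fm mu (~` A) = 1 - lam by rewrite fmC.
have l1 : 0 < 1 - lam by rewrite subr_gt0.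
have [P1 P1E] := cond_prob mA lam0.
have lC0 : 0 < fm mu (~` A) by rewrite lamC.
have [P2 P2E] := cond_prob mCA lC0.
have e1 B : measurable B -> fm mu (B `&` A) = lam * fm P1 B.
  by move=> mB; rewrite P1E// mulrC divfK// gt_eqF.
have e2 B : measurable B -> fm mu (B `&` ~` A) = (1 - lam) * fm P2 B.
  by move=> mB; rewrite P2E// lamC mulrC divfK// gt_eqF.
have inv P B0 : measurable B0 -> (forall g x, B0 (act g x) <-> B0 x) ->
    (forall B, measurable B -> fm P B = fm mu (B `&` B0) / fm mu B0) -> G_invariant act P.
  move=> mB0 B0i PE g B mB; have mgB := measurable_act db ga g mB.
  rewrite !fmE// !PE//; congr ((_ / _)%:E).
  have := mi g (B `&` B0) (measurableI _ _ mB mB0); rewrite /fm => <-.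
  by congr (fine (mu _)); apply/seteqP; split => x /= [Bx h]; split => //; apply/(B0i g x).
have i1 := inv P1 A mA Ai P1E; have i2 := inv P2 (~` A) mCA CAi P2E.
have muE phi : bmeas phi -> Ex mu phi = lam * Ex P1 phi + (1 - lam) * Ex P2 phi.
  move=> bphi; pose la (i : 'I_2) := if i == ord0 then lam else 1 - lam.
  pose nu (i : 'I_2) := if i == ord0 then P1 else P2.
  have s1 : \sum_i la i = 1 by rewrite big_ord_recl big_ord1 /la/= addrC subrK.
  have la0 i : 0 <= la i by rewrite /la; case: ifP => _; exact: ltW.
  rewrite (@Ex_mix _ _ _ mu 2 la nu phi s1 la0) //; first by rewrite big_ord_recl big_ord1.
  move=> B mB; rewrite big_ord_recl big_ord1 /la /nu/= !fmE// -!EFinM -EFinD -e1// -e2//.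
  by rewrite (fmID mu mB mA) setDE.
have lam01 : 0 < lam < 1 by rewrite lam0.
have g1' : Good smax P1.
  by apply: (Good_face dm dc db ga cphi0 eps0 FF Ginf gmu mA Ai e1 e2) => //; apply: muE; exact: (dcont_bmeas dm db dc).
have g2' : Good smax P2.
  apply: (@Good_face _ _ _ _ _ _ dm dc db ga _ cphi0 _ eps0 _ FF Ginf mu (~` A) P2 P1) => //.
  - by rewrite lamC.
  - by move=> B mB; rewrite setCK lamC opprB addrCA subrr addr0 e1.
  - by rewrite lamC l1 gtrBl.
  - rewrite lamC muE; last exact: (dcont_bmeas dm db dc).
    by rewrite opprB addrCA subrr addr0 addrC.
have eqP12 : P1 A = P2 A.
  apply: det => // i.
  by have [_ [_ h]] := lexmax_split cpsi i.+1 lam01 hmu g1' g2' muE; apply: h.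
have : fm P1 A = fm P2 A by rewrite /fm eqP12.
rewrite P1E// P2E// setIid divff ?gt_eqF// setICr fm0 mul0r => /eqP.
by rewrite oner_eq0.
Qed.

End ErgodicGood.

(** * Quasitilings of actions with stabilizers *)

Section Stabilizers.
Context {R : realType} {G : groupType} {disp : measure_display} {X : measurableType disp}.
Variable d : X -> X -> R.
Variable act : G -> X -> X.
Hypothesis dm : is_metric d.
Hypothesis dc : dcompact d.
Hypothesis db : borel_for_d d.
Hypothesis ga : G_action d act.
Local Notation name := (name act).
Local Notation mact := (measurable_act db ga).
Local Notation entr := (@entr_fun R).
Implicit Types (nu : probability X R) (A B : set X) (T : finType) (K : {fset G}).

Lemma dcont_dact g h : dcontinuous_real d (fun x => d (act g x) (act h x)).
Proof.
move=> x e e0; have e2 : 0 < e / 2 by rewrite divr_gt0.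
case: ga => _ [_ ca]; have [r r0 hr] := ca g x _ e2; have [s s0 hs] := ca h x _ e2.
exists (Num.min r s); first by rewrite lt_min r0.
move=> y; rewrite lt_min => /andP[/hr a1 /hs a2].
have b1 := dtri dm (act g x) (act g y) (act h x); have b2 := dtri dm (act g y) (act h y) (act h x).
have b3 := dtri dm (act g y) (act g x) (act h y); have b4 := dtri dm (act g x) (act h x) (act h y).
rewrite (dsym dm (act h y)) in b2; rewrite (dsym dm (act g y) (act g x)) in b3.
by rewrite ltr_norml; apply/andP; split; lra.
Qed.

Lemma measurable_act_eq g h : measurable [set x | act g x = act h x].
Proof.
rewrite (_ : mkset _ = ~` [set x | 0 < d (act g x) (act h x)]).
  apply: measurableC; apply: (dopen_measurable db); apply: dcont_open_gt; exact: dcont_dact.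
apply/seteqP; split => x /=; first by move=> ->; rewrite dxx ?ltxx.
move=> /negP; rewrite -leNgt => h0; apply: (d_eq0 dm); apply/eqP.
by rewrite eq_le h0 d_ge0.
Qed.

(** Stabilizers may be infinite, so they are inspected through finite windows. *)
Definition stabset K x : {fset G} := [fset g in K | act g x == x]%fset.

Lemma measurable_stabset K (P : {fset G} -> Prop) : measurable [set x | P (stabset K x)].
Proof.
pose b x := [ffun g : K => `[< act (fsval g) x = act 1%g x >]].
have mb : mlab b.
  apply: (mlab_ffun (Y := fun (g : K) x => `[< act (fsval g) x = act 1%g x >])) => g.
  by apply: mlab_asbool; exact: measurable_act_eq.
pose h (c : {ffun K -> bool}) : {fset G} := [fset fsval g | g : K & c g]%fset.
rewrite (_ : mkset _ = [set x | P (h (b x))]); first exact: (@mlab_pred _ _ _ b (fun c => P (h c))).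
have E x : stabset K x = h (b x).
  apply/fsetP => g; rewrite !inE /=; apply/andP/imfsetP => [[gK /eqP gx]|[k /=]].
    by exists [` gK]%fset => //=; rewrite inE ffunE; apply/asboolP; rewrite /= (act1 ga).
  rewrite inE ffunE => /asboolP; rewrite (act1 ga) => kx ->; split; first exact: fsvalP.
  by rewrite kx.
by apply/seteqP; split => x /=; rewrite E.
Qed.

Section Coincidences.

Variable nu : probability X R.
Hypothesis ni : G_invariant act nu.
Variable K Kt : {fset G}.
Variables (m : nat) (eta : R).
Hypothesis m0 : (0 < m)%N.
Hypothesis Kfix : 1 - eta <= fm nu [set x | (m <= #|` stabset K x|)%N].
Let bad : {fset G} := [fset g in Kt | ~~ all (fun k => (g * k)%g \in Kt) K]%fset.
Hypothesis Kt_bad : #|` bad|%:R <= eta * #|` Kt|%:R :> R.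

Let pat x : {ffun Kt * Kt -> bool} :=
  [ffun p => `[< act (fsval p.1) x = act (fsval p.2) x >]].
Let mpat : mlab pat.
Proof.
apply: (mlab_ffun (Y := fun (p : Kt * Kt) x => `[< act (fsval p.1) x = act (fsval p.2) x >])) => p.
by apply: mlab_asbool; exact: measurable_act_eq.
Qed.
Let E p : set X := pat @^-1` [set p].
Let mE p : measurable (E p). Proof. exact: mpat. Qed.

Let patP x y g h : E (pat x) y -> g \in Kt -> h \in Kt -> act g x = act h x -> act g y = act h y.
Proof.
move=> /ffunP h1 gK hK e; have := h1 ([` gK]%fset, [` hK]%fset); rewrite !ffunE /=.
by case: asboolP => // _ /esym /asboolP; rewrite /= => n; case: n.
Qed.

Variables (T : finType) (Y : X -> T).
Hypothesis mY : mlab Y.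
Let lT : R := ln (#|T|%:R).
Let lT0 : 0 <= lT.
Proof. by apply: ln_ge0; rewrite ler1n; apply/card_gt0P; exists (Y point). Qed.

Let v a p g : R := HE nu (E p) (fun x => Y (act (a * g)%g x)).
Let v_ge0 a p g : 0 <= v a p g.
Proof. by apply: HE_ge0 => //; exact: (mlab_act mact). Qed.
Let v_le a p g : v a p g <= fm nu (E p) * lT.
Proof. by apply: HE_le_ln => //; exact: (mlab_act mact). Qed.

Let fine p := `[< exists x, E p x /\ (m <= #|` stabset K x|)%N >].

(** Elements of [Kt] that act alike at one point of [E p] act alike on all of it, so one letter per
    class suffices, also after translation by [a]. If the cell contains a point [x0] with [m]
    stabilizing elements [k] in [K], the class of a [g] outside [bad] contains the elements [g k],
    and its letter is shared by at least [m] elements; smaller classes consist of [bad] elements. On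
    the other cells the trivial bound is used. *)
Let HE_pattern a p : HE nu (E p) (name Y (lmul_fset a Kt)) <=
  (m%:R)^-1 * (\sum_(g <- Kt) v a p g) + #|` bad|%:R * (fm nu (E p) * lT) +
  (~~ fine p)%:R * (#|` Kt|%:R * (fm nu (E p) * lT)).
Proof.
have minv : 0 <= (m%:R : R)^-1 by rewrite invr_ge0.
have s0 : 0 <= \sum_(g <- Kt) v a p g by apply: sumr_ge0.
have b0 : 0 <= #|` bad|%:R * (fm nu (E p) * lT) by rewrite !mulr_ge0// fm_ge0.
have trivial_ : HE nu (E p) (name Y (lmul_fset a Kt)) <= \sum_(g <- Kt) v a p g.
  apply: (@le_trans _ _ (\sum_(g <- lmul_fset a Kt) HE nu (E p) (fun x => Y (act g x)))).
    by apply: (HE_name_le_sum mact) => //; exact: mE.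
  rewrite /lmul_fset big_imfset//=; by move=> g h _ _; exact: mulgI.
case: (boolP (fine p)) => [/asboolP[x0 [Ex0 mx0]]|nf]; last first.
  rewrite mul1r (le_trans trivial_)// -[leLHS]add0r lerD//; first by rewrite addr_ge0// mulr_ge0.
  apply: (@le_trans _ _ (\sum_(g <- Kt) (fm nu (E p) * lT))); first by apply: ler_sum => g _; exact: v_le.
  by rewrite big_const_seq count_predT iter_addr_0 -[_ *+ size _]mulr_natl.
rewrite mul0r addr0.
have pE : E (pat x0) = E p by rewrite -[in RHS](Ex0 : pat x0 = p).
pose P0 : {fset X} := [fset act g x0 | g in Kt]%fset.
pose R0 y := nth 1%g (Kt : seq G) (find (fun g => act g x0 == y) Kt).
have R0P y : y \in P0 -> R0 y \in Kt /\ act (R0 y) x0 = y.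
  move=> /imfsetP[g /= gK yg].
  have hs : has (fun g => act g x0 == y) Kt by apply/hasP; exists g => //; rewrite yg.
  by split; [apply: mem_nth; rewrite -has_find|apply/eqP; exact: (nth_find 1%g hs)].
have same g h : g \in Kt -> h \in Kt -> act g x0 = act h x0 -> v a p g = v a p h.
  move=> gK hK e; apply: HE_deteq => //; try exact: (mlab_act mact).
  move=> x y; rewrite -pE => Ex Ey; rewrite !(actM ga).
  by rewrite (patP Ex gK hK e) (patP Ey gK hK e).
pose V y := v a p (R0 y).
have V0 y : 0 <= V y by exact: v_ge0.
have le1 : HE nu (E p) (name Y (lmul_fset a Kt)) <= \sum_(y <- P0) V y.
  pose S y := [fset (a * R0 y)%g]%fset.
  apply: (@le_trans _ _ (HE nu (E p) (name Y [fset (a * R0 y)%g | y in P0]%fset))).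
    apply: HE_det => //; try exact: (mlab_name mact).
    move=> x y Ex Ey /nameP h; apply/nameP => _ /imfsetP[g /= gK ->].
    have yP : act g x0 \in P0 by apply/imfsetP; exists g.
    have [rK rx] := R0P _ yP; rewrite -pE in Ex Ey.
    rewrite !(actM ga) (patP Ex gK rK (esym rx)) (patP Ey gK rK (esym rx)) -!(actM ga).
    by apply: h; apply/imfsetP; exists (act g x0).
  rewrite -[leLHS]mul1r.
  have -> : \sum_(y <- P0) V y = \sum_(y <- P0) HE nu (E p) (name Y (S y)).
    by apply: eq_bigr => y _; rewrite (HE_name1 mact).
  apply: (@HE_name_shearer _ _ _ _ _ mact nu (E p) T Y X P0 S _ 1 (mE p) mY) => g /imfsetP[y /= yP ->].
  by rewrite -has_count; apply/hasP; exists y => //; rewrite inE.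
pose n y := count (fun g => act g x0 == y) Kt.
have n0 y : y \in P0 -> (0 < n y)%N.
  by move=> /imfsetP[g /= gK ->]; rewrite -has_count; apply/hasP; exists g => //; rewrite eqxx.
have sumK (f : G -> R) : \sum_(g <- Kt) f g = \sum_(y <- P0) \sum_(g <- Kt | act g x0 == y) f g.
  rewrite (exchange_big_dep predT)//= big_seq [RHS]big_seq; apply: eq_bigr => g gK.
  rewrite (big_rem (act g x0))/=; last by apply/imfsetP; exists g.
  rewrite eqxx big_seq_cond big1 ?addr0// => y /andP[+ /eqP e].
  by rewrite mem_rem_uniq ?fset_uniq// inE e eqxx.
have sumV y : y \in P0 -> \sum_(g <- Kt | act g x0 == y) v a p g = (n y)%:R * V y.
  move=> yP; have [rK rx] := R0P y yP; rewrite big_seq_cond.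
  rewrite (eq_bigr (fun=> V y)); last first.
    by move=> g /andP[gK /eqP e]; apply: same => //; rewrite rx.
  by rewrite -big_seq_cond big_const_seq iter_addr_0 mulr_natl.
apply: (le_trans le1).
have badE g : g \in Kt -> (n (act g x0) < m)%N -> g \in bad.
  move=> gK; rewrite ltnNge => /negP nm; rewrite !inE gK /=; apply/negP => /allP al.
  apply: nm; apply: (leq_trans mx0); rewrite -(card_lmul (stabset K x0) g) /n -size_filter.
  apply: uniq_leq_size; first exact: fset_uniq.
  move=> h /imfsetP[k /=]; rewrite !inE => /andP[kK /eqP kx] ->.
  by rewrite mem_filter (actM ga) kx eqxx /=; exact: al.
apply: (@le_trans _ _ (\sum_(y <- P0) (m%:R^-1 * \sum_(g <- Kt | act g x0 == y) v a p g +
    \sum_(g <- Kt | act g x0 == y) (g \in bad)%:R * (fm nu (E p) * lT)))).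
  rewrite big_seq [leRHS]big_seq; apply: ler_sum => y yP; rewrite sumV//.
  case: (leqP m (n y)) => nm.
    apply: (@le_trans _ _ (m%:R^-1 * ((n y)%:R * V y))).
      by rewrite mulrA -[leLHS]mul1r ler_wpM2r// mulrC ler_pdivlMr ?ltr0n// mul1r ler_nat.
    by rewrite lerDl sumr_ge0// => g _; rewrite !mulr_ge0// fm_ge0.
  apply: (@le_trans _ _ (\sum_(g <- Kt | act g x0 == y) (g \in bad)%:R * (fm nu (E p) * lT))); last first.
    by rewrite lerDr !mulr_ge0.
  rewrite big_seq_cond (eq_bigr (fun=> fm nu (E p) * lT)); last first.
    by move=> g /andP[gK /eqP e]; rewrite badE ?mul1r// e.
  rewrite -big_seq_cond big_const_seq iter_addr_0 -/(n y).
  apply: (le_trans (v_le _ _ _)); rewrite -[leRHS]mulr_natr ler_peMr ?mulr_ge0 ?fm_ge0//.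
  by rewrite ler1n n0.
rewrite big_split/= -mulr_sumr -!sumK lerD2l -mulr_suml ler_wpM2r ?mulr_ge0 ?fm_ge0//.
rewrite -natr_sum ler_nat -[leqRHS]sum1_size [leqRHS]big_seq.
rewrite (eq_bigr (fun g => if g \in bad then 1 else 0)%N); last by move=> g _; case: (g \in bad).
rewrite -big_mkcond/= -[leqRHS]big_seq -big_filter !sum1_size.
apply: uniq_leq_size; first by rewrite filter_uniq ?fset_uniq.
by move=> g; rewrite mem_filter => /andP[].
Qed.

(** Summed over the patterns, the conditional entropies of a letter are at most its entropy, and the
    cells that are not [fine] have total mass at most [eta]. *)
Let HE_translate a : \sum_p HE nu (E p) (name Y (lmul_fset a Kt)) <=
  #|` Kt|%:R * (HE nu setT Y / m%:R + 2 * eta * lT).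
Proof.
apply: (le_trans (ler_sum _ (fun p _ => HE_pattern a p))).
rewrite !big_split/= -!mulr_sumr.
have fE : \sum_p fm nu (E p) = 1.
  rewrite -(fmT nu) -(fm_partition nu measurableT mpat).
  by apply: eq_bigr => p _; rewrite setTI.
have nfE : \sum_p (~~ fine p)%:R * fm nu (E p) <= eta.
  pose B := [set x | ~ (m <= #|` stabset K x|)%N].
  have mB : measurable B by exact: (measurable_stabset K (fun S => ~ (m <= #|` S|)%N)).
  have BE : fm nu B <= eta.
    rewrite (_ : B = ~` [set x | (m <= #|` stabset K x|)%N]) ?fmC//.
      by rewrite lerBlDr -lerBlDl.
    exact: (measurable_stabset K (fun S => (m <= #|` S|)%N)).
  apply: le_trans BE; rewrite -(fm_partition nu mB mpat); apply: ler_sum => p _.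
  case: (boolP (fine p)) => [_|/asboolPn nf]; first by rewrite mul0r fm_ge0.
  rewrite mul1r; apply: fm_le => //; first exact: measurableI.
  by move=> x Ex; split => // mx; apply: nf; exists x.
have sv : \sum_p \sum_(g <- Kt) v a p g <= #|` Kt|%:R * HE nu setT Y.
  rewrite exchange_big/= ; apply: (@le_trans _ _ (\sum_(g <- Kt) HE nu setT Y)).
    apply: ler_sum => g _; rewrite -(HE_act ni (a * g)%g mY).
    have := @sum_HE_fibre_le _ _ _ nu setT T _ (fun x => Y (act (a * g)%g x)) pat measurableT (mlab_act mact _ mY) mpat.
    by apply: le_trans; apply: ler_sum => p _; rewrite setTI.
  by rewrite big_const_seq count_predT iter_addr_0 -[_ *+ size _]mulr_natl.
have mp : 0 < (m%:R : R)^-1 by rewrite invr_gt0 ltr0n.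
have h1 : m%:R^-1 * (\sum_p \sum_(g <- Kt) v a p g) <= #|` Kt|%:R * (HE nu setT Y / m%:R).
  by rewrite mulrA [leRHS]mulrC ler_pM2l.
have h2 : #|` bad|%:R * (\sum_p fm nu (E p) * lT) <= #|` Kt|%:R * (eta * lT).
  by rewrite -mulr_suml fE mul1r mulrA ler_wpM2r// mulrC.
have h3 : \sum_p (~~ fine p)%:R * (#|` Kt|%:R * (fm nu (E p) * lT)) <= #|` Kt|%:R * (eta * lT).
  rewrite (_ : \sum_p _ = #|` Kt|%:R * ((\sum_p (~~ fine p)%:R * fm nu (E p)) * lT)).
    by rewrite ler_wpM2l// ler_wpM2r.
  by rewrite mulr_suml mulr_sumr; apply: eq_bigr => p _; ring.
apply: (le_trans (lerD (lerD h1 h2) h3)).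
by rewrite le_eqVlt; apply/orP; left; apply/eqP; ring.
Qed.

(* Along a window made of many disjoint translates [a Kt], the coincidence pattern on
   [Kt] holds for all translates and is paid for once; given it, the letters of a name
   are constant on classes of at least [m] elements. *)
Lemma hrate_coincidences (e : R) : 0 < e -> (0 < #|` Kt|)%N ->
  (exists e : nat -> G, injective e) ->
  hrate act nu Y <= HE nu setT Y / m%:R + 2 * eta * lT + e.
Proof.
move=> e0 Kt0 Ginf.
(* The entropy of the pattern is paid once for [L] translates, so its share per translate is at most
   [e]. *)
have [L [L0 LP]] : exists L, (0 < L)%N /\ HE nu setT pat <= e * L%:R.
  exists (Num.bound (HE nu setT pat / e)).+1; split => //.
  rewrite mulrC -ler_pdivrMr//; apply: ltW; apply: (@lt_trans _ _ (Num.bound (HE nu setT pat / e))%:R).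
    by rewrite archi_boundP// divr_ge0 ?HE_ge0// ltW.
  by rewrite ltr_nat.
have [A [AL AK]] := disjoint_translates Ginf Kt L.
have F0 : fmul A Kt != fset0 by rewrite -cardfs_gt0 AK muln_gt0 L0.
apply: (le_trans (hrate_le mact nu mY F0)); rewrite AK natrM.
rewrite ler_pdivrMr ?mulr_gt0 ?ltr0n//.
have mn S : mlab (name Y S) by exact: (mlab_name mact).
apply: (@le_trans _ _ (HE nu setT (fun x => (name Y (fmul A Kt) x, pat x)))).
  by apply: HE_det => //; [exact: mlab_pair|move=> x y _ _ []].
have := @sum_HE_fibre _ _ _ nu setT _ _ (name Y (fmul A Kt)) pat measurableT (mn _) mpat.
move=> /eqP; rewrite eq_sym subr_eq => /eqP ->.
apply: (@le_trans _ _ (\sum_(a <- A) #|` Kt|%:R * (HE nu setT Y / m%:R + 2 * eta * lT) + e * L%:R)).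
  apply: lerD => //.
  apply: (@le_trans _ _ (\sum_p \sum_(a <- A) HE nu (E p) (name Y (lmul_fset a Kt)))).
    apply: ler_sum => p _; rewrite setTI -[leLHS]mul1r.
    apply: (@HE_name_shearer _ _ _ _ _ mact nu (E p) T Y G A (fun a => lmul_fset a Kt) _ 1 (mE p) mY) => g.
    move=> /fmulP[a [b [aA bK ->]]]; rewrite -has_count; apply/hasP; exists a => //.
    by rewrite mem_lmul mulKg.
  by rewrite exchange_big/=; apply: ler_sum => a _; exact: HE_translate.
rewrite big_const_seq count_predT iter_addr_0 -[_ *+ size _]mulr_natl.
have -> : size A = L by rewrite -AL.
have Kt1 : 1 <= (#|` Kt|%:R : R) by rewrite ler1n.
set q := HE nu setT Y / _ + _; set k := (#|` Kt|%:R : R) in Kt1 *.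
have -> : (q + e) * (L%:R * k) = L%:R * (k * q) + e * L%:R * k by ring.
by rewrite lerD2l ler_peMr// mulr_ge0// ltW.
Qed.

End Coincidences.
End Stabilizers.

Lemma sub_in_count (I : eqType) (a b : pred I) (s : seq I) :
  {in s, forall x, a x -> b x} -> (count a s <= count b s)%N.
Proof.
move=> h; rewrite (eq_in_count (a2 := predI a b)) => [|x xs /=].
  by apply: sub_count => x /andP[].
by case E : (a x) => //=; rewrite h.
Qed.

(** * Greedy tilings with one shape, and their iteration *)

Section Tiling.
Context {R : realType} {G : groupType} {disp : measure_display} {X : measurableType disp}.
Variable d : X -> X -> R.
Variable act : G -> X -> X.
Hypothesis dm : is_metric d.
Hypothesis dc : dcompact d.
Hypothesis db : borel_for_d d.
Hypothesis ga : G_action d act.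
Local Notation mact := (measurable_act db ga).
Implicit Types (A B C : set X) (T : {fset G}).
Variable nu : probability X R.
Hypothesis ni : G_invariant act nu.

(* A pair [(T, B)] encodes the family of tiles [T x], [x] in [B]. *)
Definition tcov (p : {fset G} * set X) : set X :=
  [set y | exists2 t, t \in p.1 & p.2 (act t^-1%g y)].
Definition cov (st : seq ({fset G} * set X)) : set X := foldr (fun p C => tcov p `|` C) set0 st.
(** Tiles count with multiplicity: where stabilizers have [m] elements, a tile meeting a point
    typically does so [m] times, so the value aimed at is [m] and not 1. *)
Definition mass (st : seq ({fset G} * set X)) : R := \sum_(p <- st) #|` p.1|%:R * fm nu p.2.
Definition mtiles (st : seq ({fset G} * set X)) := forall p, List.In p st -> measurable p.2.

Lemma fm_act g A : measurable A -> fm nu (act g @^-1` A) = fm nu A.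
Proof. by move=> mA; rewrite /fm ni. Qed.

Lemma tcovE p : tcov p = \big[setU/set0]_(t <- p.1) (act t^-1%g @^-1` p.2).
Proof.
rewrite -bigcup_seq; apply/seteqP; split => y.
  by move=> [t tT Bt]; exists t.
by move=> [t tT Bt]; exists t.
Qed.

Lemma measurable_tcov p : measurable p.2 -> measurable (tcov p).
Proof. by move=> mB; rewrite tcovE; apply: bigsetU_measurable => t _; exact: mact. Qed.

Lemma fm_tcov_le p : measurable p.2 -> fm nu (tcov p) <= #|` p.1|%:R * fm nu p.2.
Proof.
move=> mB; rewrite tcovE; apply: (le_trans (fm_bigU_le _ _ _)) => [t|]; first exact: mact.
under eq_bigr do rewrite fm_act//.
by rewrite big_const_seq count_predT iter_addr_0 -[_ *+ size _]mulr_natl.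
Qed.

Lemma measurable_cov st : mtiles st -> measurable (cov st).
Proof.
elim: st => //= p st IH h; apply: measurableU; first by apply: measurable_tcov; apply: h; left.
by apply: IH => q qs; apply: h; right.
Qed.

Lemma fm_cov_le st : mtiles st -> fm nu (cov st) <= mass st.
Proof.
elim: st => [|p st IH] h; first by rewrite /mass big_nil /= fm0.
have h1 : measurable p.2 by apply: h; left.
have h2 : mtiles st by move=> q qs; apply: h; right.
rewrite /mass big_cons /=; apply: (le_trans (fmU_le _ _ _)).
- exact: measurable_tcov.
- exact: measurable_cov.
by rewrite lerD ?fm_tcov_le//; exact: IH.
Qed.

Lemma covP st y : cov st y <-> exists p, List.In p st /\ tcov p y.
Proof.
elim: st => [|p st IH] /=; first by split => // -[p []].
split => [[h|/IH[q [qs h]]]|[q [[<-|qs] h]]].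
- by exists p; split => //; left.
- by exists q; split => //; right.
- by left.
- by right; apply/IH; exists q.
Qed.

Variables (m : nat) (theta : R).
Hypothesis theta0 : 0 < theta.
Hypothesis theta1 : theta < 1.
Hypothesis stab : forall K, fm nu [set x | (m < #|` stabset act K x|)%N] = 0.

Section Step.
Variable T : {fset G}.
Hypothesis T0 : T != fset0.
Let Tp : 0 < (#|` T|%:R : R). Proof. by rewrite ltr0n cardfs_gt0. Qed.

(** Tiles [T x] and [T x'] meet only if [x' = u x] with [u] in [T^-1 T]. On this set such points are
    equal or at least [r] apart, so base points sharing a label of diameter below [r] have
    overlapping tiles only through stabilizers. *)
Definition spread (r : R) : set X :=
  [set x | forall u, u \in fmul (fsinv T) T -> act u x = x \/ r <= d x (act u x)].

Lemma measurable_spread r : measurable (spread r).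
Proof.
pose U := fmul (fsinv T) T.
pose b x := [ffun u : U => (`[< act (fsval u) x = act 1%g x >], `[< r <= d (act 1%g x) (act (fsval u) x) >])].
have mb : mlab b.
  apply: (mlab_ffun (Y := fun (u : U) x => (`[< act (fsval u) x = act 1%g x >], `[< r <= d (act 1%g x) (act (fsval u) x) >]))) => u.
  apply: mlab_pair; apply: mlab_asbool; first exact: (measurable_act_eq dm db ga).
  rewrite (_ : (fun _ => _) = ~` [set x | d (act 1%g x) (act (fsval u) x) < r]).
    apply: measurableC; apply: (dopen_measurable db); apply: dcont_open_lt; exact: dcont_dact.
  by apply/seteqP; split => x /=; rewrite leNgt; move/negP.
rewrite (_ : spread r = [set x | forall u : U, (b x u).1 || (b x u).2]).
  exact: (@mlab_pred _ _ _ b (fun c => forall u : U, (c u).1 || (c u).2)).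
apply/seteqP; split => x h.
  move=> u; rewrite ffunE /=; apply/orP.
  by have [e|e] := h (fsval u) (fsvalP u); [left|right]; apply/asboolP; rewrite (act1 ga).
move=> u uU; have := h [` uU]%fset; rewrite ffunE /= => /orP[] /asboolP; rewrite (act1 ga).
  by left.
by right.
Qed.

(** Finitely many [u] occur, so every point belongs to [spread r] once [r] is small enough. *)
Lemma spread_large (eta : R) : 0 < eta -> exists2 r : R, 0 < r & 1 - eta <= fm nu (spread r).
Proof.
move=> eta0; pose V n := spread (n.+1%:R^-1).
have mV n : measurable (V n) by exact: measurable_spread.
have ndV : nondecreasing_seq V.
  move=> n k nk; apply/subsetPset => x h u /h[e|e]; [by left|right]; apply: le_trans e.
  by rewrite lef_pV2 ?posrE// ler_nat.
have UV : \bigcup_n V n = setT.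
  apply/seteqP; split => // x _.
  pose rad u : R := if pselect (act u x = x) then 1 else d x (act u x).
  have rad0 u : 0 < rad u.
    rewrite /rad; case: pselect => // h; rewrite lt_neqAle (d_ge0 dm) andbT.
    by apply/eqP => /esym/(d_eq0 dm) e; apply: h.
  have [r r0 hr] := seq_pos_min (fmul (fsinv T) T) rad0.
  exists (Num.bound r^-1) => // u uU; case: (pselect (act u x = x)) => h; [by left|right].
  have radE : rad u = d x (act u x) by rewrite /rad; case: pselect.
  rewrite -radE; apply: le_trans (hr u uU).
  rewrite invf_ple ?posrE//; apply: ltW; apply: (@lt_trans _ _ (Num.bound r^-1)%:R).
    by rewrite archi_boundP// invr_ge0 ltW.
  by rewrite ltr_nat.
have := @fm_cvg_up _ _ _ nu _ mV ndV; rewrite UV fmT => /cvgrPdist_lt/(_ _ eta0)[n _ /(_ n (leqnn n)) hn].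
exists (n.+1%:R^-1); first by rewrite invr_gt0.
by move: hn; rewrite ltr_norml => /andP[_]; rewrite /V; lra.
Qed.

Let hits C x := count (fun t => `[< C (act t x) >]) T.

Let hits_le C C' x : C `<=` C' -> (hits C x <= hits C' x)%N.
Proof. by move=> CC; apply: sub_count => t /asboolP h; apply/asboolP; exact: CC. Qed.

Let mhits C (P : nat -> Prop) : measurable C -> measurable [set x | P (hits C x)].
Proof.
move=> mC; pose b x := [ffun t : T => `[< C (act (fsval t) x) >]].
have mb : mlab b.
  apply: (mlab_ffun (Y := fun (t : T) x => `[< C (act (fsval t) x) >])) => t.
  by apply: mlab_asbool; exact: mact.
pose h (c : {ffun T -> bool}) := count (fun t : G => if insub t is Some u then c u else false) T.
rewrite (_ : mkset _ = [set x | P (h (b x))]); first exact: (@mlab_pred _ _ _ b (fun c => P (h c))).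
have E x : hits C x = h (b x).
  rewrite /hits /h; apply: eq_in_count => t tT.
  by rewrite insubT ffunE.
by apply/seteqP; split => x /=; rewrite E.
Qed.

(** A new base point brings at least [(1 - theta) #|T|] uncovered positions. Conversely almost every
    newly covered [y] is reached from [N] by at most [m] elements of [T]: if [t] and [t0] both reach
    it, the two base points have the same label and hence coincide, so [t t0^-1] fixes [y]. Double
    counting compares the two. *)
Let add_points r (J : finType) (Y : X -> J) C j : (forall x y, Y x = Y y -> d x y < r) -> mlab Y ->
  measurable C ->
  let N := [set x | spread r x /\ Y x = j /\ (hits C x)%:R <= theta * #|` T|%:R] in
  measurable N /\
  (1 - theta) * #|` T|%:R * fm nu N <= m%:R * (fm nu (C `|` tcov (T, N)) - fm nu C).
Proof.
move=> hY mY mC N.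
have mN : measurable N.
  rewrite (_ : N = spread r `&` (Y @^-1` [set j] `&` [set x | (hits C x)%:R <= theta * #|` T|%:R])).
    apply: measurableI; first exact: measurable_spread.
    by apply: measurableI => //; exact: (mhits (fun k => k%:R <= theta * #|` T|%:R) mC).
  by apply/seteqP; split => x.
split => //; set C1 := C `|` tcov (T, N).
have mC1 : measurable C1 by apply: measurableU => //; exact: measurable_tcov.
have mCC : measurable (C1 `\` C) by exact: measurableD.
have -> : fm nu C1 - fm nu C = fm nu (C1 `\` C).
  rewrite (fmID nu mC1 mC) (_ : C1 `&` C = C); first by rewrite addrC addKr.
  by apply/seteqP; split => x; [case|move=> Cx; split => //; left].
pose U t := [set x | (~` C) (act t x)].
have mU t : measurable (U t) by apply: mact; exact: measurableC.
have h1 : (1 - theta) * #|` T|%:R * fm nu N <= \sum_(t <- T) fm nu (U t `&` N).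
  apply: count_fm_ge => // x [_ [_ hx]].
  have : (hits C x + count (fun t => x \in U t) T)%N = #|` T|.
    rewrite -(count_predC (fun t => `[< C (act t x) >])); congr addn; apply: eq_count => t /=.
    by apply/idP/idP; rewrite inE => /asboolPn.
  move=> /(congr1 (fun k => k%:R : R)); rewrite natrD => e.
  by rewrite mulrBl mul1r; lra.
apply: (le_trans h1).
pose U' t := [set y | N (act t^-1%g y)].
have mU' t : measurable (U' t) by exact: mact.
have eqU t : t \in T -> fm nu (U t `&` N) = fm nu (U' t `&` (C1 `\` C)).
  move=> tT; rewrite -(fm_act t (measurableI _ _ (mU' t) mCC)); congr fm.
  apply/seteqP; split => x /=.
    move=> [nC Nx]; rewrite /U' /= (actK ga); split => //; split => //; right.
    by exists t => //=; rewrite (actK ga).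
  by move=> [+ [_ nC]]; rewrite /U' /= (actK ga) => Nx; split.
rewrite big_seq (eq_bigr _ eqU) -big_seq.
pose K := fmul T (fsinv T).
pose Exc := [set x | (m < #|` stabset act K x|)%N].
have mExc : measurable Exc by exact: (measurable_stabset dm db ga K (fun S => (m < #|` S|)%N)).
have le2 : \sum_(t <- T) fm nu (U' t `&` (C1 `\` C)) <= \sum_(t <- T) fm nu (U' t `&` ((C1 `\` C) `\` Exc)).
  apply: ler_sum => t _; rewrite (fmID nu (measurableI _ _ (mU' t) mCC) mExc).
  rewrite -[leRHS]add0r lerD//.
    rewrite -(stab K); apply: fm_le => //.
    by apply: measurableI => //; apply: measurableI.
  rewrite (_ : _ `\` Exc = U' t `&` ((C1 `\` C) `\` Exc))//.
  by apply/seteqP; split => x /=; tauto.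
apply: (le_trans le2).
apply: (@le_trans _ _ (m%:R * fm nu ((C1 `\` C) `\` Exc))); last first.
  by rewrite ler_wpM2l// fm_le//; exact: measurableD.
apply: count_fm_le => //; first exact: measurableD.
move=> y [_ nE]; rewrite ler_nat.
have [h0|] := posnP (count (fun t => y \in U' t) T); first by rewrite h0.
rewrite -has_count => /hasP[t0 t0T]; rewrite inE => N0.
apply: (@leq_trans #|` stabset act K y|); last by rewrite leqNgt; apply/negP.
rewrite -size_filter -(size_map (fun t => (t * t0^-1)%g)).
apply: uniq_leq_size.
  by rewrite map_inj_uniq ?filter_uniq ?fset_uniq//; exact: mulIg.
move=> _ /mapP[t + ->]; rewrite mem_filter => /andP[Nt tT].
rewrite !inE /=; apply/andP; split.
  by apply: mem_fmul => //; rewrite mem_fsinv invgK.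
have [s0 [Y0 _]] := N0; have [s1 [Y1 _]] := set_mem Nt.
have uU : (t^-1 * t0)%g \in fmul (fsinv T) T.
  by apply: mem_fmul => //; rewrite mem_fsinv invgK.
have ux : act (t^-1 * t0)%g (act t0^-1%g y) = act t^-1%g y by rewrite (actM ga) (actKV ga).
have [e|far] := s0 _ uU.
  by rewrite (actM ga) -e ux (actKV ga).
move: far; rewrite ux leNgt => /negP; case; apply: hY; by rewrite Y0 Y1.
Qed.

Let greedy r (J : finType) (Y : X -> J) (l : seq J) C : (forall x y, Y x = Y y -> d x y < r) -> mlab Y ->
  measurable C -> exists B, [/\ measurable B,
   (1 - theta) * #|` T|%:R * fm nu B <= m%:R * (fm nu (C `|` tcov (T, B)) - fm nu C) &
   forall x, spread r x -> Y x \in l -> theta * #|` T|%:R <= (hits (C `|` tcov (T, B)) x)%:R].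
Proof.
move=> hY mY; elim: l C => [|j l IH] C mC.
  exists set0; split => //; rewrite fm0 mulr0 (_ : tcov (T, set0) = set0) ?setU0 ?subrr ?mulr0//.
  by apply/seteqP; split => x // [].
have [] := @add_points r J Y C j hY mY mC; set N := [set x | _] => mN hN.
have mC1 : measurable (C `|` tcov (T, N)) by apply: measurableU => //; exact: measurable_tcov.
have [B1 [mB1 h1 h2]] := IH _ mC1.
exists (N `|` B1).
have cE : C `|` tcov (T, N `|` B1) = (C `|` tcov (T, N)) `|` tcov (T, B1).
  rewrite -setUA; congr setU; apply/seteqP; split => y.
    by move=> [t tT [Nt|Bt]]; [left|right]; exists t.
  by move=> [[t tT Nt]|[t tT Bt]]; exists t => //; [left|right].
split; first exact: measurableU.
  rewrite cE; apply: (@le_trans _ _ ((1 - theta) * #|` T|%:R * (fm nu N + fm nu B1))).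
    rewrite ler_wpM2l ?fmU_le// mulr_ge0// subr_ge0 ltW//.
  rewrite mulrDr; apply: (le_trans (lerD hN h1)).
  by rewrite -mulrDr ler_wpM2l//; lra.
move=> x sx; rewrite inE cE => /predU1P[Yj|]; last exact: h2.
case: (leP (hits C x)%:R (theta * #|` T|%:R)) => hx.
  have Nx : N x by [].
  apply: (@le_trans _ _ (#|` T|%:R)); first by rewrite ger_pMl// ltW.
  rewrite ler_nat /hits -count_predT; apply: sub_in_count => t tT _.
  by apply/asboolP; left; right; exists t => //=; rewrite (actK ga).
apply: ltW; apply: (lt_le_trans hx); rewrite ler_nat; apply: hits_le.
by move=> y Cy; left; left.
Qed.

(** After the greedy pass over all labels, every point of [spread r] has a proportion [theta] of its
    tile covered. If the tile avoided [C] before, this part is new, and by invariance a sum over [t]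
    turns it into newly covered mass. *)
Lemma tiling_step C (eta : R) : measurable C -> 0 < eta ->
  exists B, [/\ measurable B,
   (1 - theta) * #|` T|%:R * fm nu B <= m%:R * (fm nu (C `|` tcov (T, B)) - fm nu C) &
   theta * (fm nu [set x | forall t, t \in T -> ~ C (act t x)] - eta) <=
     fm nu (C `|` tcov (T, B)) - fm nu C].
Proof.
move=> mC eta0; have [r r0 hr] := spread_large eta0.
have [J [Y [mY hY]]] := fine_label_exists dm dc db r0.
have hY' x y : Y x = Y y -> d x y < r by move=> /hY h; apply: (le_lt_trans h); lra.
have [B [mB h1 h2]] := @greedy r J Y (enum J) C hY' mY mC.
exists B; split => //.
set C1 := C `|` tcov (T, B) in h1 h2 *.
have mC1 : measurable C1 by apply: measurableU => //; exact: measurable_tcov.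
have mCC : measurable (C1 `\` C) by exact: measurableD.
have -> : fm nu C1 - fm nu C = fm nu (C1 `\` C).
  rewrite (fmID nu mC1 mC) (_ : C1 `&` C = C); first by rewrite addrC addKr.
  by apply/seteqP; split => x; [case|move=> Cx; split => //; left].
set D := [set x | forall t, t \in T -> ~ C (act t x)].
have mD : measurable D.
  rewrite (_ : D = [set x | hits C x = 0%N]); first exact: (mhits (fun k => k = 0%N) mC).
  apply/seteqP; split => x /=.
    move=> h; apply/eqP; rewrite eqn0Ngt -has_count; apply/hasPn => t tT; apply/asboolP; exact: h.
  by move=> /eqP; rewrite eqn0Ngt -has_count => /hasPn h t tT; have /asboolP := h t tT.
have ms := measurable_spread r.
have mU t : measurable [set x | (C1 `\` C) (act t x)] by exact: mact.
have key : theta * #|` T|%:R * fm nu (spread r `&` D) <=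
    \sum_(t <- T) fm nu ([set x | (C1 `\` C) (act t x)] `&` (spread r `&` D)).
  apply: count_fm_ge => //; first exact: measurableI.
  move=> x [sx Dx]; apply: (le_trans (h2 x sx (mem_enum _ _))); rewrite ler_nat.
  apply: sub_in_count => t tT /asboolP h; rewrite inE; split => //; exact: Dx.
have : theta * #|` T|%:R * fm nu (spread r `&` D) <= #|` T|%:R * fm nu (C1 `\` C).
  apply: (le_trans key); apply: (@le_trans _ _ (\sum_(t <- T) fm nu (C1 `\` C))).
    apply: ler_sum => t _; rewrite -(fm_act t mCC); apply: fm_le => //; last exact: mact.
    by apply: measurableI; [exact: mU|exact: measurableI].
  by rewrite big_const_seq count_predT iter_addr_0 -[_ *+ size _]mulr_natl.
rewrite mulrAC mulrC ler_pM2l// => h3; apply: le_trans h3; rewrite ler_pM2l//.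
have := fmID nu mD ms; rewrite setIC => e.
have : fm nu (D `\` spread r) <= eta.
  apply: (@le_trans _ _ (fm nu (~` spread r))).
    by apply: fm_le; [exact: measurableD|exact: measurableC|move=> x []].
  by rewrite fmC//; lra.
by lra.
Qed.

End Step.

Definition almost_inv (d0 : R) (S T : {fset G}) := #|` fmul (fsinv T) S `\` S|%fset%:R <= d0 * #|` S|%:R.

(** If [x] is uncovered but [t x] lies in a tile [S b], then [x] is in [(T^-1 S \ S) b]; such points
    have mass at most [d0 * mass st]. *)
Lemma fm_avoid st T (d0 : R) : mtiles st -> (forall p, List.In p st -> almost_inv d0 p.1 T) ->
  1 - fm nu (cov st) - d0 * mass st <= fm nu [set x | forall t, t \in T -> ~ cov st (act t x)].
Proof.
move=> mst hst; set D := [set x | _].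
have mC := measurable_cov mst.
pose st' := [seq ((fmul (fsinv T) p.1 `\` p.1)%fset, p.2) | p <- st].
have In' q : List.In q st' -> exists p, List.In p st /\ q = ((fmul (fsinv T) p.1 `\` p.1)%fset, p.2).
  rewrite /st'; elim: (st) => //= p s IH [<-|/IH[p' [h1 h2]]]; first by exists p; split => //; left.
  by exists p'; split => //; right.
have InP p : List.In p st -> List.In ((fmul (fsinv T) p.1 `\` p.1)%fset, p.2) st'.
  by rewrite /st'; elim: (st) => //= p' s IH [<-|/IH h]; [left|right].
have mst' : mtiles st' by move=> q /In'[p [ps ->]]; exact: (mst p ps).
have h1 : fm nu (cov st') <= d0 * mass st.
  apply: (le_trans (fm_cov_le mst')); rewrite /mass big_map mulr_sumr.
  have : forall p, List.In p st -> #|` fmul (fsinv T) p.1 `\` p.1|%fset%:R <= d0 * #|` p.1|%:R by [].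
  elim: (st) => [|p s IH] h; first by rewrite !big_nil.
  rewrite !big_cons lerD//; last by apply: IH => q qs; apply: h; right.
  by rewrite mulrA ler_wpM2r ?fm_ge0//; apply: h; left.
have mD : measurable D.
  rewrite (_ : D = ~` (\big[setU/set0]_(t <- T) (act t @^-1` cov st))).
    by apply: measurableC; apply: bigsetU_measurable => t _; exact: mact.
  rewrite -bigcup_seq; apply/seteqP; split => x /=.
    by move=> h [t tT]; exact: h.
  by move=> h t tT Ct; apply: h; exists t.
have sub : ~` cov st `<=` D `|` cov st'.
  move=> x nC; case: (pselect (D x)) => [|nD]; [by left|right].
  have [t /not_implyP[tT /contrapT /covP[p [ps [u uT Bu]]]]] := (existsNP _).2 nD.
  apply/covP; eexists; split; first exact: (InP p ps).
  have e : act (t^-1 * u)%g^-1%g x = act u^-1%g (act t x) by rewrite invgM invgK (actM ga).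
  exists (t^-1 * u)%g => /=; last by rewrite e.
  rewrite inE mem_fmul ?mem_fsinv ?invgK// andbT; apply/negP => h; apply: nC.
  by apply/covP; exists p; split => //; exists (t^-1 * u)%g => //; rewrite e.
have : fm nu (~` cov st) <= fm nu D + fm nu (cov st').
  apply: (@le_trans _ _ (fm nu (D `|` cov st'))); last by apply: fmU_le => //; exact: measurable_cov.
  by apply: fm_le => //; [exact: measurableC|apply: measurableU => //; exact: measurable_cov].
by rewrite fmC//; lra.
Qed.

(** The head is placed first, and it has to be almost invariant for the shapes placed after it. *)
Fixpoint inv_chain (d0 : R) (l : seq {fset G}) : Prop :=
  if l is T :: l' then (forall T', T' \in l' -> almost_inv d0 T T') /\ inv_chain d0 l' else True.

(** Each shape covers a proportion [theta] of what is still uncovered, up to the error [c], in which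
    [m / (1 - theta)] bounds the mass used so far. The uncovered excess over [c] therefore shrinks
    by the factor [1 - theta] at each step. *)
Lemma tiling_run (d0 eta : R) l st : 0 < d0 -> 0 < eta -> inv_chain d0 l ->
  (forall T, T \in l -> T != fset0) -> mtiles st ->
  (forall p T, List.In p st -> T \in l -> almost_inv d0 p.1 T) ->
  (1 - theta) * mass st <= m%:R * fm nu (cov st) ->
  let c := d0 * (m%:R / (1 - theta)) + eta in
  exists st', [/\ mtiles st', (forall p, List.In p st' -> List.In p st \/ p.1 \in l),
    size st' = (size st + size l)%N,
    (1 - theta) * mass st' <= m%:R * fm nu (cov st') &
    1 - fm nu (cov st') - c <= (1 - theta) ^+ size l * (1 - fm nu (cov st) - c)].
Proof.
move=> d00 eta0; elim: l st => [|T l IH] st ch ne mst hst hm c.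
  by exists st; split => //; [left|rewrite addn0|rewrite expr0 mul1r].
have T0 : T != fset0 by apply: ne; rewrite inE eqxx.
have mC := measurable_cov mst.
have [B [mB h1 h2]] := tiling_step T0 mC eta0.
have st1h p T' : List.In p ((T, B) :: st) -> T' \in l -> almost_inv d0 p.1 T'.
  by case => [<- T'l|ps T'l]; [exact: ch.1|apply: hst => //; rewrite inE T'l orbT].
have st1m : mtiles ((T, B) :: st) by move=> p [<-//|]; exact: mst.
have t1 : 0 < 1 - theta by rewrite subr_gt0.
have mass1 : (1 - theta) * mass ((T, B) :: st) <= m%:R * fm nu (cov ((T, B) :: st)).
  rewrite /mass big_cons -/(mass st) /= mulrDr mulrA setUC.
  have := lerD h1 hm; rewrite -mulrDr subrK; exact.
have [st' [a1 a2 a3 a4 a5]] := IH ((T, B) :: st) ch.2 (fun T' h => ne T' (mem_behead (s := T :: l) h)) st1m st1h mass1.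
exists st'; split => //.
- move=> p /a2[[<-|ps]|pl]; [right; exact: mem_head|by left|right; by rewrite inE pl orbT].
- by rewrite a3 addSnnS.
apply: (le_trans a5); rewrite /= exprSr -mulrA ler_wpM2l ?exprn_ge0 ?(ltW t1)//.
have hm' : mass st <= m%:R / (1 - theta).
  rewrite ler_pdivlMr// mulrC; apply: (le_trans hm); rewrite -[leRHS]mulr1.
  by rewrite ler_wpM2l// fm_le1.
have av := fm_avoid mst (fun p ps => hst p T ps (mem_head T l)).
have h3 : d0 * mass st <= d0 * (m%:R / (1 - theta)) by rewrite ler_pM2l.
have h4 : theta * (1 - fm nu (cov st) - c) <= fm nu (cov st `|` tcov (T, B)) - fm nu (cov st).
  by apply: le_trans h2; rewrite ler_pM2l// /c; lra.
by rewrite setUC mulrBl mul1r; rewrite -/c; lra.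
Qed.

End Tiling.

Definition outer (G : groupType) (K T : {fset G}) : {fset G} :=
  [fset t in T | ~~ all (fun g => (g * t)%g \in T) K]%fset.

Section Quasitiling.
Context {R : realType} {G : groupType} {disp : measure_display} {X : measurableType disp}.
Variable d : X -> X -> R.
Variable act : G -> X -> X.
Hypothesis dm : is_metric d.
Hypothesis dc : dcompact d.
Hypothesis db : borel_for_d d.
Hypothesis ga : G_action d act.
Local Notation mact := (measurable_act db ga).
Variable F : nat -> {fset G}.
Hypothesis FF : Folner R F.

(** Built from the end: a Folner set far enough out is almost invariant for the shapes already
    chosen, and is put in front of them. *)
Lemma inv_chain_exists (d0 : R) (P : nat -> Prop) (k : nat) : 0 < d0 ->
  (exists N, forall n, (N <= n)%N -> P n) ->
  exists l : seq {fset G}, [/\ size l = k, forall T, T \in l -> exists2 n, P n & T = F n & inv_chain d0 l].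
Proof.
move=> d00 [N0 hN0]; elim: k => [|k [l [sl hl cl]]]; first by exists [::].
have [N hN] : exists N, forall n, (N <= n)%N -> forall T, T \in l -> almost_inv d0 (F n) T.
  elim: (l) => [|T s [N hN]]; first by exists 0%N.
  have [N' hN'] := Folner_fmul FF (fsinv T) d00.
  exists (maxn N N') => n; rewrite geq_max => /andP[nN nN'] T'.
  by rewrite inE => /predU1P[->|]; [exact: hN'|exact: hN].
exists (F (maxn N N0) :: l); split; rewrite /= ?sl//.
  move=> T; rewrite inE => /predU1P[->|]; last exact: hl.
  by exists (maxn N N0) => //; apply: hN0; rewrite leq_maxr.
by split => // T; apply: hN; rewrite leq_maxl.
Qed.

Variable nu : probability X R.
Hypothesis ni : G_invariant act nu.
Variable m : nat.
Hypothesis m0 : (0 < m)%N.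
Hypothesis stab : forall K, fm nu [set x | (m < #|` stabset act K x|)%N] = 0.

(** The number [k] of shapes does not depend on the demand [P] made on them, which lets
    [tiling_bound] choose [P] in terms of [k]. *)
Lemma quasitiling (delta : R) : 0 < delta -> delta <= 1 -> exists k : nat, forall P : nat -> Prop,
  (exists N, forall n, (N <= n)%N -> P n) ->
  exists st, [/\ mtiles st, (size st <= k)%N, forall p, List.In p st -> exists2 n, P n & p.1 = F n,
    mass nu st <= m%:R * (1 + delta) & 1 - fm nu (cov act st) <= delta].
Proof.
(* This [theta] gives [1 / (1 - theta) <= 1 + delta]. The uncovered part is at most [delta / 2] from
   the geometric factor plus [delta / 4] from each of the errors governed by [d0] and [eta]. *)
move=> dl0 dl1; pose theta := delta / 2.
have th0 : 0 < theta by rewrite /theta; lra.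
have th1 : theta < 1 by rewrite /theta; lra.
have mr0 : 0 < m%:R :> R by rewrite ltr0n.
have t1 : 0 < 1 - theta by rewrite subr_gt0.
pose d0 := (delta / 4) / (m%:R / (1 - theta)).
have d00 : 0 < d0 by rewrite /d0 !divr_gt0.
pose eta := delta / 4; have eta0 : 0 < eta by rewrite /eta; lra.
have [k hk] : exists k, (1 - theta) ^+ k <= delta / 2.
  have : `|1 - theta| < 1 by rewrite ger0_norm ?(ltW t1)//; lra.
  move=> /cvg_expr/cvgrPdist_le/(_ (delta / 2)); case; first by lra.
  move=> k _ /(_ k (leqnn k)) /=; rewrite sub0r normrN ger0_norm ?exprn_ge0 ?(ltW t1)// => h.
  by exists k.
exists k => P hP; have [l [sl hl cl]] := inv_chain_exists k d00 hP.
have ne T : T \in l -> T != fset0 by move=> /hl[n _ ->]; exact: (Folner_neq0 FF).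
have [] := tiling_run dm dc db ga ni th0 th1 stab (st := [::]) d00 eta0 cl ne => //.
  by rewrite /mass big_nil /= fm0 !mulr0.
move=> st [mst hst sst h1 h2]; exists st; split => //.
- by rewrite sst add0n sl.
- by move=> p /hst[//|/hl].
- rewrite -(ler_pM2l t1); apply: (le_trans h1); apply: (@le_trans _ _ m%:R).
    by rewrite ler_piMr ?fm_le1//; exact: (measurable_cov db ga mst).
  rewrite mulrCA -[leLHS]mulr1 ler_pM2l// /theta.
  have : 0 <= delta * (1 - delta) by rewrite mulr_ge0//; lra.
  by lra.
have dm' : d0 * (m%:R / (1 - theta)) = delta / 4.
  by rewrite /d0 mulfVK// gt_eqF// divr_gt0.
move: h2; rewrite dm' /eta /= fm0 subr0 sl.
have : (1 - theta) ^+ k * (1 - (delta / 4 + delta / 4)) <= delta / 2.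
  apply: le_trans hk; rewrite ler_piMr ?exprn_ge0 ?(ltW t1)//; lra.
by lra.
Qed.

(** Let [y = t b] lie in a tile and be fixed by [m] elements [g] of [K0]. If [t] is not in
    [outer K0], all [g t] belong to the shape and [(g t)^-1 y = b], so [y] is counted at least [m]
    times. The exceptional points have measure at most [3 * delta], one [delta] for each of the last
    hypotheses. *)
Lemma tile_multiplicity (delta : R) (st : seq ({fset G} * set X)) (K0 : {fset G}) (phi : X -> R) (M : R) :
  mtiles st -> bmeas phi -> (forall x, 0 <= phi x <= M) ->
  1 - fm nu [set x | (m <= #|` stabset act K0 x|)%N] <= delta ->
  1 - fm nu (cov act st) <= delta ->
  \sum_(p <- st) #|` outer K0 p.1|%:R * fm nu p.2 <= delta ->
  m%:R * (Ex nu phi - 3 * delta * M) <=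
    \sum_(p <- st) \sum_(t <- p.1) Ex nu (fun x => \1_(p.2) x * phi (act t x)).
Proof.
move=> mst bphi phiM hstab hcov hbad.
have M0 : 0 <= M by have /andP[a b] := phiM point; exact: le_trans a b.
pose st' := [seq (outer K0 p.1, p.2) | p <- st].
have mst' : mtiles st'.
  rewrite /st' /mtiles; elim: (st) mst => [|p s IH] h q //= [<-|]; first exact: (h p (or_introl erefl)).
  by apply: IH => p' ps; apply: h; right.
pose stabm := [set x | (m <= #|` stabset act K0 x|)%N].
have mstab : measurable stabm := measurable_stabset dm db ga K0 (fun S => (m <= #|` S|)%N).
have mcov := measurable_cov db ga mst; have mcov' := measurable_cov db ga mst'.
pose Bad := (~` stabm `|` ~` cov act st) `|` cov act st'.
have mBad : measurable Bad by apply: measurableU => //; apply: measurableU; exact: measurableC.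
have fBad : fm nu Bad <= 3 * delta.
  apply: (le_trans (fmU_le _ _ mcov')); first by apply: measurableU; exact: measurableC.
  have h1 : fm nu (cov act st') <= delta.
    apply: (le_trans (fm_cov_le db ga ni mst')); by rewrite /mass big_map.
  have := fmU_le nu (measurableC mstab) (measurableC mcov); rewrite !fmC//.
  have hs : 1 - fm nu stabm <= delta := hstab.
  by lra.
pose S y : R := \sum_(p <- st) \sum_(t <- p.1) \1_(p.2) (act t^-1%g y) * phi y.
have bt p t : List.In p st -> bmeas (fun y => \1_(p.2) (act t^-1%g y) * phi y : R).
  move=> ps; apply: bmeasM => //; apply: (bmeas_act db ga (phi := \1_(p.2))).
  by apply: bmeas_indic; exact: mst.
have [bS ES] : bmeas S /\ Ex nu S =
    \sum_(p <- st) \sum_(t <- p.1) Ex nu (fun x => \1_(p.2) x * phi (act t x)).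
  rewrite /S; elim: (st) bt => [|p s IH] bt.
    split; last by rewrite big_nil -[RHS](Ex_cst nu 0); congr Ex; apply/funext => x; rewrite big_nil.
    by rewrite (_ : (fun y => _) = fun=> 0); [exact: bmeas_cst|apply/funext => x; rewrite big_nil].
  have [b1 E1] := IH (fun q t qs => bt q t (or_intror qs)).
  have b2 : bmeas (fun y => \sum_(t <- p.1) \1_(p.2) (act t^-1%g y) * phi y : R).
    by apply: (@bmeas_sum _ _ _ _ _ (fun t y => \1_(p.2) (act t^-1%g y) * phi y)) => t; apply: bt; left.
  have -> : (fun y => \sum_(q <- p :: s) \sum_(t <- q.1) \1_(q.2) (act t^-1%g y) * phi y) =
     fun y => (\sum_(t <- p.1) \1_(p.2) (act t^-1%g y) * phi y) +
      \sum_(q <- s) \sum_(t <- q.1) \1_(q.2) (act t^-1%g y) * phi y.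
    by apply/funext => y; rewrite big_cons.
  split; first exact: bmeasD.
  rewrite ExD// E1 big_cons; congr (_ + _).
  rewrite (@Ex_sum _ _ _ nu _ _ (fun t y => \1_(p.2) (act t^-1%g y) * phi y)); last by move=> t; apply: bt; left.
  apply: eq_bigr => t _; rewrite -(Ex_act db ga t ni (bt p t (or_introl erefl))).
  by congr Ex; apply/funext => x; rewrite (actK ga).
rewrite -ES; apply: (@le_trans _ _ (Ex nu (fun y => m%:R * phi y - m%:R * M * \1_Bad y))).
  rewrite ExB ?ExZ ?Ex_indic//; first last.
  - by apply: bmeasZ; exact: bmeas_indic.
  - exact: bmeasZ.
  - exact: bmeas_indic.
  rewrite mulrBr lerD2l lerN2 -mulrA ler_wpM2l// mulrC.
  by rewrite -[leRHS]mulrA [leRHS]mulrC -mulrA; rewrite mulrC [leRHS]mulrC -mulrA ler_wpM2l// mulrC.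
apply: Ex_le => // [|y]; first by apply: bmeasB; apply: bmeasZ => //; exact: bmeas_indic.
have /andP[p0 pM] := phiM y.
have S0 : 0 <= S y by apply: sumr_ge0 => p _; apply: sumr_ge0 => t _; rewrite mulr_ge0// indicE.
case: (pselect (Bad y)) => By; rewrite indicE.
  rewrite mem_set//= mulr1; apply: le_trans S0; rewrite -mulrBr mulr_ge0_le0// subr_le0//.
rewrite memNset//= mulr0 subr0.
have [sy [cy nc]] : stabm y /\ cov act st y /\ ~ cov act st' y.
  by split; [|split] => [|| h]; try apply: contrapT => h; apply: By; rewrite /Bad /=; tauto.
have [p [ps [t tp Bt]]] := (covP act st y).1 cy.
have allt : all (fun g => (g * t)%g \in p.1) K0.
  apply/negPn/negP => nall; apply: nc; apply/covP.
  exists (outer K0 p.1, p.2); split.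
    rewrite /st'; elim: (st) ps => //= q s IH [<-|/IH]; [by left|by right].
  by exists t => //=; rewrite !inE tp.
apply: (@le_trans _ _ (\sum_(u <- p.1) \1_(p.2) (act u^-1%g y) * phi y)); last first.
  rewrite /S; elim: (st) ps => //= q s IH [->|/IH h]; rewrite big_cons.
    by rewrite lerDl; apply: sumr_ge0 => ? _; apply: sumr_ge0 => ? _; rewrite mulr_ge0// indicE.
  by apply: (le_trans h); rewrite lerDr; apply: sumr_ge0 => ? _; rewrite mulr_ge0// indicE.
rewrite -mulr_suml ler_wpM2r//.
have -> : \sum_(u <- p.1) \1_(p.2) (act u^-1%g y) = (count (fun u => act u^-1%g y \in p.2) p.1)%:R :> R.
  by rewrite -sum1_count natr_sum [RHS]big_mkcond; apply: eq_bigr => u _; rewrite indicE; case: ifP.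
rewrite ler_nat; apply: (leq_trans sy); rewrite -size_filter -(size_map (fun g => (g * t)%g)).
apply: uniq_leq_size; first by rewrite map_inj_uniq ?fset_uniq//; exact: mulIg.
move=> _ /mapP[g + ->]; rewrite !inE /= mem_filter => /andP[gK /eqP gy].
rewrite (allP allt)// andbT invgM (actM ga) mem_set//.
by rewrite -{1}gy (actK ga).
Qed.

End Quasitiling.

(** * The entropy of an ergodic measure is bounded by the pressure *)

Section Coding.
Context {R : realType} {G : groupType} {disp : measure_display} {X : measurableType disp}.
Variable d : X -> X -> R.
Variable act : G -> X -> X.
Hypothesis dm : is_metric d.
Hypothesis dc : dcompact d.
Hypothesis db : borel_for_d d.
Hypothesis ga : G_action d act.
Local Notation mact := (measurable_act db ga).
Local Notation entr := (@entr_fun R).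
Local Notation name := (name act).
Implicit Types (T K : {fset G}).

Lemma dF_le T (r : R) x y : 0 <= r -> dF d act T x y <= r <-> forall g, g \in T -> d (act g x) (act g y) <= r.
Proof.
move=> r0; rewrite /dF; split=> [h g gT|h].
  by apply: le_trans h; apply: (@le_bigmax_seq _ _ _ _ _ g).
by rewrite big_seq; apply: bigmax_le.
Qed.

(** A separated set of maximal size spans; sizes are bounded by [PF_bounded] for the zero
    potential. *)
Lemma spanning_code T (r : R) : 0 < r -> exists (E : seq X) (Z : X -> 'I_(size E)),
  [/\ Defs.separated d act T r E, mlab Z &
      forall x g, g \in T -> d (act g (nth point E (Z x))) (act g x) <= r].
Proof.
move=> r0; have [M hM] := PF_bounded act dm dc db (dcont_cst d 0) r0 T.
pose P n := `[< exists2 E, Defs.separated d act T r E & size E = n >].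
have hP : exists n, P n by exists 1%N; apply/asboolP; exists [:: point] => //; exact: separated1.
have PM n : P n -> (n <= Num.bound `|M|)%N.
  move=> /asboolP[E sE <-]; have := hM E sE.
  rewrite (eq_bigr (fun=> 1)); last by move=> x _; rewrite /SF big1 ?expR0.
  rewrite big_const_seq count_predT iter_addr_0 => h; rewrite -(ler_nat R); apply: (le_trans h).
  by apply: ltW; apply: (le_lt_trans (ler_norm _)); rewrite archi_boundP.
case: (ex_maxnP hP PM) => N /asboolP[E sE sN] maxN.
have E0 : (0 < size E)%N.
  by rewrite sN; apply: maxN; apply/asboolP; exists [:: point] => //; exact: separated1.
pose b x := [ffun p : 'I_(size E) * T => `[< d (act (fsval p.2) (nth point E p.1)) (act (fsval p.2) x) <= r >]].
have mb : mlab b.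
  apply: (mlab_ffun (Y := fun (p : 'I_(size E) * T) x =>
    `[< d (act (fsval p.2) (nth point E p.1)) (act (fsval p.2) x) <= r >])) => p.
  apply: mlab_asbool; rewrite (_ : (fun _ => _) =
     act (fsval p.2) @^-1` (~` [set z | r < d (act (fsval p.2) (nth point E p.1)) z])).
    by apply: mact; apply: measurableC; apply: (dopen_measurable db); apply: dcont_open_gt; exact: dcont_d.
  by apply/seteqP; split => x /=; rewrite leNgt => /negP.
pose Zb (c : {ffun 'I_(size E) * T -> bool}) := odflt (Ordinal E0) [pick i | [forall g, c (i, g)]].
exists E, (fun x => Zb (b x)); split => //; first exact: (mlab_comp (Y := b) Zb).
move=> x g gT; rewrite /Zb; case: pickP => [i /forallP/(_ [` gT]%fset)|h].
  by rewrite ffunE => /asboolP.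
exfalso; suff : P N.+1 by move=> /maxN; rewrite ltnn.
have far w : w \in E -> r < dF d act T x w.
  move=> wE; rewrite ltNge; apply/negP => /(dF_le _ _ _ (ltW r0)) hw.
  move: wE => /(nthP point)[i iE wi]; have /negP := h (Ordinal iE); apply; apply/forallP => u.
  by rewrite ffunE; apply/asboolP; rewrite /= wi (dsym dm) hw.
have [uE hE] := sE.
apply/asboolP; exists (x :: E); last by rewrite /= sN.
split; rewrite /= ?uE ?andbT.
  apply/negP => /far; apply/negP; rewrite -leNgt dF_le ?(ltW r0)// => u _.
  by rewrite (dxx dm) ltW.
move=> y z; rewrite !inE => /predU1P[->|yE] /predU1P[->|zE]; rewrite ?eqxx//.
- by move=> _; exact: far.
- move=> _; have := far y yE; rewrite /dF; congr (_ < _).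
  by apply: eq_bigr => u _; rewrite (dsym dm).
- exact: hE.
Qed.

(** On [B] the label is the spanning point, weighted by the sum [a u] of [phi] along [T] at that
    point; off [B] it is [None]. The Gibbs inequality and the hypothesis on separated sets give the
    bound with [c], and [w] pays for replacing a point by its spanning point. *)
Lemma tile_label (nu : probability X R) T (B : set X) (r c w : R) (phi : X -> R) : 0 < r ->
  measurable B -> dcontinuous_real d phi -> (forall x y, d x y <= r -> `|phi x - phi y| <= w) ->
  (forall E, Defs.separated d act T r E -> \sum_(x <- E) expR (SF act T phi x) <= expR (c * #|` T|%:R)) ->
  exists (U : finType) (Z : X -> U), [/\ mlab Z,
    forall x y, Z x = Z y -> (B x <-> B y) /\ (B x -> forall t, t \in T -> d (act t x) (act t y) <= 2 * r) &
    HE nu setT Z + \sum_(t <- T) Ex nu (fun x => \1_B x * phi (act t x)) <=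
      entr (fm nu B) + entr (1 - fm nu B) + #|` T|%:R * fm nu B * (c + w)].
Proof.
move=> r0 mB cphi osc hc; have [E [Z [sE mZ hZ]]] := spanning_code T r0.
have bphi := dcont_bmeas dm db dc cphi.
pose Z' x := if pselect (B x) then Some (Z x) else None.
have Z'S u : Z' @^-1` [set Some u] = B `&` Z @^-1` [set u].
  apply/seteqP; split => x; rewrite /Z' /=; case: pselect => // h; first by case=> <-.
    by move=> [_ ->].
  by case.
have Z'P u x : Z' x = Some u <-> B x /\ Z x = u.
  have : (Z' @^-1` [set Some u]) x <-> (B `&` Z @^-1` [set u]) x by rewrite Z'S.
  by [].
have Z'in u x : (x \in Z' @^-1` [set Some u]) = `[< B x /\ Z x = u >].
  by apply/idP/asboolP => [/set_mem h|h]; [exact: (Z'P u x).1|apply/mem_set; exact: (Z'P u x).2].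
have Z'N : Z' @^-1` [set None] = ~` B.
  by apply/seteqP; split => x; rewrite /Z' /=; case: pselect.
have mZ' : mlab Z'.
  by case=> [u|]; rewrite ?Z'S ?Z'N; [apply: measurableI|exact: measurableC].
exists (option 'I_(size E)), Z'; split => //.
  move=> x y; rewrite /Z'; case: pselect => Bx; case: pselect => By // [Zxy]; split => // _ t tT.
  have := hZ x t tT; have := hZ y t tT; rewrite -Zxy; have := dtri dm (act t x) (act t (nth point E (Z x))) (act t y).
  by rewrite (dsym dm (act t x) (act t (nth _ _ _))); lra.
pose a (u : 'I_(size E)) := SF act T phi (nth point E u).
have := HE_option_gibbs a mZ' (k := fm nu B) (mu := nu); have -> : [set x | Z' x <> None] = B.
  by apply/seteqP; split => x; rewrite /Z' /=; case: pselect.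
move=> /(_ erefl).
have h1 : ln (\sum_(u : 'I_(size E)) expR (a u)) <= c * #|` T|%:R.
  rewrite -[leRHS]expRK ler_ln ?posrE ?expR_gt0//.
    by have := hc E sE; rewrite (big_nth point) big_mkord.
  rewrite (bigD1 (Z point))//= ltr_pwDl ?expR_gt0//.
  by apply: sumr_ge0 => u _; exact: expR_ge0.
have h2 : \sum_(t <- T) Ex nu (fun x => \1_B x * phi (act t x)) <=
    \sum_u fm nu (Z' @^-1` [set Some u]) * a u + #|` T|%:R * fm nu B * w.
  have bu u : bmeas (fun x => \1_(Z' @^-1` [set Some u]) x * (a u + #|` T|%:R * w) : R).
    apply: bmeasM; last exact: bmeas_cst.
    by apply: bmeas_indic; exact: mZ'.
  have bt t : bmeas (fun x => \1_B x * phi (act t x)).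
    by apply: bmeasM; [exact: bmeas_indic|exact: (bmeas_act db ga)].
  have b1 := bmeas_sum T bt; have b2 := bmeas_sum (index_enum _) bu.
  rewrite -(Ex_sum nu T bt).
  apply: (@le_trans _ _ (Ex nu (fun x => \sum_u \1_(Z' @^-1` [set Some u]) x * (a u + #|` T|%:R * w)))).
    apply: Ex_le; [exact: b1|exact: b2|move=> x].
    case: (pselect (B x)) => Bx; last first.
      rewrite big1 => [|t _]; last by rewrite indicE memNset// mul0r.
      rewrite big1// => u _; rewrite indicE Z'in; case: asboolP => [[]//|_]; exact: mul0r.
    rewrite [leRHS](@big_only1 _ _ _ _ (Z x))// => [|u /eqP uZ _]; last first.
      by rewrite indicE Z'in; case: asboolP => [[_ /esym]//|_]; exact: mul0r.
    have Zx : x \in Z' @^-1` [set Some (Z x)] by rewrite Z'in; apply/asboolP.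
    rewrite [\1_(Z' @^-1` _) x]indicE Zx mul1r /a /SF.
    have -> : #|` T|%:R * w = \sum_(t <- T) w.
      by rewrite big_const_seq count_predT iter_addr_0 -[RHS]mulr_natl.
    rewrite -big_split /= big_seq [leRHS]big_seq; apply: ler_sum => t tT.
    rewrite indicE mem_set// mul1r.
    by have := osc _ _ (hZ x t tT); rewrite ler_norml => /andP[+ _]; lra.
  rewrite Ex_sum// (eq_bigr (fun u => fm nu (Z' @^-1` [set Some u]) * a u +
     fm nu (Z' @^-1` [set Some u]) * (#|` T|%:R * w))); last first.
    move=> u _; have := ExZ nu (a u + #|` T|%:R * w) (bmeas_indic (mZ' (Some u))).
    rewrite Ex_indic// -mulrDr [RHS]mulrC => <-.
    by congr Ex; apply/funext => x; rewrite mulrC.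
  rewrite big_split /= lerD2l -mulr_suml.
  have -> : \sum_u fm nu (Z' @^-1` [set Some u]) = fm nu B.
    by rewrite -(fm_partition nu mB mZ); apply: eq_bigr => u _; rewrite Z'S.
  by rewrite mulrA [fm nu B * _]mulrC.
have := ler_wpM2l (fm_ge0 nu B) h1.
move: h2; set s1 := \sum_(t <- T) _; set s2 := \sum_u _ * _; set L := ln _; set b := fm nu B.
move=> h2 h3 h4; have -> : #|` T|%:R * b * (c + w) = b * (c * #|` T|%:R) + #|` T|%:R * b * w by ring.
by lra.
Qed.

Lemma tiling_code (nu : probability X R) st (r c w : R) (phi : X -> R) : 0 < r -> mtiles st ->
  dcontinuous_real d phi -> (forall x y, d x y <= r -> `|phi x - phi y| <= w) ->
  (forall p, List.In p st -> forall E, Defs.separated d act p.1 r E ->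
     \sum_(x <- E) expR (SF act p.1 phi x) <= expR (c * #|` p.1|%:R)) ->
  exists (U : finType) (Z : X -> U), [/\ mlab Z,
    forall x y, Z x = Z y -> forall p, List.In p st ->
      (p.2 x <-> p.2 y) /\ (p.2 x -> forall t, t \in p.1 -> d (act t x) (act t y) <= 2 * r) &
    HE nu setT Z + \sum_(p <- st) \sum_(t <- p.1) Ex nu (fun x => \1_(p.2) x * phi (act t x)) <=
      \sum_(p <- st) (entr (fm nu p.2) + entr (1 - fm nu p.2)) + mass nu st * (c + w)].
Proof.
move=> r0 mst cphi osc; elim: st mst => [|p st IH] mst hc.
  exists unit, (fun=> tt); split => //; first exact: mlab_cst.
  by rewrite HE_unit !big_nil /mass big_nil mul0r.
have [U [Z [mZ dZ hZ]]] := IH (fun q qs => mst q (or_intror qs)) (fun q qs => hc q (or_intror qs)).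
have [V [Y [mY dY hY]]] := tile_label nu r0 (mst p (or_introl erefl)) cphi osc (hc p (or_introl erefl)).
exists (V * U)%type, (fun x => (Y x, Z x)); split; first exact: mlab_pair.
  by move=> x y [Yxy Zxy] q /= [<-|qs]; [exact: dY|exact: dZ].
have := HE_pair_le nu measurableT mY mZ; move: hZ hY.
by rewrite /mass !big_cons mulrDl -/(mass nu st); lra.
Qed.

End Coding.

Section TilingBound.
Context {R : realType} {G : groupType} {disp : measure_display} {X : measurableType disp}.
Variable d : X -> X -> R.
Variable act : G -> X -> X.
Hypothesis dm : is_metric d.
Hypothesis dc : dcompact d.
Hypothesis db : borel_for_d d.
Hypothesis ga : G_action d act.
Local Notation mact := (measurable_act db ga).
Local Notation entr := (@entr_fun R).
Local Notation name := (name act).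
Implicit Types (T K D : {fset G}).
Variable F : nat -> {fset G}.
Hypothesis FF : Folner R F.
Hypothesis Ginf : exists e : nat -> G, injective e.
Variable nu : probability X R.
Hypothesis ni : G_invariant act nu.

(** A name of [name Y D] along [F N] is determined by the name of [Y] along [D F N]. The infimum
    rule compares the latter with any window [K], since [K^-1 D F N] is hardly larger than [F N]. *)
Lemma hrate_name_le (U : finType) (Y : X -> U) D : mlab Y -> hrate act nu (name Y D) <= hrate act nu Y.
Proof.
move=> mY; have mN K : mlab (name Y K) by exact: (mlab_name mact).
apply: hrate_ge => K K0; set h := _ / _.
have Kp : 0 < #|` K|%:R :> R by rewrite ltr0n cardfs_gt0.
have h0 : 0 <= h by rewrite divr_ge0// HE_ge0//.
apply/ler_addgt0Pr => e e0; pose e' := e / (h + 1).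
have hp : 0 < h + 1 by lra.
have e'0 : 0 < e' by rewrite divr_gt0.
have [N hN] := Folner_fmul_card FF (fmul (fsinv K) D) e'0; have {}hN := hN N (leqnn N).
have Fp := Folner_card_gt0 FF N.
apply: (le_trans (hrate_le mact nu (mN D) (Folner_neq0 FF N))).
rewrite ler_pdivrMr//.
have s1 : HE nu setT (name (name Y D) (F N)) <= HE nu setT (name Y (fmul D (F N))).
  apply: HE_det => //; first exact: (mlab_name mact).
  move=> x y _ _ /nameP exy; apply/nameP => g gF; apply/nameP => u uD.
  by rewrite -!(actM ga); apply: exy; exact: mem_fmul.
apply: (le_trans s1).
have s2 := HE_inf_rule mact ni (actM ga) K (fmul D (F N)) mY.
have -> : (h + e) = (1 + e') * h + (e - e' * h) by ring.
have e3 : 0 <= e - e' * h.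
  have -> : e = e' * (h + 1) by rewrite divfK// gt_eqF.
  by rewrite mulrDr mulr1 addrAC subrr add0r ltW.
apply: (@le_trans _ _ ((1 + e') * h * #|` F N|%:R)); last by rewrite ler_wpM2r// lerDl.
rewrite mulrAC /h mulrA ler_pdivlMr// mulrC; apply: (le_trans s2).
rewrite ler_wpM2r ?HE_ge0//; apply: le_trans hN.
rewrite ler_nat; apply: fsubset_leq_card; apply/fsubsetP => g /fmulP[a [b [aK /fmulP[u [v [uD vF ->]]] ->]]].
by rewrite mulgA; do 2 apply: mem_fmul => //.
Qed.

(** Folner sets are almost invariant on the left while [hrate_coincidences] asks for invariance on
    the right, so the window is the inverse of a Folner set. *)
Lemma hrate_le_stab (m : nat) (U : finType) (Y : X -> U) : (0 < m)%N ->
  (forall eta : R, 0 < eta -> exists K, 1 - eta <= fm nu [set x | (m <= #|` stabset act K x|)%N]) ->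
  mlab Y -> hrate act nu Y <= HE nu setT Y / m%:R.
Proof.
move=> m0 full mY; apply/ler_addgt0Pr => e e0.
have lU : 0 <= ln (#|U|%:R : R) by apply: ln_ge0; rewrite ler1n; apply/card_gt0P; exists (Y point).
pose eta := e / (4 * (ln (#|U|%:R) + 1)); have eta0 : 0 < eta by rewrite divr_gt0//; lra.
have [K hK] := full eta eta0.
have [N hN] := Folner_invariant_elts FF (fsinv K) eta0; have {}hN := hN N (leqnn N).
have Ktp : (0 < #|` fsinv (F N)|)%N by rewrite card_fsinv cardfs_gt0 (Folner_neq0 FF).
have bad : #|` [fset g in fsinv (F N) | ~~ all (fun k => (g * k)%g \in fsinv (F N)) K]%fset|%:R
    <= eta * #|` fsinv (F N)|%:R.
  rewrite card_fsinv; apply: le_trans hN; rewrite ler_nat -[leqRHS]card_fsinv.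
  apply: fsubset_leq_card; apply/fsubsetP => g; rewrite mem_fsinv !inE !mem_fsinv => /andP[-> /=].
  apply: contra => /allP h; apply/allP => k kK; rewrite mem_fsinv invgM.
  by apply: h; rewrite mem_fsinv invgK.
have e4 : 0 < e / 2 by lra.
apply: (le_trans (hrate_coincidences dm db ga ni m0 hK bad mY e4 Ktp Ginf)).
rewrite -addrA lerD2l.
have : eta * (ln #|U|%:R + 1) = e / 4.
  by rewrite /eta invfM mulrA mulfVK ?gt_eqF//; lra.
have : 0 <= eta by exact: ltW.
by rewrite mulrDr mulr1; lra.
Qed.

(** [Z] codes tiles at their base points and [Z0] codes uncovered points directly. Their joint name
    along [D] locates every point: a covered one sees its base point through some [t^-1] in [D], an
    uncovered one is read at the unit. Passing to this name does not increase the mean entropy, and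
    [HE nu setT Z] is at most about [m (c + w - Ex nu phi)]. *)
Lemma tiling_bound (m : nat) (phi : X -> R) (r c w M e : R) : (0 < m)%N ->
  (forall K, fm nu [set x | (m < #|` stabset act K x|)%N] = 0) ->
  (forall eta : R, 0 < eta -> exists K, 1 - eta <= fm nu [set x | (m <= #|` stabset act K x|)%N]) ->
  0 < r -> dcontinuous_real d phi -> (forall x, 0 <= phi x <= M) -> 0 <= c + w ->
  (forall x y, d x y <= r -> `|phi x - phi y| <= w) ->
  (exists N, forall n, (N <= n)%N -> forall E, Defs.separated d act (F n) r E ->
     \sum_(x <- E) expR (SF act (F n) phi x) <= expR (c * #|` F n|%:R)) ->
  0 < e ->
  exists (U : finType) (al : X -> U), [/\ mlab al, forall x y, al x = al y -> d x y <= 2 * r &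
    hrate act nu al <= c + w - Ex nu phi + e].
Proof.
move=> m0 stab full r0 cphi phiM cw0 osc hc e0.
have bphi := dcont_bmeas dm db dc cphi.
have M0 : 0 <= M by have /andP[a b] := phiM point; exact: le_trans a b.
have mr : 1 <= m%:R :> R by rewrite ler1n.
have mr0 : 0 < m%:R :> R by exact: lt_le_trans mr.
have r4 : 0 < 4 * r by lra.
have [J [Y0 [mY0 hY0]]] := fine_label_exists dm dc db r4.
have e4 : 0 < e / 4 by lra.
have [k0 k00 hk0] := entr2_small (ln #|J|%:R) e4.
(* [A] dominates what is multiplied by [delta] in the final estimate; the product is kept below
   [e / 2]. *)
pose A := c + w + 3 * M + 1; have A0 : 0 < A by rewrite /A; lra.
pose delta := Num.min 1 (Num.min k0 (e / 2 / A)).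
have dl0 : 0 < delta by rewrite !lt_min ltr01 k00/= !divr_gt0.
have dl1 : delta <= 1 by rewrite ge_min lexx.
have dlk : delta <= k0 by rewrite /delta !ge_min lexx orbT.
have dlA : delta * A <= e / 2 by rewrite -ler_pdivlMr// /delta !ge_min lexx !orbT.
have [k hk] := quasitiling dm dc db ga FF ni m0 stab dl0 dl1.
(* Each of at most [k] base sets costs the entropy of its indicator; the total must stay below
   [e / 4]. *)
have e5 : 0 < e / 4 / k.+1%:R by rewrite divr_gt0.
have [k1 k10 hk1] := entr2_small 0 e5.
have [K0 hK0] := full delta dl0.
pose e1 := delta / (2 * m%:R).
have e10 : 0 < e1 by rewrite divr_gt0//; lra.
(* As [#|T| nu(B)] is at most the mass, hence at most [2 m], a shape of size at least [L] has a base
   set of measure at most [k1]. *)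
pose L := (Num.bound (2 * m%:R / k1)).
pose P n := [/\ forall E, Defs.separated d act (F n) r E ->
     \sum_(x <- E) expR (SF act (F n) phi x) <= expR (c * #|` F n|%:R),
   #|` outer K0 (F n)|%:R <= e1 * #|` F n|%:R & (L <= #|` F n|)%N].
have [|st [mst sst shapes hmass hcov]] := hk P.
  have [N1 h1] := hc; have [N2 h2] := Folner_invariant_elts FF K0 e10.
  have [N3 h3] := Folner_card_infty FF Ginf L.
  exists (maxn N1 (maxn N2 N3)) => n; rewrite !geq_max => /and3P[n1 n2 n3].
  by split; [exact: h1|exact: h2|exact: h3].
have mass2 : mass nu st <= 2 * m%:R.
  by apply: (le_trans hmass); rewrite mulrC ler_pM2r//; lra.
have fm_small p : List.In p st -> fm nu p.2 <= k1.
  move=> ps; have [n [_ _ hL] pF] := shapes p ps.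
  have one : #|` p.1|%:R * fm nu p.2 <= mass nu st.
    rewrite /mass; elim: (st) ps => //= q s IH [->|/IH h]; rewrite big_cons.
      by rewrite lerDl sumr_ge0// => q' _; rewrite mulr_ge0// fm_ge0.
    by apply: (le_trans h); rewrite lerDr mulr_ge0// fm_ge0.
  have L0 : 2 * m%:R / k1 <= #|` p.1|%:R.
    rewrite pF; apply: (@le_trans _ _ L%:R); last by rewrite ler_nat.
    by apply: ltW; rewrite archi_boundP// divr_ge0 ?mulr_ge0// ltW.
  have Tp : 0 < #|` p.1|%:R :> R.
    by apply: lt_le_trans L0; rewrite divr_gt0// mulr_gt0.
  rewrite -(ler_pM2l Tp); apply: (le_trans one); apply: (le_trans mass2).
  by rewrite -ler_pdivrMr.
have ent_small : \sum_(p <- st) (entr (fm nu p.2) + entr (1 - fm nu p.2)) <= e / 4.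
  apply: (@le_trans _ _ (\sum_(p <- st) (e / 4 / k.+1%:R))).
    elim: (st) fm_small => [|p s IH] h; first by rewrite !big_nil.
    rewrite !big_cons lerD ?IH// => [|q qs]; last by apply: h; right.
    have := hk1 (fm nu p.2); rewrite mulr0 addr0; apply.
    by rewrite fm_ge0 h//; left.
  rewrite big_const_seq count_predT iter_addr_0 -[leLHS]mulr_natl mulrCA.
  rewrite -[leRHS]mulr1 ler_pM2l// ler_pdivrMr// mul1r ler_nat; exact: leqW.
have [U [Z [mZ dZ hZ]]] := tiling_code dm dc db ga nu r0 mst cphi osc
  (fun p ps => let: ex_intro2 n Pn pF := shapes p ps in
     eq_ind_r (fun T => forall E, Defs.separated d act T r E ->
        \sum_(x <- E) expR (SF act T phi x) <= expR (c * #|` T|%:R)) (let: And3 h _ _ := Pn in h) pF).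
have mcov := measurable_cov db ga mst.
pose Z0 x := if pselect (cov act st x) then None else Some (Y0 x).
have Z0P x y : Z0 x = Z0 y -> (cov act st x <-> cov act st y) /\ (~ cov act st x -> d x y <= 2 * r).
  rewrite /Z0; case: pselect => cx; case: pselect => cy // [Yxy]; split => // _.
  by have := hY0 x y Yxy; lra.
have mZ0 : mlab Z0.
  case=> [u|].
    rewrite (_ : _ @^-1` _ = ~` cov act st `&` Y0 @^-1` [set u]).
      by apply: measurableI => //; exact: measurableC.
    apply/seteqP; split => x; rewrite /Z0 /=; case: pselect => // h; first by case=> <-.
      by move=> [].
    by move=> [_ ->].
  rewrite (_ : _ @^-1` _ = cov act st)//.
  by apply/seteqP; split => x; rewrite /Z0 /=; case: pselect.
have hZ0 : HE nu setT Z0 <= e / 4.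
  apply: (le_trans (HE_option_le mZ0 (k := 1 - fm nu (cov act st)) _)).
    rewrite -fmC//; congr fm; apply/seteqP; split => x; rewrite /Z0 /=; by case: pselect.
  by apply: hk0; rewrite subr_ge0 fm_le1//= (le_trans hcov).
pose ga2 x := (Z x, Z0 x); have mg : mlab ga2 by exact: mlab_pair.
pose D := (1%g |` \bigcup_(p <- st) fsinv p.1)%fset.
have DP p t : List.In p st -> t \in p.1 -> t^-1%g \in D.
  move=> ps tp; rewrite !inE; apply/orP; right.
  elim: (st) ps => //= q s IH [->|/IH h]; rewrite big_cons inE ?h ?orbT//.
  by rewrite mem_fsinv invgK tp.
exists {ffun D -> (U * option J)%type}, (name ga2 D); split; first exact: (mlab_name mact).
- move=> x y /nameP h.
  have gD g : g \in D -> Z (act g x) = Z (act g y) /\ Z0 (act g x) = Z0 (act g y).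
    by move=> /h; rewrite /ga2 => -[].
  have D1 : 1%g \in D by rewrite !inE eqxx.
  have [_ /Z0P] := gD _ D1; rewrite !(act1 ga) => -[_ nc].
  case: (pselect (cov act st x)) => [cx|/nc//].
  have [p [ps [t tp pt]]] := (covP act st x).1 cx.
  have [Zxy _] := gD _ (DP p t ps tp).
  have [_ /(_ pt t tp)] := dZ _ _ Zxy p ps.
  by rewrite !(actKV ga).
apply: (le_trans (hrate_name_le D mg)); apply: (le_trans (hrate_le_stab m0 full mg)).
rewrite ler_pdivrMr//; apply: (le_trans (HE_pair_le nu measurableT mZ mZ0)).
have houter : \sum_(p <- st) #|` outer K0 p.1|%:R * fm nu p.2 <= delta.
  apply: (@le_trans _ _ (e1 * mass nu st)).
    rewrite /mass mulr_sumr; elim: (st) shapes => [|p s IH] h; first by rewrite !big_nil.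
    rewrite !big_cons lerD ?IH// => [|q qs]; last by apply: h; right.
    have [n [_ ho _] ->] := h p (or_introl erefl).
    by rewrite mulrA ler_wpM2r ?fm_ge0.
  apply: (@le_trans _ _ (e1 * (2 * m%:R))); first by rewrite ler_pM2l.
  by rewrite /e1 divfK// gt_eqF// mulr_gt0.
have hK0' : 1 - fm nu [set x | (m <= #|` stabset act K0 x|)%N] <= delta by lra.
have := tile_multiplicity dm db ga ni mst bphi phiM hK0' hcov houter.
move: hZ hZ0 ent_small; set s1 := \sum_(p <- st) \sum_(t <- _) _; set s2 := \sum_(p <- st) (_ + _).
move=> hZ hZ0 hs2 hs1.
have hm : mass nu st * (c + w) <= m%:R * (1 + delta) * (c + w) by rewrite ler_wpM2r.
have h1 : HE nu setT Z + HE nu setT Z0 <= m%:R * (1 + delta) * (c + w) + e / 2 - m%:R * (Ex nu phi - 3 * delta * M).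
  by lra.
apply: (le_trans h1).
have -> : m%:R * (1 + delta) * (c + w) + e / 2 - m%:R * (Ex nu phi - 3 * delta * M) =
  (c + w - Ex nu phi + delta * (c + w + 3 * M)) * m%:R + e / 2 by ring.
have hd : delta * (c + w + 3 * M) <= e / 2.
  by apply: le_trans dlA; rewrite ler_pM2l// /A; lra.
have he : e / 2 <= e / 2 * m%:R by rewrite ler_peMr//; lra.
have := ler_wpM2r (ltW mr0) hd; lra.
Qed.

End TilingBound.

Section ErgodicUpperBound.
Context {R : realType} {G : groupType} {disp : measure_display} {X : measurableType disp}.
Variable d : X -> X -> R.
Variable act : G -> X -> X.
Hypothesis dm : is_metric d.
Hypothesis dc : dcompact d.
Hypothesis db : borel_for_d d.
Hypothesis ga : G_action d act.
Local Notation mact := (measurable_act db ga).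
Implicit Types (T K D : {fset G}).
Variable F : nat -> {fset G}.
Hypothesis FF : Folner R F.

Lemma h_eps_le_hrate (nu : probability X R) (U : finType) (al : X -> U) (eps : R) :
  G_invariant act nu -> mlab al -> (forall x y, al x = al y -> d x y <= eps) ->
  (h_eps d act nu F eps <= (hrate act nu al)%:E)%E.
Proof.
move=> ni mal hal; apply: ereal_inf_lbound.
pose A (i : 'I_#|U|) := al @^-1` [set enum_val i].
have pA : finite_partition A.
  split; first by move=> i; exact: mal.
  split.
    move=> i j ij; apply/seteqP; split => x // [/= h1 h2]; move/eqP: ij; apply.
    by apply: enum_val_inj; rewrite -h1 -h2.
  by apply/seteqP; split => // x _; exists (enum_rank (al x)) => //; rewrite /A /= enum_rankK.
exists #|U|, A; split => //.
  rewrite /diam_part; apply: bigmax_le => [|i _]; first exact: leNye.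
  apply: ge_ereal_sup => _ [[x y] [/= xA yA] <-]; rewrite lee_fin; apply: hal.
  by move: xA yA => -> ->.
congr EFin; apply/esym; apply: (h_part_hrate mact ni (actM ga) FF pA mal) => x y; split.
  by move=> e; exists (enum_rank (al x)); rewrite /A /= enum_rankK.
by move=> [i -> ->].
Qed.

(** Turns the union over all finite windows in [stab_ge] into an increasing countable one, which is
    measurable and accessible to continuity of measures. *)
Lemma exhaustion : (exists e : G -> nat, injective e) -> exists Q : nat -> {fset G},
  {homo Q : m n / (m <= n)%N >-> (m `<=` n)%fset} /\ forall K, exists n, (K `<=` Q n)%fset.
Proof.
move=> [e einj]; pose q k := xget 1%g [set g | e g = k].
have qe g : q (e g) = g by apply: einj; apply: (@xgetPex _ 1%g [set h | e h = e g]); exists g.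
exists (fun n => [fset q k | k in iota 0 n]%fset); split.
  move=> m n mn; apply/fsubsetP => _ /imfsetP[k /= + ->]; rewrite mem_iota add0n => km.
  by apply/imfsetP; exists k => //=; rewrite mem_iota add0n (leq_trans km).
move=> K; exists (\max_(g <- K) (e g).+1)%N; apply/fsubsetP => g gK.
apply/imfsetP; exists (e g); last by rewrite qe.
by rewrite /= mem_iota add0n /=; exact: (leq_bigmax_seq (F := fun g => (e g).+1) g gK isT).
Qed.

Definition stab_ge (m : nat) : set X := [set x | exists K, (m <= #|` stabset act K x|)%N].

(** The stabilizers of [x] and [g x] are conjugate. *)
Lemma stab_ge_invariant m g : act g @^-1` stab_ge m = stab_ge m.
Proof.
suff h g' x : stab_ge m (act g' x) -> stab_ge m x.
  apply/seteqP; split => x; first exact: h.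
  by move=> hx; apply: (h g^-1%g); rewrite (actK ga).
move=> [K hK]; exists [fset (g'^-1 * k * g')%g | k in K]%fset.
apply: (leq_trans hK); rewrite -(size_map (fun k => (g'^-1 * k * g')%g)); apply: uniq_leq_size.
  by rewrite map_inj_uniq ?fset_uniq// => a b /mulIg/mulgI.
move=> _ /mapP[k + ->]; rewrite !inE /= => /andP[kK /eqP kx]; apply/andP; split.
  by apply/imfsetP; exists k.
by rewrite !(actM ga) kx (actK ga).
Qed.

Section Exhausted.
Variable Q : nat -> {fset G}.
Hypothesis Qmono : {homo Q : m n / (m <= n)%N >-> (m `<=` n)%fset}.
Hypothesis Qfull : forall K, exists n, (K `<=` Q n)%fset.

Let stabset_mono K K' x : (K `<=` K')%fset -> (#|` stabset act K x| <= #|` stabset act K' x|)%N.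
Proof.
move=> /fsubsetP KK; apply: fsubset_leq_card; apply/fsubsetP => g; rewrite !inE /= => /andP[/KK -> ->//].
Qed.

Lemma stab_geE m : stab_ge m = \bigcup_n [set x | (m <= #|` stabset act (Q n) x|)%N].
Proof.
apply/seteqP; split => x; last by move=> [n _ h]; exists (Q n).
move=> [K hK]; have [n Kn] := Qfull K; exists n => //=; apply: (leq_trans hK); exact: stabset_mono.
Qed.

Let mstab m n : measurable [set x | (m <= #|` stabset act (Q n) x|)%N].
Proof. exact: (measurable_stabset dm db ga (Q n) (fun S => (m <= #|` S|)%N)). Qed.

Lemma measurable_stab_ge m : measurable (stab_ge m).
Proof. by rewrite stab_geE; apply: bigcup_measurable => n _; exact: mstab. Qed.

Lemma stab_ge_full (nu : probability X R) m (eta : R) : fm nu (stab_ge m) = 1 -> 0 < eta ->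
  exists K, 1 - eta <= fm nu [set x | (m <= #|` stabset act K x|)%N].
Proof.
move=> h1 eta0.
have nd : nondecreasing_seq (fun n => [set x | (m <= #|` stabset act (Q n) x|)%N]).
  move=> a b ab; apply/subsetPset => x /= h; apply: (leq_trans h); apply: stabset_mono; exact: Qmono.
have := @fm_cvg_up _ _ _ nu _ (mstab m) nd; rewrite -stab_geE h1.
move=> /cvgrPdist_lt/(_ _ eta0)[n _ /(_ n (leqnn n)) hn]; exists (Q n).
by move: hn; rewrite ltr_norml => /andP[_]; lra.
Qed.

End Exhausted.

Hypothesis Gcount : exists e : G -> nat, injective e.
Hypothesis Ginf : exists e : nat -> G, injective e.

(** By ergodicity each invariant set [stab_ge m] is null or full. Either all are full, and division
    by arbitrarily large [m] gives zero mean entropy, or the last full one supplies the [m] of the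
    tilings. *)
Lemma ergodic_entropy_le (nu : probability X R) (phi : X -> R) (r c w : R) : G_ergodic act nu -> 0 < r ->
  dcontinuous_real d phi ->
  (forall x y, d x y <= r -> `|phi x - phi y| <= w) ->
  (exists N, forall n, (N <= n)%N -> forall E, Defs.separated d act (F n) r E ->
     \sum_(x <- E) expR (SF act (F n) phi x) <= expR (c * #|` F n|%:R)) ->
  (h_eps d act nu F (2 * r) <= (c + w - Ex nu phi)%:E)%E.
Proof.
move=> [ni erg] r0 cphi osc hc.
have bphi := dcont_bmeas dm db dc cphi.
have w0 : 0 <= w by apply: le_trans (osc point point _); rewrite ?(dxx dm) ?(ltW r0).
have [M0 M00 hM0] := dcont_bounded dm dc cphi.
have [Q [Qmono Qfull]] := exhaustion Gcount.
have SFle : exists n, forall x, SF act (F n) phi x <= c * #|` F n|%:R.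
  have [N hN] := hc; exists N => x; have := hN N (leqnn N) _ (separated1 d act r (F N) x).
  by rewrite big_seq1 ler_expR.
have [n0 hn0] := SFle; have Fp := Folner_card_gt0 FF n0.
have [all1|] := pselect (forall m, fm nu (stab_ge m) = 1).
  (* One-point separated sets bound the sums of [phi] along [F n0] by [c #|F n0|] everywhere; zero
     entropy then satisfies the claimed bound. *)
  have phic : Ex nu phi <= c.
    rewrite -(ler_pM2r Fp); apply: (@le_trans _ _ (Ex nu (SF act (F n0) phi))).
      rewrite /SF Ex_sum; last by move=> g; exact: (bmeas_act db ga).
      under eq_bigr do rewrite (Ex_act db ga)//.
      by rewrite big_const_seq count_predT iter_addr_0 mulr_natr.
    rewrite -(Ex_cst nu (c * _)); apply: Ex_le => //; last exact: bmeas_cst.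
    by apply: bmeas_sum => g; exact: (bmeas_act db ga).
  have r4 : 0 < 4 * r by lra.
  have [J [Y0 [mY0 hY0]]] := fine_label_exists dm dc db r4.
  have hY0' x y : Y0 x = Y0 y -> d x y <= 2 * r by move=> /hY0; lra.
  apply: (le_trans (h_eps_le_hrate ni mY0 hY0')); rewrite lee_fin.
  apply: (@le_trans _ _ 0); last by lra.
  apply/ler_addgt0Pr => e e0; rewrite add0r.
  pose b := Num.bound (HE nu setT Y0 / e).
  have H0 : 0 <= HE nu setT Y0 by exact: HE_ge0.
  apply: (le_trans (hrate_le_stab dm db ga FF Ginf ni (m := b.+1) _ _ mY0)) => //.
    by move=> eta; exact: (stab_ge_full Qmono Qfull (all1 _)).
  rewrite ler_pdivrMr// mulrC -ler_pdivrMr//; apply: (@le_trans _ _ b%:R); last by rewrite ler_nat.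
  by apply: ltW; rewrite archi_boundP// divr_ge0// ltW.
move=> /existsNP nall.
have ex0 : exists m, `[< fm nu (stab_ge m) <> 1 >] by have [k hk] := nall; exists k; apply/asboolP.
(* The least [m] that is not full is at least 2, because every point is in [stab_ge 0] and, through
   the unit, in [stab_ge 1]. *)
case: (ex_minnP ex0) => [[|[|k]]] /asboolP hk mink.
- exfalso; apply: hk; rewrite -(fmT nu); congr fm; apply/seteqP; split => // x _; by exists fset0.
- exfalso; apply: hk; rewrite -(fmT nu); congr fm; apply/seteqP; split => // x _.
  by exists [fset 1%g]%fset; rewrite cardfs_gt0; apply/fset0Pn; exists 1%g; rewrite !inE /= (act1 ga) !eqxx.
have full : fm nu (stab_ge k.+1) = 1.
  apply: contrapT => h; have := mink k.+1; rewrite ltnn => h'; suff : false by [].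
  by apply: h'; apply/asboolP.
have null : fm nu (stab_ge k.+2) = 0.
  by have [] := erg _ (measurable_stab_ge Qfull k.+2) (stab_ge_invariant k.+2);
    rewrite /fm => e; [rewrite e|case: hk; rewrite /fm e].
(* [tiling_bound] wants a nonnegative potential; the shift by [M0] moves [c] and the integral by the
   same amount. *)
apply/lee_addgt0Pr => e e0; pose phi' x := phi x + M0.
have cphi' : dcontinuous_real d phi' by apply: dcontD => //; exact: dcont_cst.
have Ex' : Ex nu phi' = Ex nu phi + M0 by rewrite /phi' ExD ?Ex_cst//; exact: bmeas_cst.
have stab K : fm nu [set x | (k.+1 < #|` stabset act K x|)%N] = 0.
  apply/eqP; rewrite eq_le fm_ge0 andbT -null; apply: fm_le.
  + exact: (measurable_stabset dm db ga K (fun S => (k.+1 < #|` S|)%N)).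
  + exact: (measurable_stab_ge Qfull).
  + by move=> x h; exists K.
have phiM x : 0 <= phi' x <= 2 * M0 by have := hM0 x; rewrite /phi' ler_norml => /andP[]; lra.
have cw0 : 0 <= c + M0 + w.
  suff : 0 <= c + M0 by lra.
  rewrite -(pmulr_lge0 _ Fp) mulrDl; have := hn0 point.
  suff : - (M0 * #|` F n0|%:R) <= SF act (F n0) phi point by lra.
  have -> : - (M0 * #|` F n0|%:R) = \sum_(g <- F n0) - M0.
    by rewrite big_const_seq count_predT iter_addr_0 -mulNr mulr_natr.
  by apply: ler_sum => g _; have := hM0 (act g point); rewrite ler_norml => /andP[].
have osc' x y : d x y <= r -> `|phi' x - phi' y| <= w.
  by move=> /osc; rewrite /phi' (_ : phi x + M0 - (phi y + M0) = phi x - phi y)//; ring.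
have hc' : exists N, forall n, (N <= n)%N -> forall E, Defs.separated d act (F n) r E ->
     \sum_(x <- E) expR (SF act (F n) phi' x) <= expR ((c + M0) * #|` F n|%:R).
  have [N hN] := hc; exists N => n nN E sE; have {}hN := hN n nN E sE.
  rewrite mulrDl expRD -ler_pdivrMr ?expR_gt0// mulr_suml; apply: le_trans hN.
  apply: ler_sum => x _; rewrite ler_pdivrMr ?expR_gt0// -expRD ler_expR /SF /phi' big_split /= lerD2l.
  by rewrite big_const_seq count_predT iter_addr_0 mulr_natr.
have [U [al [mal hal hr]]] := tiling_bound dm dc db ga FF Ginf ni (ltn0Sn k) stab
  (fun eta => stab_ge_full Qmono Qfull full (eta := eta)) r0 cphi' phiM cw0 osc' hc' e0.
apply: (le_trans (h_eps_le_hrate ni mal hal)); rewrite -EFinD lee_fin; apply: (le_trans hr).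
by rewrite Ex'; lra.
Qed.

End ErgodicUpperBound.

(** * Upper metric mean dimension *)

Section LimsupAtZero.
Context {R : realType}.
Implicit Types (u : R -> \bar R) (c : \bar R).

Lemma at_right0P (V : set R) : (0%R^'+ : set_system R) V <-> exists2 r : R, 0 < r & forall x, 0 < x < r -> V x.
Proof.
split=> [h|[r r0 hr]].
  have [r /= r0 hr] := (nbhs_ballP _ _).1 h; exists r => // x /andP[x0 xr].
  apply: hr => //; rewrite /ball /= sub0r normrN gtr0_norm//.
apply/nbhs_ballP; exists r => //= x; rewrite /ball /= sub0r normrN => xr x0.
by apply: hr; rewrite x0/=; apply: le_lt_trans xr; exact: ler_norm.
Qed.

Lemma limsup0_lt u c : (limf_esup u (0%R^'+) < c)%E ->
  exists2 r : R, 0 < r & forall x, 0 < x < r -> (u x < c)%E.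
Proof.
move=> /ereal_inf_lt[_ [V /at_right0P[r r0 hr] <-] h]; exists r => // x /hr Vx.
by apply: le_lt_trans h; apply: ereal_sup_ubound; exists x.
Qed.

Lemma limsup0_gt u c : (c < limf_esup u (0%R^'+))%E ->
  forall r : R, 0 < r -> exists x, 0 < x < r /\ (c < u x)%E.
Proof.
move=> h r r0; have : (c < ereal_sup (u @` [set x | (0 < x < r)%R]))%E.
  apply: (lt_le_trans h); apply: ereal_inf_lbound; exists [set x | (0 < x < r)%R] => //.
  by apply/at_right0P; exists r.
by move=> /ereal_sup_gt[_ [x xr <-] cx]; exists x.
Qed.

Lemma limsup0_le u c (r : R) : 0 < r -> (forall x, 0 < x < r -> (u x <= c)%E) ->
  (limf_esup u (0%R^'+) <= c)%E.
Proof.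
move=> r0 h; apply: (@le_trans _ _ (ereal_sup (u @` [set x | (0 < x < r)%R]))).
  by apply: ereal_inf_lbound; exists [set x | (0 < x < r)%R] => //; apply/at_right0P; exists r.
by apply: ge_ereal_sup => _ [x xr <-]; exact: h.
Qed.

Lemma limsup0_ge u c : (forall r : R, 0 < r -> exists x, 0 < x < r /\ (c <= u x)%E) ->
  (c <= limf_esup u (0%R^'+))%E.
Proof.
move=> h; apply: le_ereal_inf_tmp => _ [V /at_right0P[r r0 hr] <-].
have [x [xr cx]] := h r r0; apply: (le_trans cx); apply: ereal_sup_ubound; exists x => //; exact: hr.
Qed.

(** Reduces an inequality with possibly infinite sides to real bounds [p], for which differences
    make sense. *)
Lemma lee_dense (x y : \bar R) : (forall p : R, (y < p%:E)%E -> (x <= p%:E)%E) -> (x <= y)%E.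
Proof.
move=> h; case: y h => [y| |] h; last 2 first.
- exact: leey.
- case: x h => [x| |] h //.
    by have := h (x - 1)%R; rewrite ltNyr => /(_ isT); rewrite lee_fin => h'; exfalso; lra.
  by have := h 0; rewrite ltNyr => /(_ isT).
apply/lee_addgt0Pr => e e0; apply: h; rewrite lte_fin; lra.
Qed.

Lemma lee_dense_lt (x y : \bar R) : (forall p : R, (p%:E < x)%E -> (p%:E <= y)%E) -> (x <= y)%E.
Proof.
move=> h; rewrite -leeN2; apply: lee_dense => p; rewrite lteNl => hp.
by rewrite leeNl; apply: h.
Qed.

End LimsupAtZero.

Section MeanDimension.
Context {R : realType} {G : groupType} {disp : measure_display} {X : measurableType disp}.
Variable d : X -> X -> R.
Variable act : G -> X -> X.
Hypothesis dm : is_metric d.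
Hypothesis dc : dcompact d.
Hypothesis db : borel_for_d d.
Hypothesis ga : G_action d act.
Local Notation mact := (measurable_act db ga).
Variable F : nat -> {fset G}.
Hypothesis FF : Folner R F.
Hypothesis Gcount : exists e : G -> nat, injective e.
Hypothesis Ginf : exists e : nat -> G, injective e.

Lemma pressure_lt phi (r c : R) : dcontinuous_real d phi -> 0 < r -> (pressure d act phi F r < c%:E)%E ->
  exists N, forall n, (N <= n)%N -> forall E, Defs.separated d act (F n) r E ->
     \sum_(x <- E) expR (SF act (F n) phi x) <= expR (c * #|` F n|%:R).
Proof.
move=> cphi r0 /ereal_inf_lt[_ [V [N _ hN] <-] h]; exists N => n nN E sE.
apply: (le_trans (sum_le_PF dm dc db cphi r0 sE)).
have Fp := Folner_card_gt0 FF n; have Pp := PF_gt0 act dm dc db cphi r0 (F n).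
rewrite -[leLHS]lnK ?posrE// ler_expR -ler_pdivrMr// -lee_fin; apply: ltW; apply: le_lt_trans h.
by apply: ereal_sup_ubound; exists n => //; exact: hN.
Qed.

Lemma pressure_ge phi (r c : R) : dcontinuous_real d phi -> 0 < r -> (forall x, c <= phi x) ->
  (c%:E <= pressure d act phi F r)%E.
Proof.
move=> cphi r0 hc; apply: le_ereal_inf_tmp => _ [V [N _ hN] <-].
apply: le_ereal_sup_tmp; eexists; first by exists N => //; exact: (hN N (leqnn N)).
have Fp := Folner_card_gt0 FF N; have Pp := PF_gt0 act dm dc db cphi r0 (F N).
rewrite lee_fin ler_pdivlMr// -ler_expR lnK ?posrE//.
apply: le_trans (sum_le_PF dm dc db cphi r0 (separated1 d act r (F N) point)).
rewrite big_seq1 ler_expR mulr_natr /SF.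
have -> : c *+ #|` F N| = \sum_(g <- F N) c by rewrite big_const_seq count_predT iter_addr_0.
exact: ler_sum.
Qed.

(** A partition of diameter at most [e < r] is a fine label at scale [r], so the window bounds
    control its mean entropy and thus the infimum. *)
Lemma Good_h_eps phi (r c e : R) nu : Good d act phi r c nu -> e < r ->
  ((c - Ex nu phi)%:E <= h_eps d act nu F e)%E.
Proof.
move=> [ni hG] er; apply: le_ereal_inf_tmp => _ [k [A [pA dA ->]]].
have [mA [disj cov]] := pA.
have cov' x : {i | A i x}.
  by apply: cid; have : [set: X] x by []; rewrite -cov => -[i _ Ai]; exists i.
pose Y x := sval (cov' x); have YA x : A (Y x) x := svalP (cov' x).
have AY i x : A i x -> Y x = i.
  move=> Ai; apply/eqP/negPn/negP => ne; have := disj _ _ ne.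
  by move=> /seteqP[/(_ x (conj (YA x) Ai))].
have mY : mlab Y.
  move=> i; rewrite (_ : _ @^-1` _ = A i)//; apply/seteqP; split => x /=; last exact: AY.
  by move=> <-.
rewrite (h_part_hrate mact ni (actM ga) FF pA mY); last first.
  move=> x y; split; last by move=> [i /AY -> /AY ->].
  by move=> e'; exists (Y x) => //; rewrite e'.
rewrite lee_fin; apply: hrate_ge => K K0; rewrite lerBlDr; apply: hG => //.
exists e => // x y e'; rewrite -lee_fin; apply: le_trans dA.
apply: (@le_trans _ _ (diam d (A (Y x)))); last by rewrite /diam_part; apply: le_bigmax_cond.
apply: ereal_sup_ubound; exists (x, y) => //; split => //=; by rewrite e'.
Qed.

Variable f : X -> R.
Hypothesis cf : dcontinuous_real d f.

Let pot_cont (c : R) : dcontinuous_real d (fun x => f x * c).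
Proof. by rewrite (_ : (fun x => _) = fun x => c * f x); [exact: dcontZ|apply/funext => x; rewrite mulrC]. Qed.

Let Ex_pot nu (c : R) : Ex nu (fun x => f x * c) = c * Ex nu f.
Proof.
rewrite -(ExZ nu c (dcont_bmeas dm db dc cf)); congr Ex; by apply/funext => x; rewrite mulrC.
Qed.

(** The entropy bound at scale [x] comes from the pressure at scale [x / 2], whose normalisation
    [ln (2 / x)] exceeds [ln (1 / x)] by the negligible [ln 2]. The bound is affine in the ergodic
    measure and can be averaged over the components. *)
Lemma umdim_mu_le (mu : probability X R) (p : R) : (umdim_pot d act f F < p%:E)%E ->
  (umdim_mu d act mu F <= (p - Ex mu f)%:E)%E.
Proof.
move=> hp; apply: ge_ereal_sup => _ [mus [D [hD w ->]]].
have bf := dcont_bmeas dm db dc cf.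
(* One [gm] each for the oscillation of [f], for the weak convergence of its integrals, and for the
   [ln 2] from halving the scale. *)
apply/lee_addgt0Pr => g g0; pose gm := g / 3; have gm0 : 0 < gm by rewrite /gm; lra.
have [r1 r10 hr1] := limsup0_lt hp.
have [r2 r20 hr2] := dcont_unif dm dc cf gm0.
have [r3 r30 hr3] : exists2 r, 0 < r & forall x, 0 < x < r -> `|Ex mu f - Ex (mus x) f| < gm.
  have : (fun eps => (Ex (mus eps) f)%:E) @ 0%R^'+ --> (Ex mu f)%:E.
    by have := w f cf; rewrite ExE//; under eq_fun do rewrite ExE//.
  by move=> /fine_cvgP[_ /cvgrPdist_lt/(_ _ gm0)] /at_right0P.
have [M M0 hM] := dcont_bounded dm dc cf.
pose B := `|p| + gm + M; have l2 : 0 < ln 2 :> R by rewrite ln_gt0// ltr1n.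
have B0 : 0 <= B by rewrite /B !addr_ge0// ltW.
(* Below [r4] the term [ln 2 * B] is at most [gm * ln x^-1], where [B] bounds
   [p + gm - Ex (mus x) f]. *)
pose r4 : R := expR (- (ln 2 * B / gm + 1)); have r40 : 0 < r4 by exact: expR_gt0.
have r0 : 0 < Num.min r1 (Num.min r2 (Num.min r3 r4)) by rewrite !lt_min r10 r20 r30.
apply: (limsup0_le r0) => x; rewrite !lt_min => /andP[x0 /and4P[x1 x2 x3 x4]].
have xN : x^-1 \is Num.pos by rewrite posrE invr_gt0.
pose l := ln x^-1.
have hl : ln 2 * B / gm + 1 < l.
  rewrite /l lnV ?posrE// ltrNr -(expRK (- _)) ltr_ln ?posrE ?expR_gt0//.
have l0 : 0 < l.
  apply: le_lt_trans hl; rewrite addr_ge0// divr_ge0 ?(ltW gm0)// mulr_ge0// ltW//.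
pose l' := ln (x / 2)^-1.
have ll : l' = l + ln 2.
  by rewrite /l' /l !lnV ?posrE ?divr_gt0// ln_div ?posrE//; ring.
have l'0 : 0 < l' by rewrite ll addr_gt0.
have hx2 : 0 < x / 2 by rewrite divr_gt0.
have [Dl D1 De _ Dm] := hD x x0.
have hE : Ex (mus x) f = \sum_i @cd_lam _ _ _ (D x) i * Ex (@cd_nu _ _ _ (D x) i) f.
  by apply: Ex_mix => // i; exact: ltW.
have hh i : (h_eps d act (@cd_nu _ _ _ (D x) i) F x <= (l' * (p + gm - Ex (@cd_nu _ _ _ (D x) i) f))%:E)%E.
  have pl : (pressure d act (fun y => (f y * ln (x / 2)^-1)%R) F (x / 2) < (p * l')%:E)%E.
    have hx21 : 0 < x / 2 < r1 by rewrite hx2 /=; lra.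
    by have := hr1 _ hx21; rewrite -/l' lte_pdivrMr.
  have osc u v : d u v <= x / 2 -> `|f u * ln (x / 2)^-1 - f v * ln (x / 2)^-1| <= l' * gm.
    move=> uv; rewrite -mulrBl normrM mulrC -/l' (gtr0_norm l'0) ler_pM2l//; apply: ltW.
    by apply: hr2; apply: (le_lt_trans uv); lra.
  have := ergodic_entropy_le dm dc db ga FF Gcount Ginf (De i) hx2 (@pot_cont (ln (x / 2)^-1)) osc
    (pressure_lt (@pot_cont _) hx2 pl).
  rewrite Ex_pot mulrC divfK// => /le_trans; apply; rewrite lee_fin -/l'.
  by rewrite le_eqVlt; apply/orP; left; apply/eqP; ring.
have hF : (F_co d act F (D x) x <= (l' * (p + gm - Ex (mus x) f))%:E)%E.
  apply: (@le_trans _ _ (\sum_(i < cd_k (D x)) (@cd_lam _ _ _ (D x) i * (l' * (p + gm - Ex (@cd_nu _ _ _ (D x) i) f)))%:E)%E).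
    by apply: lee_sum => i _; rewrite EFinM lee_wpmul2l// lee_fin ltW.
  rewrite sumEFin lee_fin hE; rewrite le_eqVlt; apply/orP; left; apply/eqP.
  transitivity (\sum_i (@cd_lam _ _ _ (D x) i * (l' * (p + gm)) - l' * (@cd_lam _ _ _ (D x) i * Ex (@cd_nu _ _ _ (D x) i) f))).
    by apply: eq_bigr => i _; ring.
  by rewrite sumrB -mulr_suml D1 -mulr_sumr; ring.
apply: (@le_trans _ _ ((l' * (p + gm - Ex (mus x) f))%:E * l^-1%:E)%E).
  by rewrite lee_wpmul2r// lee_fin invr_ge0 ltW.
rewrite -EFinM -EFinD lee_fin ler_pdivrMr// ll.
have hEx : `|Ex (mus x) f| <= M by exact: Ex_abs_le.
have hA : p + gm - Ex (mus x) f <= B.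
  have := ler_norm p; have := hEx; rewrite ler_norml /B => /andP[]; lra.
have hA2 : ln 2 * (p + gm - Ex (mus x) f) <= gm * l.
  apply: (@le_trans _ _ (ln 2 * B)); first by rewrite ler_pM2l.
  by rewrite [leRHS]mulrC -ler_pdivrMr//; apply: (le_trans _ (ltW hl)); rewrite lerDl.
have hA3 : p + gm - Ex (mus x) f <= p - Ex mu f + 2 * gm.
  have := hr3 x; rewrite x0 x3 => /(_ isT); rewrite ltr_norml => /andP[]; lra.
have := ler_wpM2r (ltW l0) hA3.
have -> : (p - Ex mu f + g) = p - Ex mu f + 2 * gm + gm by rewrite /gm; field.
by rewrite mulrDl; move: hA2; lra.
Qed.

End MeanDimension.

(** * Attainment of the maximum along decreasing scales *)

Section LowerBound.
Context {R : realType} {G : groupType} {disp : measure_display} {X : measurableType disp}.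
Variable d : X -> X -> R.
Variable act : G -> X -> X.
Hypothesis dm : is_metric d.
Hypothesis dc : dcompact d.
Hypothesis db : borel_for_d d.
Hypothesis ga : G_action d act.
Variable F : nat -> {fset G}.
Hypothesis FF : Folner R F.
Hypothesis Ginf : exists e : nat -> G, injective e.
Variable f : X -> R.
Hypothesis cf : dcontinuous_real d f.

Let pot_cont (c : R) : dcontinuous_real d (fun x => f x * c).
Proof. by rewrite (_ : (fun x => _) = fun x => c * f x); [exact: dcontZ|apply/funext => x; rewrite mulrC]. Qed.

Let Ex_pot nu (c : R) : Ex nu (fun x => f x * c) = c * Ex nu f.
Proof.
rewrite -(ExZ nu c (dcont_bmeas dm db dc cf)); congr Ex; by apply/funext => x; rewrite mulrC.
Qed.

Lemma lnV_gt0 (x : R) : 0 < x < 1 -> 0 < ln x^-1.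
Proof. by move=> /andP[x0 x1]; rewrite ln_gt0// invf_gt1. Qed.

(** One-point separated sets already give the value [- M]. A value above [-oo] is needed to approach
    it from below by reals. *)
Lemma umdim_pot_ninfty : (-oo < umdim_pot d act f F)%E.
Proof.
have [M M0 hM] := dcont_bounded dm dc cf.
apply: (@lt_le_trans _ _ (- M)%:E); first exact: ltNyr.
apply: limsup0_ge => r r0; exists (Num.min r 1 / 2).
have m0 : 0 < Num.min r 1 by rewrite lt_min r0 ltr01.
have mr : Num.min r 1 <= r by rewrite ge_min lexx.
have m1 : Num.min r 1 <= 1 by rewrite ge_min lexx orbT.
set x := Num.min r 1 / 2; have x0 : 0 < x by rewrite /x; lra.
split; first by rewrite x0 /= /x; lra.
have l0 : 0 < ln x^-1 by apply: lnV_gt0; rewrite x0 /x; lra.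
rewrite lee_pdivlMr//; apply: (pressure_ge act dm dc db FF (@pot_cont _)) => // y.
by rewrite ler_pM2r//; have := hM y; rewrite ler_norml => /andP[].
Qed.

Lemma approx_from_below (P : \bar R) : (-oo < P)%E -> exists t : nat -> R,
  (forall k, ((t k)%:E < P)%E) /\
  forall q : R, (q%:E < P)%E -> exists K, forall k, (K <= k)%N -> q <= t k.
Proof.
case: P => [p| |] //= _.
  exists (fun k => p - k.+1%:R^-1); split => [k|q]; first by rewrite lte_fin ltrBlDr ltrDl invr_gt0.
  rewrite lte_fin => qp; exists (Num.bound (p - q)^-1) => k Kk /=.
  rewrite lerBrDr -lerBrDl.
  have pq : 0 < p - q by rewrite subr_gt0.
  rewrite invf_ple ?posrE//; apply: ltW; apply: (@lt_le_trans _ _ (Num.bound (p - q)^-1)%:R).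
    by rewrite archi_boundP// invr_ge0 ltW.
  by rewrite ler_nat; exact: leqW.
exists (fun k => k%:R); split => [k|q _]; first exact: ltry.
exists (Num.bound `|q|) => k Kk; apply: (le_trans (ler_norm _)); apply: ltW.
apply: (@lt_le_trans _ _ (Num.bound `|q|)%:R); first by rewrite archi_boundP.
by rewrite ler_nat.
Qed.

Lemma ergodic_at_scale (t delta : R) : (t%:E < umdim_pot d act f F)%E -> 0 < delta <= 1 ->
  exists p : R * probability X R, [/\ 0 < p.1 < delta, G_ergodic act p.2 &
    forall e, e < p.1 -> ((ln p.1^-1 * (t - Ex p.2 f))%:E <= h_eps d act p.2 F e)%E].
Proof.
move=> ht /andP[dl0 dl1]; have [x [/andP[x0 xd] hx]] := limsup0_gt ht dl0.
have l0 : 0 < ln x^-1 by apply: lnV_gt0; rewrite x0 (lt_le_trans xd).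
move: hx; rewrite lte_pdivlMr// => hx.
have [mu0 hmu0] := pressure_Good dm dc db ga (@pot_cont _) x0 FF hx.
have [nu [enu hnu]] := ergodic_Good dm dc db ga (@pot_cont _) x0 FF Ginf hmu0.
exists (x, nu); split => //=; first by rewrite x0.
move=> e ex; have := Good_h_eps db ga FF hnu ex; rewrite Ex_pot.
by rewrite [X in (X%:E <= _)%E -> _](_ : _ = ln x^-1 * (t - Ex nu f)) //; ring.
Qed.

(** Each scale is chosen below the previous one and below [1 / (k + 1)]; strict decrease lets a
    scale determine its index. *)
Lemma ergodic_sequence (t : nat -> R) : (forall k, ((t k)%:E < umdim_pot d act f F)%E) ->
  exists (eps : nat -> R) (nu : nat -> probability X R),
  [/\ forall k, 0 < eps k < k.+1%:R^-1, {homo eps : m n / (m < n)%N >-> n < m},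
      forall k, G_ergodic act (nu k) &
      forall k e, e < eps k -> ((ln (eps k)^-1 * (t k - Ex (nu k) f))%:E <= h_eps d act (nu k) F e)%E].
Proof.
move=> ht.
have [pk hpk] : exists pk : nat * R -> R * probability X R, forall kd, 0 < kd.2 <= 1 ->
   [/\ 0 < (pk kd).1 < kd.2, G_ergodic act (pk kd).2 &
    forall e, e < (pk kd).1 -> ((ln (pk kd).1^-1 * (t kd.1 - Ex (pk kd).2 f))%:E <= h_eps d act (pk kd).2 F e)%E].
  suff h kd : exists p : R * probability X R, 0 < kd.2 <= 1 -> [/\ 0 < p.1 < kd.2, G_ergodic act p.2 &
    forall e, e < p.1 -> ((ln p.1^-1 * (t kd.1 - Ex p.2 f))%:E <= h_eps d act p.2 F e)%E].
    by exists (fun kd => sval (cid (h kd))) => kd; exact: (svalP (cid (h kd))).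
  case: (pselect (0 < kd.2 <= 1)) => [h|h]; last by exists (1, \d_point : probability X R).
  by have [p hp] := ergodic_at_scale (ht kd.1) h; exists p.
pose fix s k := if k is k'.+1 then pk (k, Num.min (s k').1 k.+1%:R^-1) else pk (0%N, 1).
pose dl k := if k is k'.+1 then Num.min (s k').1 k.+1%:R^-1 else 1.
have sE k : s k = pk (k, dl k) by case: k.
have inv1 k : 0 < (k.+1%:R^-1 : R) <= 1 by rewrite invr_gt0 ltr0n /= invf_le1// ler1n.
have dl01 k : 0 < dl k <= 1.
  elim: k => [|k IH]; first by rewrite ltr01 lexx.
  have [/andP[h _] _ _] := hpk (k, dl k) IH; rewrite -sE in h.
  by have /andP[i1 i2] := inv1 k.+1; rewrite /dl lt_min h i1 /= ge_min i2 orbT.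
have all k := hpk (k, dl k) (dl01 k).
exists (fun k => (s k).1), (fun k => (s k).2); split.
- move=> k; have [/andP[h1 h2] _ _] := all k; rewrite -sE /= in h1 h2; rewrite h1 /=.
  apply: (lt_le_trans h2); case: (k) => [|k'] /=; first by rewrite invr1.
  by rewrite ge_min lexx orbT.
- apply: (homo_ltn (r := fun a b => b < a)) => [y x z h1 h2|k]; first exact: lt_trans h2 h1.
  have [/andP[_ h2] _ _] := all k.+1; rewrite -sE in h2; apply: (lt_le_trans h2).
  by rewrite /= ge_min lexx.
- by move=> k; have [_ h _] := all k; rewrite sE.
- by move=> k; have [_ _ h] := all k; rewrite sE.
Qed.

(** The sequence is turned into a family over all scales by the step function [idx], each member
    having a single ergodic component. Weak convergence holds for the whole family, while the limsup
    is tested only at the scales [e k]. *)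
Lemma umdim_pot_attained : exists2 mu : probability X R, G_invariant act mu &
  (umdim_pot d act f F <= umdim_mu d act mu F + (Ex mu f)%:E)%E.
Proof.
have [t [htP htq]] := approx_from_below umdim_pot_ninfty.
have [eps0 [nu0 [heps0 mono0 erg0 hent0]]] := ergodic_sequence htP.
have [s [smono [mu wmu]]] := weak_compact dm dc db nu0.
have sge k : (k <= s k)%N.
  by elim: k => // k IH; apply: (leq_ltn_trans IH); exact: smono.
(* Half of [eps0 (s k)], because the entropy bound holds strictly below that scale; this again costs
   [ln 2]. *)
pose e k := eps0 (s k) / 2; pose nu k := nu0 (s k).
have e0 k : 0 < e k by have /andP[h _] := heps0 (s k); rewrite /e divr_gt0.
have emono k j : (k < j)%N -> e j < e k.
  by move=> kj; rewrite /e ltr_pM2r ?invr_gt0//; apply: mono0; exact: smono.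
have eps_small (r : R) : 0 < r -> exists K, forall k, (K <= k)%N -> eps0 (s k) < r.
  move=> r0; exists (Num.bound r^-1) => k Kk; have /andP[_ h] := heps0 (s k); apply: (lt_le_trans h).
  rewrite invf_ple ?posrE//; apply: ltW; apply: (@lt_le_trans _ _ (Num.bound r^-1)%:R).
    by rewrite archi_boundP// invr_ge0 ltW.
  by rewrite ler_nat; apply: leqW; exact: (leq_trans Kk).
have e_small (r : R) : 0 < r -> exists K, forall k, (K <= k)%N -> e k < r.
  move=> /eps_small[K hK]; exists K => k /hK h; apply: le_lt_trans h.
  by have := e0 k; rewrite /e; lra.
(* [idx x] is the least index whose scale is at most [x]: it returns [k] at [e k] and tends to
   infinity as [x] tends to 0. *)
have [idx hidx] : exists idx : R -> nat, forall x, 0 < x -> e (idx x) <= x /\ forall k, e k <= x -> (idx x <= k)%N.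
  suff h x : exists i, 0 < x -> e i <= x /\ forall k, e k <= x -> (i <= k)%N.
    by exists (fun x => sval (cid (h x))) => x; exact: (svalP (cid (h x))).
  case: (pselect (0 < x)) => x0; last by exists 0%N.
  have [K /(_ K (leqnn K)) /ltW eK] := e_small x x0.
  have [i ei hi] := ex_minnP (ex_intro (fun k => e k <= x) K eK).
  by exists i.
have idxe k : idx (e k) = k.
  have [h1 h2] := hidx (e k) (e0 k); apply/eqP; rewrite eqn_leq h2//=.
  by rewrite leqNgt; apply/negP => /emono; rewrite ltNge h1.
have idx_large K x : 0 < x -> x < e K -> (K <= idx x)%N.
  move=> x0 xK; have [h1 _] := hidx x x0; rewrite leqNgt; apply/negP => /emono h.
  by have := lt_trans xK h; rewrite ltNge h1.
have bf := dcont_bmeas dm db dc cf.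
exists mu; first by apply: (wconv_invariant dm dc db ga _ wmu) => k; have [] := erg0 (s k).
apply: lee_dense_lt => q hq.
suff h : ((q - Ex mu f)%:E <= umdim_mu d act mu F)%E.
  by have := leeD2r (Ex mu f)%:E h; rewrite -EFinD subrK.
pose mus x := nu (idx x).
pose D (x : R) : co_decomp R X := @CoDecomp R disp X 1 (fun=> 1) (fun=> mus x).
apply: (@le_trans _ _ (limf_esup (fun eps : R => (F_co d act F (D eps) eps * ((ln eps^-1)^-1)%:E)%E) (0%R^'+))); last first.
  apply: ereal_sup_ubound; exists mus, D; split => //.
    move=> x x0; split => //=.
    - by rewrite big_ord1.
    - by move=> i; exact: erg0.
    - by move=> i j _; rewrite !ord1.
    - by move=> A mA; rewrite big_ord1 mul1e.
  move=> psi cpsi; have bpsi := dcont_bmeas dm db dc cpsi.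
  rewrite ExE//; under eq_fun do rewrite ExE//.
  apply: cvg_EFin; first by apply: nearW.
  apply/cvgrPdist_lt => g g0; have /cvgrPdist_lt/(_ _ g0)[K _ hK] := wmu psi cpsi.
  by apply/at_right0P; exists (e K) => // x /andP[x0 xK]; apply: hK; exact: idx_large.
apply: lee_dense_lt => p; rewrite lte_fin => pq; apply: limsup0_ge => r r0.
pose g := (q - Ex mu f - p) / 2; have g0 : 0 < g by rewrite /g; lra.
have l2 : 0 < ln 2 :> R by rewrite ln_gt0// ltr1n.
have [K1 hK1] := e_small r r0.
(* At such scales [ln (1 / eps0)] exceeds [|p| ln 2 / g], which absorbs the passage from [eps0] to
   [eps0 / 2]. *)
have [K2 hK2] := eps_small (expR (- (`|p| * ln 2 / g))) (expR_gt0 _).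
have [K3 hK3] := htq q hq.
have /cvgrPdist_lt/(_ _ g0)[K4 _ hK4] := wmu f cf.
pose k := maxn (maxn K1 K2) (maxn K3 K4).
have k1 : (K1 <= k)%N by rewrite /k -maxnA leq_maxl.
have k2 : (K2 <= k)%N by rewrite /k !leq_max leqnn orbT.
have k3 : (K3 <= k)%N by rewrite /k !leq_max leqnn !orbT.
have k4 : (K4 <= k)%N by rewrite /k !leq_max leqnn !orbT.
exists (e k); split; first by rewrite e0 hK1.
have /andP[ep0 ep1] := heps0 (s k).
pose l := ln (eps0 (s k))^-1.
have hl : `|p| * ln 2 / g < l.
  by rewrite /l lnV ?posrE// ltrNr -(expRK (- _)) ltr_ln ?posrE ?expR_gt0// hK2.
have l0 : 0 < l by apply: le_lt_trans hl; rewrite divr_ge0 ?(ltW g0)// mulr_ge0// ltW.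
have le_ : ln (e k)^-1 = l + ln 2.
  by rewrite /l /e !lnV ?posrE ?divr_gt0// ln_div ?posrE//; ring.
rewrite le_ lee_pdivlMr ?addr_gt0// /F_co /= big_ord1 mul1e /mus idxe.
have ek : e k < eps0 (s k) by rewrite /e; lra.
apply: le_trans (hent0 (s k) (e k) ek); rewrite -EFinM lee_fin -/l.
have t1 : q <= t (s k) by apply: hK3; exact: leq_trans (sge k).
have t2 : Ex (nu0 (s k)) f <= Ex mu f + g.
  by have := hK4 k k4; rewrite /= ltr_norml => /andP[]; lra.
have t3 : p * ln 2 <= g * l.
  apply: (@le_trans _ _ (`|p| * ln 2)); first by rewrite ler_wpM2r ?ler_norm// ltW.
  by rewrite [leRHS]mulrC -ler_pdivrMr// ltW.
have : l * (p + g) <= l * (t (s k) - Ex (nu0 (s k)) f).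
  by rewrite ler_pM2l// /g; rewrite /g in t2; lra.
by move: t3; lra.
Qed.

End LowerBound.

Theorem theorem4p6 (R : realType) (G : groupType)
  (disp : measure_display) (X : measurableType disp)
  (d : X -> X -> R) (act : G -> X -> X) (F : nat -> {fset G}) (f : X -> R) :
  countably_infinite_group G ->
  is_metric d -> dcompact d -> borel_for_d d ->
  G_action d act ->
  Folner R F -> tempered R F ->
  dcontinuous_real d f ->
  umdim_pot d act f F =
    ereal_sup [set (umdim_mu d act mu F + \int[mu]_x (f x)%:E)%E
               | mu in [set mu : probability X R | G_invariant act mu]] /\
  exists2 mu : probability X R, G_invariant act mu &
    (umdim_mu d act mu F + \int[mu]_x (f x)%:E)%E = umdim_pot d act f F.
Proof.
move=> [Gcount Ginf] dm dc db ga FF _ cf.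
have bf := dcont_bmeas dm db dc cf.
have ub (mu : probability X R) : (umdim_mu d act mu F + \int[mu]_x (f x)%:E <= umdim_pot d act f F)%E.
  rewrite ExE//; apply: lee_dense => p hp.
  have := leeD2r (Ex mu f)%:E (umdim_mu_le dm dc db ga FF Gcount Ginf cf mu hp).
  by rewrite -EFinD subrK.
have [mu mi hmu] := umdim_pot_attained dm dc db ga FF Ginf cf.
have e : (umdim_mu d act mu F + \int[mu]_x (f x)%:E)%E = umdim_pot d act f F.
  by apply/eqP; rewrite eq_le ub ExE.
split; last by exists mu.
apply/eqP; rewrite eq_le; apply/andP; split.
  by rewrite -e; apply: ereal_sup_ubound; exists mu.
by apply: ge_ereal_sup => _ [mu' _ <-].
Qed.
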